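(* Let $\mathcal{T}_h$ be a regular triangulation of a bounded polyhedral Lipschitz domain $\Omega\subset\mathbb{R}^d$ with boundary partition $\partial\Omega=\Gamma_D\cup\Gamma_N$. Let $\overline{u}_h\in\Pi_h\,\mathcal{S}^{1,cr}_D(\mathcal{T}_h)$ and let $\phi\in C(\mathbb{R}^d)$ be convex. Then $$\inf\Big\{\int_\Omega\phi(\nabla_h u_h)\,dx:\ u_h\in\mathcal{S}^{1,cr}_D(\mathcal{T}_h),\ \Pi_h u_h=\overline{u}_h\Big\}\ \ge\ \sup\Big\{-\int_\Omega\phi^*(\Pi_h z_h)\,dx-(\overline{u}_h,\operatorname{div} z_h):\ z_h\in\mathcal{R}T^0_N(\mathcal{T}_h)\Big\}.$$ If $\phi\in C^1(\mathbb{R}^d)$ and the infimum is finite, then equality holds.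
   Context: Let $d$ be a positive integer and $\Omega\subset\mathbb{R}^d$ a bounded polyhedral Lipschitz domain (in particular connected). Let $\mathcal{T}_h$ be a regular (conforming, finite) triangulation of $\Omega$ into closed nondegenerate $d$-simplices, called elements. $\mathcal{S}_h$ is the set of sides ($(d-1)$-dimensional faces) of elements; $x_S$ and $x_T$ are the barycenters (midpoints) of a side $S$ and an element $T$. The boundary $\partial\Omega$ is partitioned into $\Gamma_D$ and $\Gamma_N$: $\Gamma_D$ is a (possibly empty) union of boundary sides and $\Gamma_N$ is the union of the remaining boundary sides (possibly empty). $n$ is the outer unit normal on $\partial\Omega$, and $(\cdot,\cdot)$ is the $L^2(\Omega)$ inner product. $P_k(T)$ is the set of polynomials of total degree at most $k$ on $T$, and $\mathcal{L}^k(\mathcal{T}_h)^\ell=\{w_h\in L^\infty(\Omega;\mathbb{R}^\ell): w_h|_T\in P_k(T)$ (componentwise) for all $T\in\mathcal{T}_h\}$; the superscript $\ell$ is omitted if $\ell=1$. $\Pi_h:L^1(\Omega;\mathbb{R}^\ell)\to\mathcal{L}^0(\mathcal{T}_h)^\ell$ is the $L^2$ projection onto elementwise constants, i.e. $\Pi_h v|_T=|T|^{-1}\int_T v\,dx$. Crouzeix--Raviart space: $\mathcal{S}^{1,cr}(\mathcal{T}_h)=\{v_h\in\mathcal{L}^1(\mathcal{T}_h): v_h$ is continuous at $x_S$ for all $S\in\mathcal{S}_h\}$ (for an interior side, the values at $x_S$ from the two adjacent elements agree), and $\mathcal{S}^{1,cr}_D(\mathcal{T}_h)=\{v_h\in\mathcal{S}^{1,cr}(\mathcal{T}_h):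 v_h(x_S)=0$ for all $S\in\mathcal{S}_h$ with $S\subset\Gamma_D\}$. The elementwise gradient $\nabla_h v_h\in\mathcal{L}^0(\mathcal{T}_h)^d$ is defined by $\nabla_h v_h|_T=\nabla(v_h|_T)$. Raviart--Thomas space: $\mathcal{R}T^0(\mathcal{T}_h)=\{y_h\in H(\operatorname{div};\Omega): y_h|_T(x)=a_T+b_T(x-x_T),\ a_T\in\mathbb{R}^d,\ b_T\in\mathbb{R},$ for all $T\in\mathcal{T}_h\}$, where $H(\operatorname{div};\Omega)$ is the set of $L^2$ vector fields with distributional divergence in $L^2(\Omega)$, and $\mathcal{R}T^0_N(\mathcal{T}_h)=\{y_h\in\mathcal{R}T^0(\mathcal{T}_h): y_h\cdot n=0$ on $\Gamma_N\}$. The convex conjugate of $\phi:\mathbb{R}^d\to\mathbb{R}$ is $\phi^*(s)=\sup_{r\in\mathbb{R}^d}\big(s\cdot r-\phi(r)\big)\in\mathbb{R}\cup\{+\infty\}$. Infima and suprema are taken in the extended real line. *)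

(* Defs.v *)
From HB Require Import structures.
From mathcomp Require Import all_boot all_order all_algebra.
From mathcomp Require Import all_classical all_reals all_analysis.

Set Implicit Arguments.
Unset Strict Implicit.
Unset Printing Implicit Defensive.
Import Order.TTheory GRing.Theory Num.Theory.
Import numFieldNormedType.Exports.
Local Open Scope classical_set_scope.
Local Open Scope ring_scope.

(* Row vectors carry the sigma-algebra generated by the coordinate maps, as
   the library does for n.-tuple. On R^n it is the Borel sigma-algebra. *)
Definition measure_rV_display : measure_display.
Proof. exact: default_measure_display. Qed.

Section measurable_rV.
Context (R : realType) (n : nat).

Definition rV_coord (i : 'I_n) (x : 'rV[R]_n) : R := x ord0 i.

Let rV_set0 : g_sigma_preimage rV_coord set0.
Proof. exact: sigma_algebra0. Qed.

Let rV_setC A : g_sigma_preimage rV_coord A -> g_sigma_preimage rV_coord (~` A).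
Proof. exact: sigma_algebraC. Qed.

Let rV_bigcup (F : (set 'rV[R]_n)^nat) :
  (forall i, g_sigma_preimage rV_coord (F i)) ->
  g_sigma_preimage rV_coord (\bigcup_i (F i)).
Proof. exact: sigma_algebra_bigcup. Qed.

HB.instance Definition _ := @isMeasurable.Build
  measure_rV_display 'rV[R]_n
  (g_sigma_preimage rV_coord) rV_set0 rV_setC rV_bigcup.

End measurable_rV.

Section lebesgue_rV.
Context (R : realType).

Lemma measurable_rV_coord n (i : 'I_n) : measurable_fun setT (@rV_coord R n i).
Proof.
move=> _ A mA; apply: sub_sigma_algebra.
by case: n i => [[]//|n] i; rewrite -bigcup_mkord_ord; exists i;
  [exact: ltn_ord | exists A => //; rewrite inord_val].
Qed.

Lemma measurable_fun_rV d (T : measurableType d) n (f : T -> 'rV[R]_n) :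
  (forall i, measurable_fun setT (rV_coord i \o f)) -> measurable_fun setT f.
Proof.
move=> mf _ A mA; rewrite setTI; move: A mA.
pose S : set (set 'rV[R]_n) := [set A | measurable (f @^-1` A)].
suff : (measurable : set (set 'rV[R]_n)) `<=` S by [].
apply: smallest_sub.
  split; first by rewrite /S /= preimage_set0.
    by move=> A; rewrite /S /= setTD preimage_setC => /measurableC.
  by move=> F mF; rewrite /S /= preimage_bigcup; exact: bigcupT_measurable.
case: n => [|n] in f mf S *; first by rewrite big_ord0.
rewrite -bigcup_mkord_ord; apply: bigcup_sub => i _ _ [B mB <-].
by rewrite /S /= setTI -comp_preimage -[X in measurable X]setTI; exact: mf.
Qed.

Definition rV_cons n (p : measurableTypeR R * 'rV[R]_n) : 'rV[R]_n.+1 :=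
  \row_i if unlift ord0 i is Some j then p.2 ord0 j else p.1.

Definition rV_uncons n (x : 'rV[R]_n.+1) : measurableTypeR R * 'rV[R]_n :=
  (x ord0 ord0, \row_i x ord0 (lift ord0 i)).

Lemma rV_cons0 n p : @rV_cons n p ord0 ord0 = p.1.
Proof. by rewrite mxE unlift_none. Qed.

Lemma rV_consS n p i : @rV_cons n p ord0 (lift ord0 i) = p.2 ord0 i.
Proof. by rewrite mxE liftK. Qed.

Lemma rV_consK n : cancel (@rV_cons n) (@rV_uncons n).
Proof.
move=> [a v]; congr pair; first exact: rV_cons0.
by apply/rowP => i; rewrite mxE rV_consS.
Qed.

Lemma rV_unconsK n : cancel (@rV_uncons n) (@rV_cons n).
Proof.
move=> x; apply/rowP => i; case: (unliftP ord0 i) => [j|] ->.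
  by rewrite rV_consS mxE.
exact: rV_cons0.
Qed.

Lemma measurable_rV_cons n : measurable_fun setT (@rV_cons n).
Proof.
apply: measurable_fun_rV => i; case: (unliftP ord0 i) => [j|] ->.
  rewrite (_ : _ \o _ = rV_coord j \o snd).
    by apply: measurableT_comp => //; exact: measurable_rV_coord.
  by apply/funext => p; rewrite /= /rV_coord rV_consS.
rewrite (_ : _ \o _ = fst); first exact: measurable_fst.
by apply/funext => p; rewrite /= /rV_coord rV_cons0.
Qed.

Lemma measurable_rV_uncons n : measurable_fun setT (@rV_uncons n).
Proof.
apply/measurable_fun_pairP; split.
  exact: (@measurable_rV_coord n.+1 ord0).
apply: measurable_fun_rV => i.
rewrite (_ : _ \o _ = @rV_coord R n.+1 (lift ord0 i)).
  exact: measurable_rV_coord.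
by apply/funext => x; rewrite /rV_coord /= mxE.
Qed.

Section step.
Context n (m : {sigma_finite_measure set 'rV[R]_n -> \bar R}).

Definition lebesgue_step : set 'rV[R]_n.+1 -> \bar R :=
  pushforward (@lebesgue_measure R \x m)%E (@rV_cons n).

Let step0 : lebesgue_step set0 = 0%E.
Proof. by rewrite /lebesgue_step /pushforward preimage_set0 measure0. Qed.

Let step_ge0 A : (0 <= lebesgue_step A)%E.
Proof. by apply: integral_ge0 => // *. Qed.

Let step_sigma_additive : semi_sigma_additive lebesgue_step.
Proof.
exact: (@measure_semi_sigma_additive _ _ _
  (measure_function_pushforward__canonical__measure_function_Measure
    (@lebesgue_measure R \x m)%E (@measurable_rV_cons n))).
Qed.

HB.instance Definition _ := isMeasure.Build _ _ _ lebesgue_step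
  step0 step_ge0 step_sigma_additive.

Let step_sigma_finite : sigma_finite setT lebesgue_step.
Proof.
have /sigma_finiteP[F [TF ndF Foo]] := sigma_finiteT (@lebesgue_measure R).
have /sigma_finiteP[G [TG ndG Goo]] := sigma_finiteT m.
exists (fun k => @rV_uncons n @^-1` (F k `*` G k)).
  rewrite -preimage_bigcup; apply/esym/seteqP; split=> // x _.
  have [i _ Fi] : (\bigcup_i F i) (rV_uncons x).1 by rewrite -TF.
  have [j _ Gj] : (\bigcup_j G j) (rV_uncons x).2 by rewrite -TG.
  exists (maxn i j) => //; split.
    by move: Fi; exact/subsetPset/ndF/leq_maxl.
  by move: Gj; exact/subsetPset/ndG/leq_maxr.
move=> k; have [mF Fk] := Foo k; have [mG Gk] := Goo k; split.
  by rewrite -[X in measurable X]setTI; apply: measurable_rV_uncons => //;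
    exact: measurableX.
rewrite /lebesgue_step /pushforward -comp_preimage.
rewrite (_ : _ \o _ = id); last by apply/funext => p; exact: rV_consK.
by rewrite preimage_id product_measure1E// lte_mul_pinfty// ge0_fin_numE.
Qed.

HB.instance Definition _ := Measure_isSigmaFinite.Build _ _ _ lebesgue_step
  step_sigma_finite.

End step.

(* Lebesgue measure on R^n: the point mass for n = 0, and the product of the
   one-dimensional Lebesgue measure with that on R^n for n + 1. *)
Fixpoint lebesgue_rV n : {sigma_finite_measure set 'rV[R]_n -> \bar R} :=
  if n is k.+1 return {sigma_finite_measure set 'rV[R]_n -> \bar R}
  then lebesgue_step (lebesgue_rV k) else \d_(0 : 'rV[R]_0).

End lebesgue_rV.

Section calculus.
Context (R : realType) (d : nat).
Notation V := 'rV[R]_d.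

Definition dotp (x y : V) : R := \sum_i x ord0 i * y ord0 i.

Definition basis_vec (i : 'I_d) : V := delta_mx ord0 i.

Definition grad (f : V -> R) (x : V) : V := \row_i 'D_(basis_vec i) f x.

Fixpoint Ck (k : nat) (f : V -> R) : Prop :=
  continuous f /\
  if k is m.+1 then
    forall i, (forall x, derivable f x (basis_vec i)) /\
              Ck m (fun x => 'D_(basis_vec i) f x)
  else True.

Definition support (f : V -> R) : set V := closure [set x | f x != 0].

Definition test_function (Om : set V) (psi : V -> R) :=
  [/\ forall k, Ck k psi, compact (support psi) & support psi `<=` Om].

Definition convex_conjugate (phi : V -> R) (s : V) : \bar R :=
  ereal_sup [set (dotp s r - phi r)%:E | r in [set: V]].

End calculus.

Section domains.
Context (R : realType) (d : nat).
Notation V := 'rV[R]_d.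

(* empty if A is empty *)
Definition conv_hull (I : finType) (A : {set I}) (p : I -> V) : set V :=
  [set x | exists l : I -> R,
    [/\ forall i, 0 <= l i, \sum_(i in A) l i = 1 &
        x = \sum_(i in A) l i *: p i]].

Definition boundary (Om : set V) : set V := closure Om `\` interior Om.

(* Near each boundary point, Om is the strict epigraph of a Lipschitz function
   g defined on the hyperplane orthogonal to a unit vector e. *)
Definition lipschitz_boundary (Om : set V) :=
  forall x0, boundary Om x0 -> exists (e : V) (g : V -> R) (L r : R),
    [/\ dotp e e = 1, 0 < r, forall x y, `|g x - g y| <= L * `|x - y| &
        forall x, ball x0 r x ->
          (Om x <-> g (x - dotp x e *: e) < dotp x e)].

Definition polyhedral (Om : set V) :=
  exists (n k : nat) (p : 'I_n -> 'I_k -> V),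
    closure Om = \bigcup_(i in [set: 'I_n]) conv_hull [set: 'I_k] (p i).

Definition bounded_polyhedral_lipschitz_domain (Om : set V) :=
  [/\ Om !=set0, open Om & connected Om] /\
  [/\ bounded_set Om, polyhedral Om & lipschitz_boundary Om].

End domains.

Section triangulations.
Context (R : realType) (d : nat).
Notation V := 'rV[R]_d.

(* A simplex is given by its d + 1 vertices. *)
Notation simplex := ('I_d.+1 -> V).

Definition elem (T : simplex) : set V := conv_hull [set: 'I_d.+1] T.

(* the side opposite to the vertex j *)
Definition side (T : simplex) (j : 'I_d.+1) : set V := conv_hull [set~ j] T.

Definition elem_mid (T : simplex) : V := (d.+1%:R)^-1 *: \sum_i T i.

Definition side_mid (T : simplex) (j : 'I_d.+1) : V :=
  (d%:R)^-1 *: \sum_(i | i != j) T i.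

Definition nondegenerate (T : simplex) :=
  row_free (\matrix_(i < d) (T (lift ord0 i) - T ord0)).

Definition outer_unit_normal (T : simplex) (j : 'I_d.+1) (nu : V) :=
  [/\ dotp nu nu = 1, forall x y, side T j x -> side T j y -> dotp nu (x - y) = 0
    & forall x, side T j x -> dotp nu (T j - x) < 0].

Context (N : nat).
Implicit Type Th : 'I_N -> simplex.

(* Two elements meet in a common (possibly empty) face. *)
Definition regular_triangulation (Om : set V) Th :=
  [/\ forall t, nondegenerate (Th t),
      forall t t', elem (Th t) = elem (Th t') -> t = t',
      forall t t', exists A B : {set 'I_d.+1},
        elem (Th t) `&` elem (Th t') = conv_hull A (Th t) /\
        elem (Th t) `&` elem (Th t') = conv_hull B (Th t') &
      closure Om = \bigcup_(t in [set: 'I_N]) elem (Th t)].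

Definition sides Th : set (set V) :=
  [set S | exists t j, S = side (Th t) j].

Definition boundary_sides (Om : set V) Th : set (set V) :=
  [set S | sides Th S /\ S `<=` boundary Om].

Definition boundary_partition (Om : set V) Th (GD GN : set V) :=
  exists D : set (set V),
    [/\ D `<=` boundary_sides Om Th, GD = \bigcup_(S in D) S &
        GN = \bigcup_(S in boundary_sides Om Th `\` D) S].

End triangulations.

(* Functions on Om are measurable functions on R^d up to equality almost
   everywhere on Om; their values outside Om play no role. *)
Section spaces.
Context (R : realType) (d N : nat).
Notation V := 'rV[R]_d.
Notation mu := (lebesgue_rV R d).
Variables (Om : set V) (Th : 'I_N -> 'I_d.+1 -> V).

Definition Linfty (w : V -> R) :=
  measurable_fun setT w /\
  exists M : R, {ae mu, forall x, Om x -> `|w x| <= M}.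

Definition L2 (w : V -> R) :=
  measurable_fun setT w /\ (\int[mu]_(x in Om) ((w x) ^+ 2)%:E < +oo)%E.

Definition L2prod (v w : V -> R) : R := (\int[mu]_(x in Om) (v x * w x))%R.

Definition Pk (k : nat) : set (V -> R) :=
  [set p | exists c : {ffun 'I_d -> 'I_k.+1} -> R,
     p = fun x : V => \sum_(a : {ffun 'I_d -> 'I_k.+1} | (\sum_i a i <= k)%N)
                    c a * \prod_i x ord0 i ^+ a i].

Definition is_restr (k : nat) (w : V -> R) (t : 'I_N) (p : V -> R) :=
  Pk k p /\ ae_eq mu (elem (Th t)) w p.

Definition Lk (k : nat) (w : V -> R) :=
  Linfty w /\ forall t, exists p, is_restr k w t p.

(* For w in Lk k this is the polynomial w|_t. It is unique because the elements
   are nondegenerate, and it gives w point values on the closed element. *)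
Definition restr (k : nat) (w : V -> R) (t : 'I_N) : V -> R :=
  xget (fun=> 0) [set p | is_restr k w t p].

(* The function equal to c t on the interior of each element t; it vanishes on
   the union of the sides, a null set. *)
Definition glue (W : lmodType R) (c : 'I_N -> V -> W) (x : V) : W :=
  \sum_t \1_(interior (elem (Th t))) x *: c t x.

Definition mean (t : 'I_N) (v : V -> R) : R :=
  (fine (mu (elem (Th t))))^-1 * (\int[mu]_(x in elem (Th t)) v x)%R.

Definition Pi_h (v : V -> R) : V -> R := glue (fun t _ => mean t v : R^o).

Definition Pi_h_vec (y : V -> V) : V -> V :=
  glue (fun t _ => \row_i mean t (fun x => y x ord0 i)).

Definition CR (u : V -> R) :=
  Lk 1 u /\
  forall t t' j j', side (Th t) j = side (Th t') j' ->
    restr 1 u t (side_mid (Th t) j) = restr 1 u t' (side_mid (Th t) j).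

Definition CR_D (GD : set V) (u : V -> R) :=
  CR u /\
  forall t j, side (Th t) j `<=` GD -> restr 1 u t (side_mid (Th t) j) = 0.

Definition Pi_h_CR_D (GD : set V) (w : V -> R) :=
  measurable_fun setT w /\ exists2 v, CR_D GD v & ae_eq mu Om (Pi_h v) w.

Definition grad_h (u : V -> R) : V -> V :=
  glue (fun t x => grad (restr 1 u t) x).

Definition is_weak_div (y : V -> V) (g : V -> R) :=
  L2 g /\ forall psi, test_function Om psi ->
    (\int[mu]_(x in Om) dotp (y x) (grad psi x))%R = - L2prod g psi.

Definition Hdiv (y : V -> V) :=
  (forall i, L2 (fun x => y x ord0 i)) /\ exists g, is_weak_div y g.

Definition divergence (y : V -> V) : V -> R :=
  xget (fun=> 0) [set g | is_weak_div y g].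

Definition RT (y : V -> V) :=
  Hdiv y /\ forall t, exists (a : V) (b : R),
    ae_eq mu (elem (Th t)) y (fun x => a + b *: (x - elem_mid (Th t))).

Definition restr_vec (y : V -> V) (t : 'I_N) (x : V) : V :=
  \row_i restr 1 (fun z => y z ord0 i) t x.

(* On a boundary side the outer unit normals of Om and of the adjacent element
   are the same. *)
Definition RT_N (GN : set V) (y : V -> V) :=
  RT y /\ forall t j nu, side (Th t) j `<=` GN ->
    outer_unit_normal (Th t) j nu ->
    forall x, side (Th t) j x -> dotp (restr_vec y t x) nu = 0.

Definition primal_values (GD : set V) (phi : V -> R) (ubar : V -> R) :
    set (\bar R) :=
  [set (\int[mu]_(x in Om) (phi (grad_h u x))%:E)%E |
     u in [set u | CR_D GD u /\ ae_eq mu Om (Pi_h u) ubar]].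

Definition dual_values (GN : set V) (phi : V -> R) (ubar : V -> R) :
    set (\bar R) :=
  [set (- (\int[mu]_(x in Om) convex_conjugate phi (Pi_h_vec z x))
        - (L2prod ubar (divergence z))%:E)%E | z in RT_N GN].

End spaces.

(* Main.v *)
From HB Require Import structures.
Require Import Defs.
From mathcomp Require Import all_boot all_order all_algebra all_fingroup.
From mathcomp Require Import all_classical all_reals all_analysis.
From mathcomp Require Import measurable_realfun ring lra.

Set Implicit Arguments.
Unset Strict Implicit.
Unset Printing Implicit Defensive.
Import Order.TTheory GRing.Theory Num.Theory.
Import numFieldNormedType.Exports.
Local Open Scope classical_set_scope.
Local Open Scope ring_scope.

(** Both problems are finite-dimensional, and the theorem is convex duality for
them once they are written in the degrees of freedom of the two spaces.

A Crouzeix--Raviart function is given by its values [p t j] at the midpoints of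
the sides. Its elementwise gradient [cr_grad] is linear in these values, its
element means are averages of them, and [conforming] expresses the continuity
and the boundary condition ([primal_valuesE]). A Raviart--Thomas field is given
by the coefficients [a t], [b t] of its restrictions, of which [a t] is the
elementwise mean and [d * b t] the divergence. The field belongs to the space
exactly if its fluxes through each interior side, computed from the two
elements, are opposite, and the boundary condition says that the fluxes through
the sides in [GN] vanish ([RT_N_admissible], [dual_valuesE]). The sum over an
element of flux times midpoint value is [vol * (a . cr_grad p + d * b * mean
p)] ([flux_pairing]); summed over the elements, these products cancel in pairs
on interior sides and vanish on boundary sides ([admissible_orthogonal]).
Together with Fenchel's inequality this is [weak_duality].

For the converse, let [M] be the infimum, [p0] a feasible point and [m] the
prescribed means. The convex function [energy (p0 + P) - M] is nonnegative on
the subspace of the conforming [P] with zero means. By the Hahn--Banach theorem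
there is a linear functional below it that vanishes on this subspace
([lagrange_multipliers]). It vanishes on elementwise constants, on which the
energy does not depend, so that it has the form [P |-> \sum_t vol * (a t .
cr_grad P)]; and up to multipliers for the means it is orthogonal to all
conforming [P], so that testing with the indicator functions of sides
([orthogonal_sides]) shows that it comes from the fluxes of an admissible
field. Maximizing the inequality [\sum_t vol * (a t . (q t - cr_grad p0)) <=
\sum_t vol * phi (q t) - M] over all [q] bounds the sum of the conjugates, and
the dual value of the field is at least [M] ([strong_duality]).

The analytic part is the characterization of the Raviart--Thomas space by
fluxes, which needs a divergence theorem on a simplex. It is obtained without
surface measure. The derivative at [s = 1] of the integral of a function [f]
over the image of the simplex under the dilation by [s] about the vertex [T j]
is the integral of [d * f + grad f . (x - T j)]. It vanishes if [f] vanishes on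
the opposite side, because the integral over a thin shell at this side is then
quadratically small ([cone_identity]). Hence that integral, suitably
normalized, depends only on the values of [f] on the side and serves as the
mean over the side, [side_mean]. Since an affine map that fixes the common side
of two elements carries one element to the other, both elements give the same
mean ([side_mean_eq]), and the divergence theorem for Raviart--Thomas fields is
linear algebra ([divergence_theorem]). It shows that fields with matching
fluxes have a weak divergence ([flux_weak_div]). Conversely, smooth test
functions supported in one element identify the weak divergence there
([weak_div_elem]), and a smooth bump at a common side with positive mean forces
the fluxes to match ([flux_match]).

The combinatorics of the sides rests on conformity, by which two elements meet
in a common face, and on the Lipschitz boundary, by which the domain is the
interior of the union of its elements ([lipschitz_interior_closure]): each side
that is not on the boundary belongs to exactly two elements, on opposite sides
of it ([interior_side_neighbor], [side_unique]). *)

(** * Lebesgue measure on R^d *)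

Lemma measurable_preimage d1 d2 (X : measurableType d1) (Y : measurableType d2)
    (f : X -> Y) (A : set Y) :
  measurable_fun setT f -> measurable A -> measurable (f @^-1` A).
Proof. by move=> mf mA; rewrite -[X in measurable X]setTI; exact: mf. Qed.

Lemma lebesgue_measure_affine (R : realType) (s a : R)
    (A : set (measurableTypeR R)) : 0 < s -> measurable A ->
  (s%:E * lebesgue_measure ((fun x => s * x + a)%R @^-1` A) =
   lebesgue_measure A)%E.
Proof.
move=> s0 mA.
pose f : measurableTypeR R -> measurableTypeR R := fun x => s * x + a.
have mf : measurable_fun setT f.
  by apply: measurable_funD => //; apply: measurable_funM.
pose m1 := measure_function_pushforward__canonical__measure_function_Measure
  (@lebesgue_measure R) mf.
pose m := mscale (NngNum (ltW s0)) m1.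
rewrite [RHS](@lebesgue_measure_unique _ m) // => X.
case=> [[u v]] _ <- /=.
rewrite /m /mscale /m1 /= /pushforward.
rewrite (_ : f @^-1` _ = `](u - a) / s, (v - a) / s]%classic).
  rewrite !lebesgue_measure_itv /= !lte_fin ltr_pM2r ?invr_gt0// ltrD2r.
  case: ifP => _; last by rewrite mule0.
  by rewrite -!EFinD -EFinM; congr EFin; field; rewrite gt_eqF.
apply/seteqP; split=> x /=; rewrite !in_itv /= ltr_pdivrMr// ler_pdivlMr// /f;
  rewrite ltrBlDr lerBrDr; by rewrite [s * x]mulrC.
Qed.

Section homothety.
Variable R : realType.

Lemma lebesgue_rVSE d A :
  lebesgue_rV R d.+1 A = lebesgue_step (lebesgue_rV R d) A.
Proof. by []. Qed.

(** By induction on the dimension: a homothety acts on each factor of the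
product, and a measure on the product is determined by its rectangles. *)
Lemma lebesgue_rV_homothety d (s : R) (v : 'rV[R]_d) (A : set 'rV[R]_d) :
  0 < s -> measurable A ->
  ((s ^+ d)%:E * lebesgue_rV R d ((fun x => s *: x + v)%R @^-1` A) =
   lebesgue_rV R d A)%E.
Proof.
move=> s0; elim: d => [|d IH] in v A *.
  move=> mA; rewrite expr0 mul1e /=; congr (_ _).
  by apply/seteqP; split=> x /=; rewrite [_ + _]thinmx0 [x]thinmx0.
move=> mA; rewrite lebesgue_rVSE /lebesgue_step /pushforward.
set mu := lebesgue_rV R d.
pose w := (rV_uncons v).2.
pose f (p : measurableTypeR R * 'rV[R]_d) : measurableTypeR R * 'rV[R]_d :=
  (s * p.1 + v ord0 ord0, s *: p.2 + w).
pose f1 (x : measurableTypeR R) : measurableTypeR R := s * x + v ord0 ord0.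
pose f2 (x : 'rV[R]_d) : 'rV[R]_d := s *: x + w.
have mfst : measurable_fun setT f1.
  apply: (@measurable_funD _ _ _ _ (fun x : measurableTypeR R => s * x)) => //.
  by apply: measurable_funM.
have msnd : measurable_fun setT f2.
  apply: measurable_fun_rV => i.
  rewrite (_ : _ \o _ = (fun x => s * rV_coord i x + w ord0 i)).
    apply: measurable_funD => //; apply: measurable_funM => //.
    exact: measurable_rV_coord.
  by apply/funext => x; rewrite /= /rV_coord !mxE.
have mf : measurable_fun setT f.
  apply/measurable_fun_pairP; split.
    by apply: (measurableT_comp mfst); exact: measurable_fst.
  by apply: (measurableT_comp msnd); exact: measurable_snd.
pose m1 := measure_function_pushforward__canonical__measure_function_Measure
  (@lebesgue_measure R \x mu)%E mf.
pose m := mscale (NngNum (exprn_ge0 d.+1 (ltW s0))) m1.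
have mcA : measurable (@rV_cons R d @^-1` A).
  by apply: measurable_preimage => //; exact: measurable_rV_cons.
transitivity (m (@rV_cons R d @^-1` A)).
  rewrite /m /mscale /m1 /pushforward /=; congr (_ * _)%E.
  suff -> : @rV_cons R d @^-1` ((fun x => s *: x + v) @^-1` A) =
            f @^-1` (@rV_cons R d @^-1` A) by [].
  apply/seteqP; split=> p /=; congr (A _).
    apply/rowP => i; rewrite !mxE; case: (unliftP ord0 i) => [j|] -> //=.
    by rewrite !mxE.
  apply/rowP => i; rewrite !mxE; case: (unliftP ord0 i) => [j|] -> //=.
  by rewrite !mxE.
apply/esym/product_measure_unique => //.
move=> B C mB mC; rewrite /m /mscale /m1 /pushforward /=.
change ((s ^+ d.+1)%:E * (lebesgue_measure \x mu) ((f1 @^-1` B) `*` (f2 @^-1` C))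
  = lebesgue_measure B * mu C)%E.
rewrite product_measure1E; [|exact: (measurable_preimage mfst)|
  exact: (measurable_preimage msnd)].
rewrite exprS EFinM muleACA; congr (_ * _)%E.
  exact: lebesgue_measure_affine.
exact: IH.
Qed.

Definition cube d (r : R) : set 'rV[R]_d := [set x | forall i, `|x ord0 i| < r].

Lemma measurable_cube d r : measurable (@cube d r).
Proof.
rewrite (_ : cube r = \bigcap_(i in [set: 'I_d])
    (@rV_coord R d i @^-1` `]- r, r[%classic)).
  apply: fin_bigcap_measurable; first exact: finite_finset.
  by move=> i _; apply: measurable_preimage => //; exact: measurable_rV_coord.
apply/seteqP; split=> x /=.
  by move=> h i _ /=; rewrite in_itv /= -ltr_norml; exact: h.
by move=> h i; have := h i I; rewrite /= in_itv /= -ltr_norml.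
Qed.

Lemma lebesgue_rV_cube d (r : R) : 0 < r ->
  lebesgue_rV R d (cube r) = ((r *+ 2) ^+ d)%:E.
Proof.
move=> r0; elim: d => [|d IH].
  by rewrite expr0 /= diracE mem_set //= => -[].
rewrite lebesgue_rVSE /lebesgue_step /pushforward.
rewrite (_ : _ @^-1` _ = `]- r, r[%classic `*` cube r).
  rewrite product_measure1E ?IH //; last exact: measurable_cube.
  rewrite exprS EFinM; congr (_ * _)%E.
  apply: etrans (lebesgue_measure_itv _) _.
  by rewrite /= lte_fin gtrN// -EFinD opprK.
apply/seteqP; split=> -[x y] /=.
  move=> h; split=> [|i] /=.
    by have := h ord0; rewrite rV_cons0 in_itv /= -ltr_norml.
  by have := h (lift ord0 i); rewrite rV_consS.
case=> /=; rewrite in_itv /= -ltr_norml => hx hy i.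
by case: (unliftP ord0 i) => [j|] ->; rewrite ?rV_cons0// rV_consS.
Qed.

End homothety.

Section translation.
Variable R : realType.

Lemma ball_rVE d (x y : 'rV[R]_d) (r : R) :
  ball x r y <-> 0 < r /\ forall i, `|x ord0 i - y ord0 i| < r.
Proof.
split=> [[r0 h]|[r0 h]]; split=> // i; first exact: h.
by rewrite ord1 => j; exact: h.
Qed.

Lemma measurable_ball_rV d (x : 'rV[R]_d) (r : R) : measurable (ball x r).
Proof.
have [r0|r0] := ltP 0 r; last first.
  rewrite (_ : ball x r = set0) //; apply/seteqP; split=> y //.
  by rewrite ball_rVE => -[]; rewrite ltNge r0.
rewrite (_ : ball x r = (fun y => 1 *: y + - x) @^-1` (@cube R d r)).
  apply: measurable_preimage; last exact: measurable_cube.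
  apply: measurable_fun_rV => i.
  rewrite (_ : _ \o _ = (fun y => rV_coord i y + - x ord0 i)).
    by apply: measurable_funD => //; exact: measurable_rV_coord.
  by apply/funext => y; rewrite /= /rV_coord scale1r !mxE.
apply/seteqP; split=> y /=.
  by rewrite ball_rVE => -[_ h] i; rewrite scale1r !mxE distrC.
by move=> h; apply/ball_rVE; split=> // i; have := h i;
  rewrite scale1r !mxE distrC.
Qed.

(** Balls with rational centres and radii [1/(n+1)] form a countable basis. *)
Lemma open_measurable_rV d (U : set 'rV[R]_d) : open U -> measurable U.
Proof.
move=> oU.
pose B (p : 'rV[rat]_d * nat) : set 'rV[R]_d :=
  ball (map_mx ratr p.1 : 'rV[R]_d) p.2.+1%:R^-1.
pose F k : set 'rV[R]_d :=
  if (unpickle k : option ('rV[rat]_d * nat)) is Some p then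
    if `[< B p `<=` U >] then B p else set0
  else set0.
rewrite (_ : U = \bigcup_k F k).
  apply: bigcup_measurable => k _; rewrite /F; case: unpickle => [p|] //.
  by case: asboolP => // _; exact: measurable_ball_rV.
apply/seteqP; split=> x; last first.
  move=> [k _]; rewrite /F; case: unpickle => // p.
  by case: asboolP => // pU /pU.
move=> Ux; have : nbhs x U by apply: open_nbhs_nbhs.
move=> /nbhs_ballP[e /= e0 xeU].
have [n ne] : exists n, n.+1%:R^-1 < e / 2 :> R.
  exists (Num.trunc (e / 2)^-1).
  by rewrite -[ltRHS]invrK ltf_pV2 ?posrE ?invr_gt0 ?divr_gt0// truncnS_gt.
have n0 : 0 < n.+1%:R^-1 :> R by rewrite invr_gt0.
have q_ i : {q : rat | `|ratr q - x ord0 i| < n.+1%:R^-1 :> R}.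
  apply: cid.
  have h : x ord0 i - n.+1%:R^-1 < x ord0 i + n.+1%:R^-1.
    by rewrite ltrD2l gtrN.
  have [q] := rat_in_itvoo h.
  by rewrite in_itv /= => /andP[h1 h2]; exists q; rewrite ltr_distl h1.
pose q : 'rV[rat]_d := \row_i sval (q_ i).
have xq : ball (map_mx ratr q : 'rV[R]_d) n.+1%:R^-1 x.
  by apply/ball_rVE; split=> // i; rewrite !mxE; exact: (svalP (q_ i)).
exists (pickle (q, n)) => //; rewrite /F pickleK /=.
case: asboolP => // -[] y qy; apply: xeU.
move: xq qy => /ball_rVE[_ h1] /ball_rVE[_ h2]; apply/ball_rVE; split=> // i.
have := h1 i; have := h2 i; rewrite !mxE => h3 h4.
rewrite (splitr e) -(subrKA (ratr (q ord0 i))).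
apply: (le_lt_trans (ler_normD _ _)); apply: ltrD.
  by rewrite distrC (lt_trans _ ne)// mxE.
by rewrite (lt_trans _ ne)// mxE.
Qed.

Lemma continuous_measurable_rV d (f : 'rV[R]_d -> R) :
  continuous f -> measurable_fun setT f.
Proof.
move=> cf; apply: (measurability _ (RGenOInfty.measurableE R)) => //.
move=> _ [_ [a ->] <-]; rewrite setTI; apply: open_measurable_rV.
by apply: open_comp => // x _; exact: cf.
Qed.

Lemma measurable_affine d (M : 'M[R]_d) (v : 'rV[R]_d) :
  measurable_fun setT (fun x : 'rV[R]_d => x *m M + v).
Proof.
apply: measurable_fun_rV => i.
rewrite (_ : _ \o _ = (fun x => (\sum_j rV_coord j x * M j i) + v ord0 i)).
  apply: measurable_funD => //; apply: measurable_sum => j.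
  by apply: measurable_funM => //; exact: measurable_rV_coord.
by apply/funext => x; rewrite /= /rV_coord !mxE.
Qed.

Definition translation_invariant d (nu : set 'rV[R]_d -> \bar R) :=
  forall (v : 'rV[R]_d) (A : set 'rV[R]_d), measurable A ->
    nu ((fun x => x + v) @^-1` A) = nu A.

Lemma lebesgue_rV_translation d : translation_invariant (lebesgue_rV R d).
Proof.
move=> v A mA; rewrite -[RHS](@lebesgue_rV_homothety R d 1 v)// expr1n mul1e.
by under [X in lebesgue_rV _ _ (X @^-1` _)]eq_fun do rewrite -[X in X + v]scale1r.
Qed.

(** The classical two-line argument for the uniqueness of Haar measure:
Tonelli for the set of the [(x, y)] with [x + y] in [A] and [y] in the
symmetric set [B], together with the two invariances, gives
[mu A * nu B = nu A * mu B]. *)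
Lemma haar_unique d (nu : {sigma_finite_measure set 'rV[R]_d -> \bar R}) :
  translation_invariant nu ->
  forall A, measurable A ->
  (lebesgue_rV R d A * nu (cube 1) = nu A * lebesgue_rV R d (cube 1))%E.
Proof.
move=> tnu A mA; set mu := lebesgue_rV R d; set B := cube 1.
have mB : measurable B by exact: measurable_cube.
have madd : measurable_fun setT (fun p : 'rV[R]_d * 'rV[R]_d => p.1 + p.2).
  apply: measurable_fun_rV => i.
  rewrite (_ : _ \o _ = (fun p => rV_coord i p.1 + rV_coord i p.2)).
    by apply: measurable_funD; apply: measurableT_comp => //;
      exact: measurable_rV_coord.
  by apply/funext => x; rewrite /= /rV_coord !mxE.
have msub : measurable_fun setT (fun p : 'rV[R]_d * 'rV[R]_d => p.2 - p.1).
  apply: measurable_fun_rV => i.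
  rewrite (_ : _ \o _ = (fun p => rV_coord i p.2 - rV_coord i p.1)).
    by apply: measurable_funB; apply: measurableT_comp => //;
      exact: measurable_rV_coord.
  by apply/funext => x; rewrite /= /rV_coord !mxE.
pose E1 := [set p : 'rV[R]_d * 'rV[R]_d | A (p.1 + p.2) /\ B p.2].
pose E2 := [set p : 'rV[R]_d * 'rV[R]_d | A p.2 /\ B (p.2 - p.1)].
have mE1 : measurable E1.
  apply: (@measurableI _ _ ((fun p => p.1 + p.2) @^-1` A) (snd @^-1` B)).
    exact: measurable_preimage.
  exact: measurable_preimage.
have mE2 : measurable E2.
  apply: (@measurableI _ _ (snd @^-1` A) ((fun p => p.2 - p.1) @^-1` B)).
    exact: measurable_preimage.
  exact: measurable_preimage.
have tonelli E : measurable E ->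
    (\int[mu]_x nu (xsection E x) = \int[nu]_y mu (ysection E y))%E.
  move=> mE; have := @indic_fubini_tonelli _ _ _ _ _ mu nu E mE.
  by rewrite indic_fubini_tonelli_FE// indic_fubini_tonelli_GE.
have -> : (mu A * nu B = \int[nu]_y mu (ysection E1 y))%E.
  rewrite -integral_cst//= [LHS]integral_mkcond; apply: eq_integral => y _.
  rewrite patchE; case: ifPn => yB.
    rewrite -(lebesgue_rV_translation y mA); congr (mu _).
    apply/seteqP; split=> x; rewrite /ysection /= ?inE /=.
      by move=> ?; split=> //; exact: set_mem.
    by case.
  rewrite (_ : ysection _ _ = set0) ?measure0//.
  apply/seteqP; split=> x //; rewrite /ysection /= inE => -[_ /= By].
  by rewrite (mem_set By) in yB.
rewrite -tonelli//.
have -> : (nu A * mu B = \int[nu]_y mu (ysection E2 y))%E.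
  rewrite muleC -integral_cst//= [LHS]integral_mkcond; apply: eq_integral => y _.
  rewrite patchE; case: ifPn => yA.
    rewrite -(lebesgue_rV_translation (- y) mB); congr (mu _).
    apply/seteqP; split=> x; rewrite /ysection /= ?inE /=.
      move=> Bxy; split=> /=; [exact: set_mem|move=> i].
      by have := Bxy i; rewrite !mxE distrC.
    case=> _ /= Byx i; have := Byx i.
    by rewrite !mxE distrC.
  rewrite (_ : ysection _ _ = set0) ?measure0//.
  apply/seteqP; split=> x //; rewrite /ysection /= inE => -[/= Ay _].
  by rewrite (mem_set Ay) in yA.
rewrite -tonelli//; apply: eq_integral => x _.
rewrite -(tnu x (xsection E2 x)); last exact: measurable_xsection.
congr (nu _); apply/seteqP; split=> y; rewrite /xsection /= !inE /E1 /E2 /=;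
  rewrite addrK (addrC x y).
  by [].
by [].
Qed.
End translation.

Section change_of_variables.
Variables (R : realType) (d : nat).
Notation V := 'rV[R]_d.
Notation mu := (lebesgue_rV R d).

Lemma lebesgue_rV_lty (A : set V) (r : R) :
  measurable A -> A `<=` cube r -> (mu A < +oo)%E.
Proof.
move=> mA Ar.
have r0 : 0 < Num.max r 1 by rewrite lt_max ltr01 orbT.
apply: (@le_lt_trans _ _ (mu (cube (Num.max r 1)))); last first.
  by rewrite lebesgue_rV_cube// ltry.
apply: le_measure; rewrite ?inE //; first exact: measurable_cube.
by move=> x /Ar h i; rewrite lt_max h.
Qed.

(** The image of Lebesgue measure under a bijective affine map is translation
invariant, hence a multiple of it. The factor is a determinant; its existence
suffices below, where volumes only enter through their ratios. *)
Lemma lebesgue_rV_affine (M : 'M[R]_d) (v : V) : M \in unitmx ->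
  exists c : {nonneg R}, forall A : set V, measurable A ->
    mu ((fun x => x *m M + v) @^-1` A) = (c%:num%:E * mu A)%E.
Proof.
move=> uM; pose F (x : V) := x *m M + v; pose G (y : V) := (y - v) *m invmx M.
have FG y : F (G y) = y by rewrite /F /G mulmxKV// subrK.
have mF : measurable_fun setT F by exact: measurable_affine.
have mG : measurable_fun setT G.
  rewrite (_ : G = fun y => y *m invmx M + (- v *m invmx M)).
    exact: measurable_affine.
  by apply/funext => y; rewrite /G mulmxDl.
pose nu0 := measure_function_pushforward__canonical__measure_function_Measure
  mu mF.
have sf : sigma_finite setT nu0.
  have [E TE Eoo] := sigma_finiteT mu.
  exists (fun k => G @^-1` (E k)).
    rewrite -preimage_bigcup; apply/seteqP; split=> // y _ /=.
    by rewrite -TE.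
  move=> k; have [mE Ek] := Eoo k; split; first exact: measurable_preimage.
  rewrite /nu0 /= /pushforward (_ : F @^-1` _ = E k)//.
  by apply/seteqP; split=> x /=; rewrite /G /F addrK mulmxK.
pose sfm := Measure_isSigmaFinite.Build _ _ _ nu0 sf.
pose nu : {sigma_finite_measure set V -> \bar R} :=
  HB.pack_for (SigmaFiniteMeasure.type V R) (Measure.sort nu0) sfm.
have tnu : translation_invariant nu.
  move=> w A mA; rewrite /nu /= /pushforward.
  rewrite -[RHS](lebesgue_rV_translation (w *m invmx M)); last first.
    exact: measurable_preimage.
  congr (mu _); apply/seteqP; split=> x /=;
    by rewrite /F mulmxDl mulmxKV// addrAC.
have mu1 : mu (cube 1) = (2 ^+ d)%:E by rewrite lebesgue_rV_cube.
have nu1 : (nu (cube 1) < +oo)%E.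
  pose r : R := 1 + \sum_i \sum_j (1 + `|v ord0 j|) * `|invmx M j i|.
  have -> : nu (cube 1) = mu (F @^-1` cube 1) by [].
  apply: (@lebesgue_rV_lty _ r).
    by apply: measurable_preimage => //; exact: measurable_cube.
  move=> x /= Fx i; rewrite -[x](mulmxK uM) -[x *m M](addrK v) -/(F x) mxE.
  apply: (le_lt_trans (ler_norm_sum _ _ _)).
  pose b k := \sum_j (1 + `|v ord0 j|) * `|invmx M j k|.
  have b0 k : 0 <= b k.
    by apply: sumr_ge0 => j _; rewrite mulr_ge0// addr_ge0.
  apply: (@le_lt_trans _ _ (b i)); last first.
    apply: (@le_lt_trans _ _ (\sum_k b k)); last by rewrite ltr_pwDl.
    by rewrite (bigD1 i)//= lerDl sumr_ge0.
  apply: ler_sum => j _; rewrite normrM ler_wpM2r//.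
  have -> : (F x - v) ord0 j = F x ord0 j - v ord0 j.
    by rewrite [LHS]mxE [X in _ + X]mxE.
  by apply: (le_trans (ler_normB _ _)); rewrite lerD2r ltW//; exact: Fx.
have fnu1 : nu (cube 1) \is a fin_num by rewrite ge0_fin_numE.
have c0 : 0 <= fine (nu (cube 1)) / 2 ^+ d.
  by rewrite divr_ge0// fine_ge0.
exists (NngNum c0) => A mA /=.
have -> : mu ((fun x => x *m M + v) @^-1` A) = nu A by [].
have := haar_unique tnu mA; rewrite mu1 -[nu (cube 1)]fineK// => h.
by rewrite EFinM muleAC [X in (X * _)%E]muleC h -muleA -EFinM divff ?mule1.
Qed.

End change_of_variables.

Section scaled_pushforward.
Context d1 d2 (X : measurableType d1) (Y : measurableType d2) (R : realType).
Variables (m1 : {measure set X -> \bar R}) (m2 : {measure set Y -> \bar R}).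
Variables (f : X -> Y) (c : {nonneg R}).
Hypothesis mf : measurable_fun setT f.
Hypothesis fm : forall A, measurable A -> m1 (f @^-1` A) = (c%:num%:E * m2 A)%E.

Lemma ge0_integral_scaled D (g : Y -> \bar R) : measurable D ->
  measurable_fun setT g -> (forall x, 0 <= g x)%E ->
  (\int[m1]_(x in f @^-1` D) g (f x) = c%:num%:E * \int[m2]_(y in D) g y)%E.
Proof.
move=> mD mg g0; rewrite -ge0_integral_mscale//; last exact: measurable_funTS.
rewrite -[LHS](ge0_integral_pushforward mf m1)//; last exact: measurable_funTS.
by apply: eq_measure_integral => A mA _; exact: fm.
Qed.

(** The form in which the affine changes of variables are used: their Jacobian
is the constant [c]. *)
Lemma Rintegral_scaled D (g : Y -> R) : measurable D -> measurable_fun setT g ->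
  m2.-integrable D (EFin \o g) ->
  m1.-integrable (f @^-1` D) (EFin \o g \o f) /\
  \int[m1]_(x in f @^-1` D) g (f x) = c%:num * \int[m2]_(y in D) g y.
Proof.
move=> mD mg ig.
have mg' : measurable_fun setT (EFin \o g) by exact/measurable_EFinP.
have ig' : m1.-integrable (f @^-1` D) (EFin \o g \o f).
  apply/integrableP; split.
    by apply: measurable_funTS; exact: measurableT_comp.
  rewrite (@ge0_integral_scaled D (fun y => `|(g y)%:E|%E))//.
    by apply: lte_mul_pinfty => //; case/integrableP: ig.
  exact: measurableT_comp.
split=> //; rewrite /Rintegral.
rewrite integralE [in RHS]integralE.
have pI := integrable_pos_fin_num mD ig; have nI := integrable_neg_fin_num mD ig.
rewrite (_ : (fun x => (g (f x))%:E) = (EFin \o g) \o f)// funepos_comp funeneg_comp.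
rewrite !ge0_integral_scaled//; [|exact: measurable_funeneg|exact: measurable_funepos].
rewrite -muleBr//; last by rewrite fin_num_adde_defr.
by rewrite fineM// fin_numB pI.
Qed.
End scaled_pushforward.

(** * Barycentric coordinates of a simplex *)

Lemma continuous_sum (R : realType) (X : topologicalType) (I : Type)
    (r : seq I) (P : pred I) (f : I -> X -> R) :
  (forall i, continuous (f i)) ->
  continuous (fun x => \sum_(i <- r | P i) f i x).
Proof.
move=> cf; elim: r => [|a r IH] x.
  by under eq_fun do rewrite big_nil; exact: cst_continuous.
under eq_fun do rewrite big_cons; case: ifP => _; last exact: IH.
by apply: cvgD; [exact: cf|exact: IH].
Qed.

Lemma continuous_add (R : realType) (W : normedModType R) (X : topologicalType)
    (f g : X -> W) : continuous f -> continuous g ->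
  continuous (fun x => f x + g x).
Proof. by move=> cf cg x; apply: cvgD; [exact: cf|exact: cg]. Qed.

Lemma continuous_scale (R : realType) (W : normedModType R)
    (X : topologicalType) (a : X -> R) (f : X -> W) :
  continuous a -> continuous f -> continuous (fun x => a x *: f x).
Proof. by move=> ca cf x; apply: cvgZ; [exact: ca|exact: cf]. Qed.

Lemma continuous_mul (R : realType) (X : topologicalType) (f g : X -> R) :
  continuous f -> continuous g -> continuous (fun x => f x * g x).
Proof. by move=> cf cg x; apply: cvgM; [exact: cf|exact: cg]. Qed.

Section dotp_theory.
Variables (R : realType) (d : nat).
Implicit Types x y z : 'rV[R]_d.

Lemma dotpC x y : dotp x y = dotp y x.
Proof. by apply: eq_bigr => i _; rewrite mulrC. Qed.

Lemma dotpDr x y z : dotp x (y + z) = dotp x y + dotp x z.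
Proof. by rewrite -big_split; apply: eq_bigr => i _; rewrite mxE mulrDr. Qed.

Lemma dotpZr a x y : dotp x (a *: y) = a * dotp x y.
Proof. by rewrite mulr_sumr; apply: eq_bigr => i _; rewrite mxE mulrCA. Qed.

Lemma dotpDl x y z : dotp (y + z) x = dotp y x + dotp z x.
Proof. by rewrite dotpC dotpDr !(dotpC x). Qed.

Lemma dotpZl a x y : dotp (a *: y) x = a * dotp y x.
Proof. by rewrite dotpC dotpZr dotpC. Qed.

Lemma dotpNr x y : dotp x (- y) = - dotp x y.
Proof. by rewrite -scaleN1r dotpZr mulN1r. Qed.

Lemma dotpBr x y z : dotp x (y - z) = dotp x y - dotp x z.
Proof. by rewrite dotpDr dotpNr. Qed.

Lemma dotp0r x : dotp x 0 = 0.
Proof. by rewrite -(scale0r 0) dotpZr mul0r. Qed.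

Lemma dotp0l x : dotp 0 x = 0.
Proof. by rewrite dotpC dotp0r. Qed.

Lemma dotp_sumr (I : finType) (P : pred I) x (F : I -> 'rV[R]_d) :
  dotp x (\sum_(i | P i) F i) = \sum_(i | P i) dotp x (F i).
Proof. exact: (big_morph (dotp x) (dotpDr x) (dotp0r x)). Qed.

Lemma dotp_suml (I : finType) (P : pred I) x (F : I -> 'rV[R]_d) :
  dotp (\sum_(i | P i) F i) x = \sum_(i | P i) dotp (F i) x.
Proof. by rewrite dotpC dotp_sumr; apply: eq_bigr => i _; rewrite dotpC. Qed.

Lemma dotp_continuous x : continuous (dotp x).
Proof.
apply: continuous_sum => i; apply: continuous_mul.
  by move=> y; exact: cst_continuous.
exact: (@coord_continuous R 1 d ord0 i).
Qed.

Lemma dotp_delta x i : dotp x (basis_vec R i) = x ord0 i.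
Proof.
rewrite /dotp (bigD1 i)//= big1 ?addr0 => [|j ji].
  by rewrite /basis_vec mxE !eqxx mulr1.
by rewrite /basis_vec mxE (negbTE ji) andbF mulr0.
Qed.

Lemma dotp_self_eq0 x : (dotp x x == 0) = (x == 0).
Proof.
apply/eqP/eqP => [|->]; last by rewrite dotp0r.
move=> /eqP; rewrite psumr_eq0 => [/allP h|i _]; last by rewrite -expr2 sqr_ge0.
apply/rowP => i; rewrite mxE; apply/eqP.
by have := h i (mem_index_enum _); rewrite mulf_eq0 orbb.
Qed.

Lemma dotp_self_ge0 x : 0 <= dotp x x.
Proof. by apply: sumr_ge0 => i _; rewrite -expr2 sqr_ge0. Qed.

End dotp_theory.

Section barycentric.
Variables (R : realType) (d : nat) (T : 'I_d.+1 -> 'rV[R]_d).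
Notation V := 'rV[R]_d.

Definition edge_mx : 'M[R]_d := \matrix_(i < d) (T (lift ord0 i) - T ord0).

(** The gradients of the barycentric coordinates. Those of the vertices other
than the first are the columns of the inverse of the edge matrix, and the sum
of all is zero because the coordinates add up to one. *)
Definition bgrad (j : 'I_d.+1) : V :=
  if unlift ord0 j is Some i then \row_k invmx edge_mx k i
  else - \sum_i \row_k invmx edge_mx k i.

Definition bary (j : 'I_d.+1) (x : V) : R :=
  (j == ord0)%:R + dotp (bgrad j) (x - T ord0).

Lemma baryE j x y : bary j x = bary j y + dotp (bgrad j) (x - y).
Proof. by rewrite /bary -addrA -dotpDr [y - _ + _]addrC subrKA. Qed.

Lemma bary_segment j s x y :
  bary j (x + s *: (y - x)) = (1 - s) * bary j x + s * bary j y.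
Proof.
rewrite (baryE j (x + _) x) [bary j y](baryE j y x) [x + _]addrC addrK dotpZr.
by ring.
Qed.

Lemma bary_continuous j : continuous (bary j).
Proof.
have -> : bary j = fun x =>
    ((j == ord0)%:R - dotp (bgrad j) (T ord0)) + dotp (bgrad j) x.
  by apply/funext => x; rewrite /bary dotpBr addrA addrAC.
apply: continuous_add; first by move=> x; exact: cst_continuous.
exact: dotp_continuous.
Qed.

Lemma bgrad_sum : \sum_j bgrad j = 0.
Proof.
rewrite big_ord_recl {1}/bgrad unlift_none.
rewrite [X in _ + X](eq_bigr (fun i => \row_k invmx edge_mx k i)) ?addNr//.
by move=> i _; rewrite /bgrad liftK.
Qed.

Lemma bary_sum x : \sum_j bary j x = 1.
Proof.
rewrite big_split /= -dotp_suml bgrad_sum dotp0l addr0.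
by rewrite (bigD1 ord0)//= big1 ?addr0// => i /negbTE ->.
Qed.

Hypothesis ndT : Defs.nondegenerate T.

Lemma edge_mx_unit : edge_mx \in unitmx.
Proof. by rewrite -row_free_unit. Qed.

Lemma bgrad_comb w : \sum_j dotp (bgrad j) w *: T j = w.
Proof.
rewrite big_ord_recl.
have -> : bgrad ord0 = - \sum_i bgrad (lift ord0 i).
  by apply/eqP; rewrite -addr_eq0 -big_ord_recl bgrad_sum.
rewrite -scaleN1r dotpZl mulN1r dotp_suml scaleNr scaler_suml addrC -sumrB.
rewrite -[RHS](mulmxKV edge_mx_unit); apply/rowP => k; rewrite summxE mxE.
apply: eq_bigr => i _; rewrite !mxE -mulrBr; congr (_ * _).
by apply: eq_bigr => l _; rewrite /bgrad liftK mxE mulrC.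
Qed.

Lemma bary_comb x : \sum_j bary j x *: T j = x.
Proof.
under eq_bigr do rewrite /bary scalerDl.
rewrite big_split /= bgrad_comb (bigD1 ord0)//= big1 ?addr0 ?scale1r.
  by rewrite addrC subrK.
by move=> i /negbTE ->; rewrite scale0r.
Qed.

Lemma bary0_uniq (c : 'I_d.+1 -> R) :
  \sum_j c j = 0 -> \sum_j c j *: T j = 0 -> forall j, c j = 0.
Proof.
move=> c0 cT.
have h i : c (lift ord0 i) = 0.
  suff : \row_i c (lift ord0 i) = 0 :> 'rV[R]_d by move/rowP/(_ i); rewrite !mxE.
  rewrite -[LHS](mulmxK edge_mx_unit) (_ : _ *m edge_mx = 0) ?mul0mx//.
  rewrite -[RHS]cT mulmx_sum_row big_ord_recl.
  have -> : c ord0 = - \sum_i c (lift ord0 i).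
    by apply/eqP; rewrite -addr_eq0 -big_ord_recl c0.
  rewrite scaleNr scaler_suml addrC -sumrB.
  by apply: eq_bigr => k _; rewrite rowK mxE scalerBr.
move=> j; case: (unliftP ord0 j) => [i|] ->; first exact: h.
by move: c0; rewrite big_ord_recl big1 ?addr0.
Qed.

(** Uniqueness of the coordinates; it identifies the coordinates of every
point that is given as an affine combination of the vertices. *)
Lemma bary_uniq (c : 'I_d.+1 -> R) x :
  \sum_j c j = 1 -> x = \sum_j c j *: T j -> forall j, bary j x = c j.
Proof.
move=> c1 cx j; apply/eqP; rewrite -subr_eq0; apply/eqP.
apply: (bary0_uniq (c := fun j => bary j x - c j)).
  by rewrite sumrB bary_sum c1 subrr.
by under eq_bigr do rewrite scalerBl; rewrite sumrB bary_comb -cx subrr.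
Qed.

Lemma bary_vertex j i : bary j (T i) = (j == i)%:R.
Proof.
apply: (bary_uniq (c := fun j => (j == i)%:R)).
  by rewrite (bigD1 i)//= eqxx big1 ?addr0// => k /negbTE ->.
rewrite (bigD1 i)//= eqxx big1 ?addr0 ?scale1r// => k /negbTE ->.
by rewrite scale0r.
Qed.

Lemma bary_inj x y : (forall j, bary j x = bary j y) -> x = y.
Proof. by move=> h; rewrite -[x]bary_comb -[y]bary_comb; apply: eq_bigr => j _; rewrite h. Qed.

Lemma dotp_bgrad_vertex j x i :
  dotp (bgrad j) (x - T i) = bary j x - (j == i)%:R.
Proof. by rewrite (baryE j x (T i)) bary_vertex; ring. Qed.

Lemma vertex_inj : injective T.
Proof.
move=> i k ik; have := bary_vertex i k.
by rewrite -ik bary_vertex eqxx; case: eqVneq => // _ /eqP; rewrite oner_eq0.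
Qed.

Lemma conv_hullP (A : {set 'I_d.+1}) x : conv_hull A T x <->
  (forall j, 0 <= bary j x) /\ (forall j, j \notin A -> bary j x = 0).
Proof.
split=> [[l [l0 l1 xl]]|[h0 hA]].
  have e j : bary j x = if j \in A then l j else 0.
    apply: (bary_uniq (c := fun j => if j \in A then l j else 0)).
      by rewrite -big_mkcond.
    rewrite xl big_mkcond; apply: eq_bigr => k _.
    by case: ifP => // _; rewrite scale0r.
  split=> j; rewrite e; first by case: ifP.
  by move/negbTE => ->.
exists (bary^~ x); split=> //.
  rewrite -[RHS](bary_sum x) big_mkcond; apply: eq_bigr => j _.
  by case: ifPn => // /hA ->.
rewrite -[LHS]bary_comb [RHS]big_mkcond; apply: eq_bigr => j _.
by case: ifPn => // /hA ->; rewrite scale0r.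
Qed.

Lemma elemP x : elem T x <-> forall j, 0 <= bary j x.
Proof. by rewrite /elem conv_hullP; split=> [[]|h] //; split=> // j; rewrite inE. Qed.

Lemma sideP j x : side T j x <-> (forall i, 0 <= bary i x) /\ bary j x = 0.
Proof.
rewrite /side conv_hullP; split=> -[h0 h]; split=> //.
  by apply: h; rewrite !inE negbK.
by move=> i; rewrite !inE negbK => /eqP ->.
Qed.

Lemma conv_hull_elem A : conv_hull A T `<=` elem T.
Proof. by move=> x /conv_hullP[h _]; apply/elemP. Qed.

Lemma bary_le1 j x : elem T x -> bary j x <= 1.
Proof.
move=> /elemP h; rewrite -(bary_sum x) (bigD1 j)//= lerDl.
by apply: sumr_ge0 => i _.
Qed.

Lemma bary_elem_mid j : bary j (elem_mid T) = d.+1%:R^-1.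
Proof.
apply: (bary_uniq (c := fun=> d.+1%:R^-1)).
  by rewrite sumr_const card_ord -[LHS]mulr_natl divff// pnatr_eq0.
by rewrite /elem_mid scaler_sumr.
Qed.

Lemma bary_side_mid (hd : (0 < d)%N) i j :
  bary i (side_mid T j) = (i != j)%:R / d%:R.
Proof.
apply: (bary_uniq (c := fun i => (i != j)%:R / d%:R)).
  rewrite (eq_bigr (fun i => if i != j then d%:R^-1 else 0)).
    rewrite -big_mkcond sumr_const cardC1 card_ord -[LHS]mulr_natl divff//.
    by rewrite pnatr_eq0 -lt0n.
  by move=> k _; case: ifP; rewrite ?mul1r// mul0r.
rewrite /side_mid scaler_sumr big_mkcond; apply: eq_bigr => k _.
by case: ifP => _; rewrite ?mul1r// mul0r scale0r.
Qed.

Lemma bgrad_neq0 (hd : (0 < d)%N) j : bgrad j != 0.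
Proof.
have [i ij] : exists i : 'I_d.+1, i != j.
  have [->|] := eqVneq j ord0; last by exists ord0; rewrite eq_sym.
  by exists ord_max; rewrite -val_eqE /= -lt0n.
apply/eqP => g0; have := dotp_bgrad_vertex j (T j) i.
by rewrite g0 dotp0l bary_vertex eqxx eq_sym (negbTE ij) => /eqP; rewrite subr0 eq_sym oner_eq0.
Qed.

End barycentric.

Lemma rV_norm_le (R : realType) d (x : 'rV[R]_d) r :
  0 <= r -> (forall i, `|x ord0 i| <= r) -> `|x| <= r.
Proof.
move=> r0 h; rewrite /Num.norm /= mx_normrE.
by apply/bigmax_leP; split=> // -[i j] _ /=; rewrite ord1.
Qed.

Section simplex_topology.
Variables (R : realType) (d : nat) (T : 'I_d.+1 -> 'rV[R]_d).
Notation V := 'rV[R]_d.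
Notation mu := (lebesgue_rV R d).
Hypothesis ndT : Defs.nondegenerate T.

Lemma open_forall_ord (n : nat) (A : 'I_n -> set V) :
  (forall i, open (A i)) -> open [set x | forall i, A i x].
Proof.
move=> oA; rewrite openE => x /= Ax; rewrite /interior.
apply: (@filter_forall _ _ A (nbhs x)) => i; apply: open_nbhs_nbhs; by split; [exact: oA|exact: Ax].
Qed.

Lemma closed_forall_ord (n : nat) (A : 'I_n -> set V) :
  (forall i, closed (A i)) -> closed [set x | forall i, A i x].
Proof.
move=> cA; rewrite (_ : mkset _ = \bigcap_i A i).
  by apply: closed_bigI => i _; exact: cA.
by apply/seteqP; split=> x h => [i _|i]; [exact: h|exact: (h i I)].
Qed.

Lemma open_bary_gt j c : open [set x : V | c < bary T j x].
Proof.
apply: (@open_comp _ _ (bary T j) [set y | c < y]); last exact: open_gt.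
by move=> x _; exact: bary_continuous.
Qed.

Lemma closed_bary_ge j c : closed [set x : V | c <= bary T j x].
Proof.
apply: (@closed_comp _ _ (bary T j) [set y | c <= y]); last exact: closed_ge.
by move=> x _; exact: bary_continuous.
Qed.

Lemma elem_closed : closed (elem T).
Proof.
rewrite (_ : elem T = [set x | forall j, [set y | 0 <= bary T j y] x]).
  by apply: closed_forall_ord => j; exact: closed_bary_ge.
by apply/seteqP; split=> x; rewrite (elemP ndT).
Qed.

Lemma elem_cube : exists2 r, 0 < r & elem T `<=` cube r.
Proof.
pose b i := \sum_j `|T j ord0 i|; have b0 i : 0 <= b i by exact: sumr_ge0.
exists (1 + \sum_i b i); first by rewrite ltr_pwDl// sumr_ge0.
move=> x Tx i.
apply: (@le_lt_trans _ _ (b i)).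
  rewrite -[x](bary_comb ndT) summxE; apply: (le_trans (ler_norm_sum _ _ _)).
  apply: ler_sum => j _; rewrite mxE normrM ler_piMl// ger0_norm.
    exact: bary_le1.
  by move/elemP : Tx; exact.
apply: (@le_lt_trans _ _ (\sum_k b k)); last by rewrite ltrDr.
by rewrite (bigD1 i)//= lerDl sumr_ge0.
Qed.

Lemma elem_compact : compact (elem T).
Proof.
apply: bounded_closed_compact; last exact: elem_closed.
have [r r0 Tr] := elem_cube; exists r; split; first exact: num_real.
move=> s rs x /Tr xr; apply: rV_norm_le => [|i].
  by rewrite ltW// (lt_trans r0).
by rewrite ltW// (lt_trans _ rs).
Qed.

Definition open_elem : set V := [set x | forall j, 0 < bary T j x].

Lemma open_elem_open : open open_elem.
Proof. by apply: open_forall_ord => j; exact: open_bary_gt. Qed.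

Lemma open_elem_sub : open_elem `<=` elem T.
Proof. by move=> x h; apply/elemP => // j; exact/ltW/h. Qed.

(** A point with a vanishing coordinate leaves the simplex when it is moved
away from the vertex of that coordinate. *)
Lemma interior_elem : interior (elem T) = open_elem.
Proof.
apply/seteqP; split=> [x ix|]; last first.
  by rewrite -open_subsetE; [exact: open_elem_sub|exact: open_elem_open].
have Tx : elem T x by exact: interior_subset ix.
move=> j; have /elemP -/(_ ndT j) := Tx; rewrite le_eqVlt => /orP[/eqP xj|//].
have cts : (fun t : R => x + t *: (T j - x)) @ 0 --> x.
  rewrite -[X in _ --> X]addr0 -(scale0r (T j - x)).
  apply: cvgD; first exact: cvg_cst.
  by apply: cvgZ; [exact: cvg_id|exact: cvg_cst].
have [e /= e0 he] := (cts _ ix : nbhs 0 _) : exists2 e : R, 0 < e & _.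
have {}he := he (- (e / 2)).
have : elem T (x + - (e / 2) *: (T j - x)).
  apply: he; rewrite /= sub0r opprK gtr0_norm ?divr_gt0//.
  by rewrite ltr_pdivrMr// ltr_pMr// ltr1n.
move=> /elemP -/(_ ndT j); rewrite bary_segment -xj mulr0 add0r bary_vertex// eqxx.
by rewrite mulr1 oppr_ge0 leNgt divr_gt0.
Qed.

Lemma elem_mid_open_elem : open_elem (elem_mid T).
Proof. by move=> j; rewrite bary_elem_mid// invr_gt0. Qed.

Lemma elem_measurable : measurable (elem T).
Proof.
rewrite -[elem T]setCK; apply: measurableC; apply: open_measurable_rV.
by apply: closed_openC; exact: elem_closed.
Qed.

Lemma elem_lty : (mu (elem T) < +oo)%E.
Proof.
have [r _ Tr] := elem_cube.
by apply: lebesgue_rV_lty Tr; exact: elem_measurable.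
Qed.

Lemma open_lebesgue_gt0 (U : set V) : open U -> U !=set0 -> (0 < mu U)%E.
Proof.
move=> oU [x Ux]; have : nbhs x U by exact: open_nbhs_nbhs.
move=> /nbhs_ballP[e /= e0 xeU].
apply: (@lt_le_trans _ _ (mu (ball x e))); last first.
  apply: le_measure; rewrite ?inE//; first exact: measurable_ball_rV.
  exact: open_measurable_rV.
rewrite (_ : ball x e = (fun y => y + - x) @^-1` (@cube R d e)).
  rewrite lebesgue_rV_translation; last exact: measurable_cube.
  by rewrite lebesgue_rV_cube// lte_fin exprn_gt0// mulrn_wgt0.
apply/seteqP; split=> y /=.
  by rewrite ball_rVE => -[_ h] i; rewrite !mxE distrC.
by move=> h; apply/ball_rVE; split=> // i; have := h i; rewrite !mxE distrC.
Qed.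

Definition vol : R := fine (mu (elem T)).

Lemma elem_fin : mu (elem T) \is a fin_num.
Proof. by rewrite ge0_fin_numE// elem_lty. Qed.

Lemma volE : mu (elem T) = vol%:E.
Proof. by rewrite fineK// elem_fin. Qed.

Lemma vol_gt0 : 0 < vol.
Proof.
rewrite -lte_fin -volE; apply: (@lt_le_trans _ _ (mu open_elem)).
  by apply: open_lebesgue_gt0; [exact: open_elem_open|
    exists (elem_mid T); exact: elem_mid_open_elem].
apply: le_measure; rewrite ?inE; last exact: open_elem_sub.
  by apply: open_measurable_rV; exact: open_elem_open.
exact: elem_measurable.
Qed.

Lemma continuous_bounded_elem (f : V -> R) : continuous f ->
  exists2 K, 0 <= K & forall x, elem T x -> `|f x| <= K.
Proof.
move=> cf; have cT : compact (f @` elem T).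
  by apply: continuous_compact; [exact: continuous_subspaceT|exact: elem_compact].
have [M [_ hM]] := compact_bounded cT.
exists (Num.max 0 (M + 1)); first by rewrite le_max lexx.
move=> x Tx; rewrite le_max; apply/orP; right.
by apply: (hM (M + 1)); [rewrite ltrDl|exists x].
Qed.

Lemma continuous_integrable_elem (f : V -> R) : continuous f ->
  mu.-integrable (elem T) (EFin \o f).
Proof.
move=> cf; apply: measurable_bounded_integrable.
- exact: elem_measurable.
- exact: elem_lty.
- by apply: measurable_funTS; exact: continuous_measurable_rV.
have [K K0 hK] := continuous_bounded_elem cf.
exists K; split; first exact: num_real.
by move=> s Ks x Tx; apply: (le_trans (hK _ Tx)); exact: ltW.
Qed.

End simplex_topology.

(** * Continuously differentiable functions *)

Lemma continuous_sub (R : realType) (W : normedModType R) (X : topologicalType)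
    (f g : X -> W) : continuous f -> continuous g ->
  continuous (fun x => f x - g x).
Proof. by move=> cf cg x; apply: cvgB; [exact: cf|exact: cg]. Qed.

Lemma continuous_compose (X Y Z : topologicalType) (f : X -> Y) (g : Y -> Z) :
  continuous f -> continuous g -> continuous (fun x => g (f x)).
Proof. by move=> cf cg x; apply: continuous_comp; [exact: cf|exact: cg]. Qed.

Lemma continuous_mulmxr (R : realType) d m (N : 'M[R]_(d, m)) :
  continuous (fun x : 'rV[R]_d => x *m N).
Proof.
have -> : (fun x : 'rV[R]_d => x *m N) =
    fun x => \sum_i x ord0 i *: row i N.
  apply/funext => x; rewrite mulmx_sum_row; apply: eq_bigr => i _ //.
elim: (index_enum _) => [|i r IH] x.
  by under eq_fun do rewrite big_nil; exact: cst_continuous.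
under eq_fun do rewrite big_cons; move: x; apply: continuous_add => //.
apply: continuous_scale; last by move=> x; exact: cst_continuous.
exact: coord_continuous.
Qed.

Section has_grad.
Variables (R : realType) (d : nat).
Notation V := 'rV[R]_d.
Implicit Types (f : V -> R) (G : V -> V).

(** Directional derivatives in all directions with a continuous gradient: the
form of the C^1 condition that is preserved by affine substitutions and
restricts to lines. It follows from the existence of continuous partial
derivatives, see [Ck1_has_grad]. *)
Definition has_grad f G :=
  [/\ continuous f, continuous G &
      forall x v : V, is_derive x v f (dotp (G x) v)].

Lemma is_derive_line f (x v : V) (t df : R) : is_derive (x + t *: v) v f df ->
  is_derive t 1 (fun u : R => f (x + u *: v)) df.
Proof.
have E : (fun h : R => h^-1 *: (((fun u : R => f (x + u *: v)) \o shift t) (h *: 1)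
      - f (x + t *: v))) =
    (fun h => h^-1 *: ((f \o shift (x + t *: v)) (h *: v) - f (x + t *: v))).
  apply/funext => h; congr (_ *: (f _ - _)) => /=.
  by rewrite -[h *: 1]/(h * 1) mulr1 scalerDl addrCA.
move=> [h1 h2]; constructor; first by rewrite /derivable E.
by rewrite -h2 /derive E.
Qed.

Lemma has_grad_affine (g : V) (c : R) : has_grad (fun x => c + dotp g x) (cst g).
Proof.
split.
- by apply: continuous_add => [x|]; [exact: cst_continuous|exact: dotp_continuous].
- by move=> x; exact: cst_continuous.
move=> x v.
have E : \forall h \near 0^', (h : R)^-1 *: (((fun x => c + dotp g x) \o shift x) (h *: v)
      - (c + dotp g x)) = dotp g v.
  near=> h.
  rewrite /= dotpDr dotpZr addrCA addrK -[_ *: _]/(_ * _) mulKf//.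
  by near: h; exact: nbhs_dnbhs_neq.
have cv : (fun h : R => h^-1 *: (((fun x => c + dotp g x) \o shift x) (h *: v)
      - (c + dotp g x))) @ 0^' --> dotp g v.
  by apply: cvg_near_cst.
by constructor; [apply/cvg_ex; exists (dotp g v)|exact: cvg_lim cv].
Unshelve. all: by end_near. Qed.

Lemma has_gradM f G f' G' : has_grad f G -> has_grad f' G' ->
  has_grad (fun x => f x * f' x) (fun x => f x *: G' x + f' x *: G x).
Proof.
move=> [cf cG h] [cf' cG' h']; split.
- exact: continuous_mul.
- by apply: continuous_add; exact: continuous_scale.
move=> x v; have := @is_deriveM _ _ f f' x v _ _ (h x v) (h' x v).
by rewrite dotpDl !dotpZl.
Qed.

Lemma has_gradB f G f' G' : has_grad f G -> has_grad f' G' ->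
  has_grad (fun x => f x - f' x) (fun x => G x - G' x).
Proof.
move=> [cf cG h] [cf' cG' h']; split.
- exact: continuous_sub.
- exact: continuous_sub.
move=> x v; have := @is_deriveB _ _ _ f f' x v _ _ (h x v) (h' x v).
by rewrite [dotp (G x - _) v]dotpC dotpBr !(dotpC v).
Qed.

Lemma dotp_mulmx (x y : V) : dotp x y = (x *m y^T) ord0 ord0.
Proof. by rewrite mxE; apply: eq_bigr => i _; rewrite mxE. Qed.

Lemma has_grad_comp_affine f G (M : 'M[R]_d) (w : V) : has_grad f G ->
  has_grad (fun x => f (x *m M + w)) (fun x => G (x *m M + w) *m M^T).
Proof.
move=> [cf cG h].
have cA : continuous (fun x : V => x *m M + w).
  by apply: continuous_add => x; [exact: continuous_mulmxr|exact: cst_continuous].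
split.
- exact: (continuous_compose cA cf).
- exact: (continuous_compose (continuous_compose cA cG) (@continuous_mulmxr _ _ _ _)).
move=> x v.
have -> : dotp (G (x *m M + w) *m M^T) v = dotp (G (x *m M + w)) (v *m M).
  by rewrite !dotp_mulmx trmx_mul mulmxA.
have [h1 h2] := h (x *m M + w) (v *m M).
have E : (fun k : R => k^-1 *: (((fun x => f (x *m M + w)) \o shift x) (k *: v)
      - f (x *m M + w))) =
    (fun k => k^-1 *: ((f \o shift (x *m M + w)) (k *: (v *m M)) - f (x *m M + w))).
  apply/funext => k; congr (_ *: (f _ - _)) => /=.
  by rewrite mulmxDl scalemxAl addrA.
by constructor; [rewrite /derivable E|rewrite -h2 /derive E].
Qed.

Lemma has_grad_mvt f G (x v : V) (a b : R) : has_grad f G -> a <= b ->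
  exists2 t, a <= t <= b &
    f (x + b *: v) - f (x + a *: v) = dotp (G (x + t *: v)) v * (b - a).
Proof.
move=> [cf cG h] ab.
have [||t] := @MVT_segment R (fun u => f (x + u *: v))
    (fun u => dotp (G (x + u *: v)) v) a b ab.
- by move=> t _; exact: is_derive_line.
- apply: continuous_subspaceT => t; apply: continuous_comp; last exact: cf.
  by apply: cvgD; [exact: cvg_cst|apply: cvgZ; [exact: cvg_id|exact: cvg_cst]].
by rewrite in_itv /=; exists t.
Qed.

Lemma continuous_dotp (F G : V -> V) : continuous F -> continuous G ->
  continuous (fun x => dotp (F x) (G x)).
Proof.
move=> cF cG; apply: continuous_sum => i; apply: continuous_mul.
  exact: (continuous_compose cF (@coord_continuous R 1 d ord0 i)).
exact: (continuous_compose cG (@coord_continuous R 1 d ord0 i)).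
Qed.

Lemma cone_integrand_continuous (T : 'I_d.+1 -> V) j f G : has_grad f G ->
  continuous (fun x => d%:R * f x + dotp (G x) (x - T j)).
Proof.
move=> [cf cG _]; apply: continuous_add.
  by apply: continuous_mul => // x; exact: cst_continuous.
apply: continuous_dotp => //.
by apply: continuous_sub => x; [exact: cvg_id|exact: cst_continuous].
Qed.

End has_grad.

(** * A divergence theorem without surface measure *)

Section cone.
Variables (R : realType) (d : nat) (T : 'I_d.+1 -> 'rV[R]_d).
Notation V := 'rV[R]_d.
Notation mu := (lebesgue_rV R d).
Hypothesis ndT : Defs.nondegenerate T.
Variable j : 'I_d.+1.

Definition dil (s : R) (x : V) : V := T j + s *: (x - T j).

(** The image of the simplex under the dilation [dil s] about the vertex [j],
see [dil_shrunk]. *)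
Definition shrunk (s : R) : set V := elem T `&` [set x | 1 - s <= bary T j x].

Lemma bary_dil s i x : bary T i (dil s x) = (1 - s) * (i == j)%:R + s * bary T i x.
Proof. by rewrite /dil bary_segment bary_vertex. Qed.

Lemma dil_shrunk s : 0 < s <= 1 -> dil s @^-1` shrunk s = elem T.
Proof.
move=> /andP[s0 s1]; apply/seteqP; split=> x.
  move=> [/= /(elemP ndT) h1 h2]; apply/elemP => // i.
  have := h1 i; rewrite bary_dil; have [->|ij] := eqVneq i j; last first.
    by rewrite mulr0 add0r pmulr_rge0.
  by move: h2; rewrite /= bary_dil eqxx mulr1 lerDl pmulr_rge0.
move=> /(elemP ndT) h; have s0' := ltW s0; split=> /=.
  by apply/elemP => // i; rewrite bary_dil addr_ge0 ?mulr_ge0 ?subr_ge0.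
by rewrite bary_dil eqxx mulr1 lerDl mulr_ge0.
Qed.

Lemma shrunk_measurable s : measurable (shrunk s).
Proof.
apply: measurableI; first exact: elem_measurable.
rewrite -[X in measurable X]setCK; apply: measurableC; apply: open_measurable_rV.
by apply: closed_openC; exact: closed_bary_ge.
Qed.

Lemma dil_measure s (A : set V) : 0 < s -> measurable A ->
  mu (dil s @^-1` A) = ((s ^+ d)^-1%:E * mu A)%E.
Proof.
move=> s0 mA; rewrite -(@lebesgue_rV_homothety R d s (T j - s *: T j) A)//.
rewrite muleA -EFinM mulVf ?mul1e; last by rewrite gt_eqF// exprn_gt0.
congr (mu _); apply/seteqP; split=> x /=;
  by rewrite /dil scalerBr addrCA.
Qed.

Lemma dil_continuous s : continuous (dil s).
Proof.
apply: continuous_add => [x|]; first exact: cst_continuous.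
apply: continuous_scale => [x|]; first exact: cst_continuous.
by apply: continuous_sub => x; [exact: cvg_id|exact: cst_continuous].
Qed.

Lemma dil_measurable s : measurable_fun setT (dil s).
Proof.
apply: measurable_fun_rV => i; apply: continuous_measurable_rV.
have ci : continuous (@rV_coord R d i) by exact: coord_continuous.
move=> x; apply: (@continuous_comp _ _ _ (dil s) (@rV_coord R d i)).
  exact: dil_continuous.
exact: ci.
Qed.

Lemma Rintegral_dil s (f : V -> R) : 0 < s <= 1 -> continuous f ->
  s ^+ d * \int[mu]_(x in elem T) f (dil s x) = \int[mu]_(x in shrunk s) f x.
Proof.
move=> /[dup] s01 /andP[s0 s1] cf.
have c0 : 0 <= (s ^+ d)^-1 by rewrite invr_ge0 exprn_ge0// ltW.
have fm A : measurable A -> mu (dil s @^-1` A) = ((NngNum c0)%:num%:E * mu A)%E.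
  by move=> mA; exact: dil_measure.
have if_ : mu.-integrable (shrunk s) (EFin \o f).
  apply: (@integrableS _ _ _ _ (elem T)); first exact: elem_measurable.
  - exact: shrunk_measurable.
  - by move=> x [].
  - exact: continuous_integrable_elem.
have [_] := Rintegral_scaled (dil_measurable s) fm (shrunk_measurable s)
  (continuous_measurable_rV cf) if_.
rewrite dil_shrunk// => -> /=.
by rewrite mulrA divff ?mul1r// gt_eqF// exprn_gt0.
Qed.

Lemma bernoulli (s : R) n : 0 <= s <= 1 -> 1 - s ^+ n <= n%:R * (1 - s).
Proof.
move=> /andP[s0 s1]; elim: n => [|n IH]; first by rewrite expr0 subrr mul0r.
rewrite exprS -natr1 mulrDl mul1r.
have -> : 1 - s * s ^+ n = (1 - s ^+ n) + (1 - s) * s ^+ n by ring.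
apply: lerD => //; rewrite ler_piMr ?subr_ge0//.
by rewrite exprn_ile1.
Qed.

Lemma vol_shell s : 0 < s <= 1 ->
  exists2 m, 0 <= m <= d%:R * (1 - s) * vol T & mu (elem T `\` shrunk s) = m%:E.
Proof.
move=> /[dup] s01 /andP[s0 s1].
have E : mu (shrunk s) = (s ^+ d * vol T)%:E.
  rewrite EFinM -volE// -(dil_shrunk s01) dil_measure//; last exact: shrunk_measurable.
  by rewrite muleA -EFinM divff ?mul1e// gt_eqF// exprn_gt0.
exists ((1 - s ^+ d) * vol T).
  have v0 := ltW (vol_gt0 ndT); have s0' := ltW s0.
  apply/andP; split; first by rewrite mulr_ge0// subr_ge0 exprn_ile1.
  by rewrite ler_wpM2r// bernoulli// s0'.
rewrite measureD//=; last 3 first.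
- exact: elem_measurable.
- exact: shrunk_measurable.
- exact: elem_lty.
rewrite setIidr; last by move=> x [].
by rewrite volE// E -EFinB mulrBl mul1r.
Qed.

Lemma side_measurable : measurable (side T j).
Proof.
rewrite (_ : side T j = elem T `\` [set x | 0 < bary T j x]).
  apply: measurableD; first exact: elem_measurable.
  by apply: open_measurable_rV; exact: open_bary_gt.
apply/seteqP; split=> x.
  move=> /(sideP ndT)[h0 h1]; split; first exact/elemP.
  by rewrite /= h1 ltxx.
move=> [/(elemP ndT) h0 /= h]; apply/sideP => //; split=> //.
by apply/eqP; rewrite eq_le h0 andbT leNgt; apply/negP.
Qed.

(** The side is contained in the shells [elem T `\` shrunk s], whose volumes are
at most [d * (1 - s) * vol T]. *)
Lemma side_null : mu (side T j) = 0%E.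
Proof.
have mS := side_measurable.
apply/eqP; rewrite eq_le measure_ge0 andbT.
apply/lee_addgt0Pr => e e0; rewrite add0e.
have K0 : 0 <= d%:R * vol T by rewrite mulr_ge0// ltW// vol_gt0.
pose s := 1 - Num.min (1 / 2) (e / (d%:R * vol T + 1)).
have K1 : 0 < d%:R * vol T + 1 by rewrite ltr_wpDl.
have s01 : 0 < s <= 1.
  rewrite /s subr_gt0 gerBl gt_min le_min; apply/andP; split.
    by apply/orP; left; rewrite ltr_pdivrMr// mul1r ltr1n.
  by apply/andP; split; rewrite divr_ge0// ltW.
have [m /andP[m0 mle] Em] := vol_shell s01.
apply: (@le_trans _ _ (mu (elem T `\` shrunk s))).
  apply: le_measure; rewrite ?inE//.
    by apply: measurableD; [exact: elem_measurable|exact: shrunk_measurable].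
  move=> x /(sideP ndT)[h0 h1]; split; first exact/elemP.
  move=> [_ /=]; rewrite h1 leNgt /s opprB addrC subrK.
  by rewrite lt_min !divr_gt0.
rewrite Em lee_fin; apply: (le_trans mle); rewrite /s opprB addrC subrK.
apply: (@le_trans _ _ (d%:R * vol T * (e / (d%:R * vol T + 1)))).
  by rewrite mulrAC ler_wpM2l// ge_min lexx orbT.
by rewrite mulrCA ler_piMr ?(ltW e0)// ler_pdivrMr// mul1r lerDl.
Qed.

End cone.

Lemma Rintegral_dominated_convergence d (X : measurableType d) (R : realType)
    (m : {measure set X -> \bar R}) (D : set X) (mD : measurable D)
    (f_ : nat -> X -> R) (f g : X -> R) :
  (forall n, measurable_fun D (f_ n)) -> measurable_fun D f ->
  (forall x, D x -> f_ ^~ x @ \oo --> f x) -> m.-integrable D (EFin \o g) ->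
  (forall n x, D x -> `|f_ n x| <= g x) ->
  (fun n => \int[m]_(x in D) f_ n x) @ \oo --> \int[m]_(x in D) f x.
Proof.
move=> mf_ mf cf ig fg.
have mf_' n : measurable_fun D (EFin \o f_ n) by exact/measurable_EFinP.
have mf' : measurable_fun D (EFin \o f) by exact/measurable_EFinP.
have cf' : {ae m, forall x, D x -> (EFin \o f_ n) x @[n --> \oo] --> (EFin \o f) x}.
  by apply: aeW => x Dx; apply: cvg_EFin; [exact: nearW|exact: cf].
have fg' : {ae m, forall x n, D x -> (`|(EFin \o f_ n) x| <= (EFin \o g) x)%E}.
  by apply: aeW => x n Dx; rewrite /= lee_fin; exact: fg.
have [i1 _ h] := dominated_convergence mD mf_' mf' cf' ig fg'.
by apply: fine_cvg; rewrite fineK//; exact: integrable_fin_num.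
Qed.

Section cone_identity.
Variables (R : realType) (d : nat) (T : 'I_d.+1 -> 'rV[R]_d).
Notation V := 'rV[R]_d.
Notation mu := (lebesgue_rV R d).
Hypothesis ndT : Defs.nondegenerate T.
Variable j : 'I_d.+1.
Variables (f : V -> R) (G : V -> V).
Hypothesis fG : has_grad f G.

Let cf : continuous f. Proof. by case: fG. Qed.
Let cG : continuous G. Proof. by case: fG. Qed.

(** The difference quotients of [f] along the rays from [T j] are bounded by
[K] uniformly on the simplex; this dominates the limit in [cone_identity]. *)
Lemma grad_bound : exists2 K, 0 <= K &
  forall x y, elem T x -> elem T y -> `|dotp (G x) (y - T j)| <= K.
Proof.
have cS : continuous (fun x => \sum_i `|G x ord0 i|).
  apply: continuous_sum => i.
  have ci : continuous (fun x : V => x ord0 i) by exact: coord_continuous.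
  by apply: (continuous_compose (continuous_compose cG ci)); exact: norm_continuous.
have [K K0 hK] := continuous_bounded_elem ndT cS.
have [r r0 Tr] := elem_cube ndT.
exists (K * (r + r)); first by rewrite mulr_ge0// addr_ge0// ltW.
move=> x y Tx Ty; apply: (le_trans (ler_norm_sum _ _ _)).
apply: (@le_trans _ _ ((\sum_i `|G x ord0 i|) * (r + r))); last first.
  rewrite ler_wpM2r ?addr_ge0 ?(ltW r0)//.
  by apply: le_trans (hK x Tx); exact: ler_norm.
rewrite mulr_suml; apply: ler_sum => i _; rewrite normrM ler_wpM2l//.
rewrite !mxE; apply: (le_trans (ler_normB _ _)); apply: lerD; apply/ltW/Tr => //.
by apply/(elemP ndT) => k; rewrite bary_vertex.
Qed.

Lemma elem_dil s x : elem T x -> 0 <= s <= 1 -> elem T (dil T j s x).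
Proof.
move=> /(elemP ndT) h /andP[s0 s1]; apply/(elemP ndT) => i.
by rewrite bary_dil// addr_ge0 ?mulr_ge0 ?subr_ge0.
Qed.

Lemma dil_lipschitz K s x : (forall x y, elem T x -> elem T y ->
    `|dotp (G x) (y - T j)| <= K) -> 0 <= s <= 1 -> elem T x ->
  `|f x - f (dil T j s x)| <= K * (1 - s).
Proof.
move=> hK /andP[s0 s1] Tx.
have [t /andP[st t1] E] := has_grad_mvt (T j) (x - T j) fG s1.
have -> : f x - f (dil T j s x) = dotp (G (dil T j t x)) (x - T j) * (1 - s).
  by rewrite /dil -E scale1r [T j + (x - T j)]addrC subrK.
rewrite normrM (ger0_norm (_ : 0 <= 1 - s)) ?subr_ge0// ler_wpM2r ?subr_ge0//.
by apply: hK => //; apply: elem_dil => //; rewrite (le_trans s0 st).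
Qed.

Hypothesis f0 : forall x, side T j x -> f x = 0.

(** Near the side where it vanishes, [f] is at most of the order of the distance
to it; this makes its integral over the shell quadratically small. *)
Lemma vanishing_bound K x : (forall x y, elem T x -> elem T y ->
    `|dotp (G x) (y - T j)| <= K) -> elem T x -> bary T j x < 1 ->
  `|f x| <= K * bary T j x.
Proof.
move=> hK Tx x1; pose r := 1 - bary T j x.
have r0 : 0 < r by rewrite subr_gt0.
have h := (elemP ndT x).1 Tx.
have r1 : r <= 1 by rewrite /r gerBl.
pose y := dil T j r^-1 x.
have yj : bary T j y = 0.
  rewrite bary_dil// eqxx mulr1 (_ : bary T j x = 1 - r); last by rewrite /r; ring.
  by rewrite mulrBr mulr1 mulVf ?gt_eqF//; ring.
have Ty : elem T y.
  apply/(elemP ndT) => i; have [->|ij] := eqVneq i j; first by rewrite yj.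
  by rewrite bary_dil// (negbTE ij) mulr0 add0r mulr_ge0// invr_ge0 ltW.
have -> : f x = - (f y - f (dil T j r y)).
  rewrite (f0 (x := y)); last by apply/(sideP ndT); split=> //; exact/(elemP ndT).
  rewrite sub0r opprK; congr f.
  rewrite /y /dil addrAC subrr add0r scalerA divff ?gt_eqF//.
  by rewrite scale1r [RHS]addrC subrK.
rewrite normrN; apply: (le_trans (dil_lipschitz hK _ Ty)).
  by rewrite r1 ltW.
by rewrite /r opprB addrC subrK.
Qed.

Let s_ (n : nat) : R := 1 - n.+2%:R^-1.

Let s_01 n : 0 < s_ n < 1.
Proof.
rewrite /s_ subr_gt0 gtrBl invr_gt0 ltr0n andbT.
by rewrite invf_lt1 ?ltr0n// ltr1n.
Qed.

Let s_cvg : s_ @ \oo --> (1 : R).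
Proof.
rewrite -[X in _ --> X]subr0; apply: cvgB; first exact: cvg_cst.
by rewrite (@cvg_shiftS _ (fun n : nat => n.+1%:R^-1 : R)); exact: cvg_harmonic.
Qed.

Let q n (x : V) := (f x - s_ n ^+ d * f (dil T j (s_ n) x)) / (1 - s_ n).

Let shift_cvg (W : R -> R) (l : R) : W h @[h --> 0^'] --> l ->
  (fun n => W (s_ n - 1)) @ \oo --> l.
Proof.
move=> Wl; have u0 : (fun n => s_ n - 1) @ \oo --> (0 : R).
  by rewrite -(subrr (1 : R)); apply: cvgB; [exact: s_cvg|exact: cvg_cst].
have u0' : (fun n => s_ n - 1) @ \oo --> (0 : R)^'.
  move=> A A0.
  have h : \forall n \near \oo, s_ n - 1 != 0 -> A (s_ n - 1) := u0 _ A0.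
  apply: filterS h => n; apply.
  by rewrite /s_ [1 - _]addrC addrK oppr_eq0 invr_eq0 pnatr_eq0.
exact: (cvg_comp _ _ u0' Wl).
Qed.

Let q_cvg x : q ^~ x @ \oo --> d%:R * f x + dotp (G x) (x - T j).
Proof.
pose W (h : R) := h^-1 *: (f (h *: (x - T j) + x) - f x).
have qE n : q n x = (\sum_(i < d) s_ n ^+ i) * f x + s_ n ^+ d * W (s_ n - 1).
  have h : 1 - s_ n != 0.
    by rewrite /s_ opprB addrC subrK invr_eq0 pnatr_eq0.
  have -> : W (s_ n - 1) = (f x - f (dil T j (s_ n) x)) / (1 - s_ n).
    rewrite /W (_ : _ *: _ + x = dil T j (s_ n) x).
      by rewrite -[_ *: _]/(_ * _) mulrC -opprB -[s_ n - 1]opprB invrN mulrNN.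
    by rewrite /dil scalerBl scale1r opprB -addrA subrK addrC.
  have e1 : 1 - s_ n ^+ d = (1 - s_ n) * \sum_(i < d) s_ n ^+ i.
    by rewrite -opprB subrX1 -mulNr opprB.
  rewrite /q (_ : f x - _ = (1 - s_ n ^+ d) * f x +
    s_ n ^+ d * (f x - f (dil T j (s_ n) x))); last by ring.
  by rewrite e1; move: (\sum_(i < d) _) => S; field.
under eq_fun do rewrite qE.
rewrite -[dotp _ _]mul1r -[X in X * dotp _ _](expr1n R d).
rewrite (_ : d%:R = \sum_(i < d) (1 : R) ^+ i); last first.
  by under eq_bigr do rewrite expr1n; rewrite sumr_const card_ord.
apply: cvgD; apply: cvgM.
- have cS : continuous (fun s : R => \sum_(i < d) s ^+ i).
    by apply: continuous_sum => i; exact: exprn_continuous.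
  exact: (cvg_comp _ _ s_cvg (cS 1)).
- exact: cvg_cst.
- exact: (cvg_comp _ _ s_cvg (@exprn_continuous R d 1)).
apply: shift_cvg; have [_ _ /(_ x (x - T j))[h1 h2]] := fG.
by rewrite -h2; exact: h1.
Qed.

(** The volume of the dilated simplex, differentiated at scale [1]: the
derivative of [s ^ d * \int_T f (p + s (x - p))] is the integral of
[d f + (x - p) . grad f], and it vanishes since the integral over the shell
between the two simplices is quadratically small. *)
Lemma cone_identity :
  \int[mu]_(x in elem T) (d%:R * f x + dotp (G x) (x - T j)) = 0.
Proof.
have [K K0 hK] := grad_bound.
have [B B0 hB] := continuous_bounded_elem ndT cf.
have mT := elem_measurable ndT.
have s1 n : 1 - s_ n = n.+2%:R^-1 by rewrite /s_ opprB addrC subrK.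
have cq n : continuous (q n).
  apply: continuous_mul; last by move=> x; exact: cst_continuous.
  apply: continuous_sub => //; apply: continuous_mul.
    by move=> x; exact: cst_continuous.
  exact: (continuous_compose (@dil_continuous _ _ T j (s_ n)) cf).
have qb n x : elem T x -> `|q n x| <= d%:R * B + K.
  move=> Tx; have /andP[sn0 sn1] := s_01 n.
  have c0 : 0 < 1 - s_ n by rewrite subr_gt0.
  rewrite /q normrM normfV (gtr0_norm c0) ler_pdivrMr//.
  rewrite (_ : f x - _ = (1 - s_ n ^+ d) * f x +
    s_ n ^+ d * (f x - f (dil T j (s_ n) x))); last by ring.
  apply: (le_trans (ler_normD _ _)); rewrite [leRHS]mulrDl; apply: lerD.
    rewrite normrM mulrAC ler_pM ?hB//.
    by rewrite ger0_norm ?subr_ge0 ?exprn_ile1 ?bernoulli ?(ltW sn0) ?(ltW sn1).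
  rewrite normrM ger0_norm ?exprn_ge0 ?(ltW sn0)//.
  apply: (@le_trans _ _ `|f x - f (dil T j (s_ n) x)|).
    by rewrite ler_piMl// exprn_ile1// ltW.
  by apply: dil_lipschitz => //; rewrite !ltW.
have cI := cone_integrand_continuous (T := T) (j := j) fG.
have lim1 : (fun n => \int[mu]_(x in elem T) q n x) @ \oo -->
    \int[mu]_(x in elem T) (d%:R * f x + dotp (G x) (x - T j)).
  apply: (@Rintegral_dominated_convergence _ _ _ mu _ mT q _ (cst (d%:R * B + K))).
  - by move=> n; apply: measurable_funTS; exact: continuous_measurable_rV.
  - by apply: measurable_funTS; exact: continuous_measurable_rV.
  - by move=> x _; exact: q_cvg.
  - by apply: continuous_integrable_elem => // x; exact: cst_continuous.
  - by move=> n x; exact: qb.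
have if_ : mu.-integrable (elem T) (EFin \o f) by exact: continuous_integrable_elem.
have est n : `|\int[mu]_(x in elem T) q n x| <= K * (d%:R * vol T) * (1 - s_ n).
  have /andP[sn0 sn1] := s_01 n.
  have sn01 : 0 < s_ n <= 1 by rewrite sn0 ltW.
  have c0 : 0 < 1 - s_ n by rewrite subr_gt0.
  have mS := shrunk_measurable ndT j (s_ n).
  have mD : measurable (elem T `\` shrunk T j (s_ n)) by exact: measurableD.
  have iD : mu.-integrable (elem T `\` shrunk T j (s_ n)) (EFin \o f).
    by apply: integrableS if_ => //; exact: subDsetl.
  have cfd : continuous (fun x => f (dil T j (s_ n) x)).
    exact: (continuous_compose (@dil_continuous _ _ T j (s_ n)) cf).
  have ifd : mu.-integrable (elem T) (EFin \o (fun x => f (dil T j (s_ n) x))).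
    exact: continuous_integrable_elem.
  have -> : \int[mu]_(x in elem T) q n x =
      (1 - s_ n)^-1 * \int[mu]_(x in elem T `\` shrunk T j (s_ n)) f x.
    have -> : q n = (fun x => (1 - s_ n)^-1 * (f x - s_ n ^+ d * f (dil T j (s_ n) x))).
      by apply/funext => x; rewrite /q mulrC.
    have cfd' : continuous (fun x => s_ n ^+ d * f (dil T j (s_ n) x)).
      by apply: continuous_mul => // x; exact: cst_continuous.
    rewrite RintegralZl//; last first.
      by apply: continuous_integrable_elem => //; exact: continuous_sub.
    rewrite RintegralB//; last exact: continuous_integrable_elem.
    rewrite RintegralZl// Rintegral_dil//; congr (_ * _).
    have UE : elem T = (elem T `\` shrunk T j (s_ n)) `|` shrunk T j (s_ n).
      by rewrite setUC setDUK//; move=> x [].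
    rewrite {1}UE Rintegral_setU//; last 2 first.
    - by rewrite -UE.
    - by apply/disj_setPS => x [[_ h] /h].
    by rewrite addrK.
  rewrite normrM normfV (gtr0_norm c0) ler_pdivrMl//.
  apply: (le_trans (le_normr_Rintegral mD iD)).
  have [m /andP[m0 mle] Em] := vol_shell ndT j sn01.
  apply: (@le_trans _ _ (\int[mu]_(x in elem T `\` shrunk T j (s_ n)) (K * (1 - s_ n)))).
    apply: le_Rintegral => //.
    - by apply: (@integrable_norm _ _ _ mu).
    - have ic : mu.-integrable (elem T) (EFin \o cst (K * (1 - s_ n))).
        by apply: continuous_integrable_elem => // x; exact: cst_continuous.
      by apply: integrableS ic => //; exact: subDsetl.
    move=> x [Tx h].
    have xs : bary T j x < 1 - s_ n.
      by rewrite ltNge; apply/negP => xs; apply: h.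
    apply: (le_trans (vanishing_bound hK Tx _)).
      by apply: (lt_trans xs); rewrite gtrBl.
    by rewrite ler_wpM2l// ltW.
  rewrite Rintegral_cst// (_ : fine _ = m); last exact: (congr1 fine Em).
  rewrite [leRHS](_ : _ = K * (1 - s_ n) * (d%:R * (1 - s_ n) * vol T)); last by ring.
  by rewrite ler_wpM2l// mulr_ge0// ltW.
have lim2 : (fun n => \int[mu]_(x in elem T) q n x) @ \oo --> (0 : R).
  have c0 : (fun n => K * (d%:R * vol T) * (1 - s_ n)) @ \oo --> (0 : R).
    rewrite -(mulr0 (K * (d%:R * vol T))) -(subrr (1 : R)).
    by apply: cvgM; [exact: cvg_cst|apply: cvgB; [exact: cvg_cst|exact: s_cvg]].
  apply: (squeeze_cvgr _ _ c0); last by rewrite -oppr0; exact: cvgN c0.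
  by apply: nearW => n; rewrite -ler_norml.
exact: (cvg_unique _ lim1 lim2).
Qed.

End cone_identity.

(** * Mean values on sides and fluxes through sides *)

Section affine_map.
Variables (R : realType) (d : nat).
Notation V := 'rV[R]_d.

(** The linear part of the affine map that sends the vertices of [T] to those
of [T']. *)
Definition affine_lin (T T' : 'I_d.+1 -> V) : 'M[R]_d :=
  \sum_i (bgrad T i)^T *m T' i.

Lemma affine_linE (T T' : 'I_d.+1 -> V) (w : V) :
  w *m affine_lin T T' = \sum_i dotp (bgrad T i) w *: T' i.
Proof.
rewrite mulmx_sumr; apply: eq_bigr => i _; rewrite mulmxA.
by rewrite [w *m _]mx11_scalar mul_scalar_mx -dotp_mulmx dotpC.
Qed.

Lemma dotp_bgrad_comb (T : 'I_d.+1 -> V) (c : 'I_d.+1 -> R) k :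
  Defs.nondegenerate T -> \sum_i c i = 0 ->
  dotp (bgrad T k) (\sum_i c i *: T i) = c k.
Proof.
move=> ndT c0; apply/eqP; rewrite -subr_eq0; apply/eqP.
set w := \sum_i c i *: T i.
apply: (bary0_uniq ndT (c := fun i => dotp (bgrad T i) w - c i)).
  by rewrite sumrB -dotp_suml bgrad_sum dotp0l c0 subrr.
by under eq_bigr do rewrite scalerBl; rewrite sumrB bgrad_comb// subrr.
Qed.

Lemma affine_lin_unit (T T' : 'I_d.+1 -> V) : Defs.nondegenerate T ->
  Defs.nondegenerate T' -> affine_lin T T' \in unitmx.
Proof.
move=> ndT ndT'; suff : affine_lin T T' *m affine_lin T' T = 1%:M.
  by move/mulmx1_unit => [].
apply/row_matrixP => i; rewrite !rowE mulmxA mulmx1; set w := delta_mx _ _.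
rewrite affine_linE -[RHS](bgrad_comb ndT); apply: eq_bigr => k _; congr (_ *: _).
rewrite affine_linE dotp_bgrad_comb//.
by rewrite -dotp_suml bgrad_sum dotp0l.
Qed.

Definition affine_map (T T' : 'I_d.+1 -> V) (x : V) : V :=
  x *m affine_lin T T' + (T' ord0 - T ord0 *m affine_lin T T').

Lemma affine_mapE (T T' : 'I_d.+1 -> V) (x : V) :
  affine_map T T' x = \sum_i bary T i x *: T' i.
Proof.
under eq_bigr do rewrite /bary scalerDl; rewrite big_split /= -affine_linE.
rewrite (bigD1 ord0)//= big1 ?addr0; last first.
  by move=> i /negbTE ->; rewrite scale0r.
by rewrite scale1r mulmxBl /affine_map addrCA.
Qed.

Lemma bary_affine_map (T T' : 'I_d.+1 -> V) i x : Defs.nondegenerate T' ->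
  bary T' i (affine_map T T' x) = bary T i x.
Proof.
move=> ndT'; apply: (bary_uniq ndT' (c := bary T ^~ x)); first exact: bary_sum.
exact: affine_mapE.
Qed.

Lemma affine_map_vertex (T T' : 'I_d.+1 -> V) i : Defs.nondegenerate T ->
  affine_map T T' (T i) = T' i.
Proof.
move=> ndT; rewrite affine_mapE (bigD1 i)//= bary_vertex// eqxx scale1r.
by rewrite big1 ?addr0// => k /negbTE ki; rewrite bary_vertex// ki scale0r.
Qed.

Lemma nondegenerate_perm (T : 'I_d.+1 -> V) (s : {perm 'I_d.+1}) :
  Defs.nondegenerate T -> Defs.nondegenerate (T \o s).
Proof.
move=> ndT; rewrite /Defs.nondegenerate row_free_unit -[X in X \in _]/(edge_mx _).
suff : edge_mx (T \o s) *m (\matrix_(k, i) bgrad (T) (s (lift ord0 i)) ord0 k) = 1%:M.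
  by move/mulmx1_unit => [].
apply/matrixP => i k; rewrite !mxE.
transitivity (dotp (bgrad T (s (lift ord0 k))) (T (s (lift ord0 i)) - T (s ord0))).
  by apply: eq_bigr => l _; rewrite !mxE mulrC.
rewrite dotp_bgrad_vertex// bary_vertex//.
rewrite !(inj_eq perm_inj) (inj_eq (@lift_inj _ _)).
by rewrite [lift _ _ == ord0]eq_sym (negbTE (neq_lift _ _)) subr0 eq_sym.
Qed.

Lemma bary_perm (T : 'I_d.+1 -> V) (s : {perm 'I_d.+1}) i x :
  Defs.nondegenerate T -> bary (T \o s) i x = bary T (s i) x.
Proof.
move=> ndT.
apply: (bary_uniq (nondegenerate_perm s ndT) (c := fun i => bary T (s i) x)).
  by rewrite -[RHS](bary_sum T x) [RHS](reindex_inj (@perm_inj _ s)).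
by rewrite -[LHS](bary_comb ndT) [LHS](reindex_inj (@perm_inj _ s)).
Qed.

End affine_map.

Section side_mean.
Variables (R : realType) (d : nat).
Hypothesis hd : (0 < d)%N.
Notation V := 'rV[R]_d.
Notation mu := (lebesgue_rV R d).
Implicit Types (T : 'I_d.+1 -> V) (f : V -> R) (G : V -> V).

(** The mean value of [f] over the side opposite to the vertex [j]: the field
[(x - T j) f] is tangential on the other sides and has normal component [f * d
* vol T / area] on this one, so that its outflow, computed by the divergence
theorem, is the right multiple of the surface integral of [f]. *)
Definition side_mean T j f G : R := (d%:R * vol T)^-1 *
  \int[mu]_(x in elem T) (d%:R * f x + dotp (G x) (x - T j)).

Lemma side_mean0 T j f G : Defs.nondegenerate T -> has_grad f G ->
  (forall x, side T j x -> f x = 0) -> side_mean T j f G = 0.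
Proof. by move=> ndT fG f0; rewrite /side_mean cone_identity// mulr0. Qed.

Lemma side_meanB T j f G f' G' : Defs.nondegenerate T ->
  has_grad f G -> has_grad f' G' ->
  side_mean T j (fun x => f x - f' x) (fun x => G x - G' x) =
  side_mean T j f G - side_mean T j f' G'.
Proof.
move=> ndT fG fG'; rewrite /side_mean -mulrBr; congr (_ * _).
rewrite -RintegralB; last 3 first.
- exact: elem_measurable.
- by apply: continuous_integrable_elem => //; exact: cone_integrand_continuous.
- by apply: continuous_integrable_elem => //; exact: cone_integrand_continuous.
apply: eq_Rintegral => x _; rewrite mulrBr.
by rewrite [dotp (G x - _) _]dotpC dotpBr !(dotpC (x - T j)); ring.
Qed.

(** Under an affine substitution the integrand of [side_mean] is transported
exactly, since [x - T j] is transformed by the linear part and gradients by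
its transpose. *)
Lemma side_mean_affine T T' j f G : Defs.nondegenerate T ->
  Defs.nondegenerate T' -> has_grad f G ->
  side_mean T j (fun x => f (affine_map T T' x))
    (fun x => G (affine_map T T' x) *m (affine_lin T T')^T) =
  side_mean T' j f G.
Proof.
move=> ndT ndT' fG.
pose F := affine_map T T'.
have [c hc] := lebesgue_rV_affine (T' ord0 - T ord0 *m affine_lin T T')
  (affine_lin_unit ndT ndT').
have mF : measurable_fun setT F by exact: measurable_affine.
have FT : F @^-1` elem T' = elem T.
  apply/seteqP; split=> x /=.
    move=> /(elemP ndT') h; apply/(elemP ndT) => i.
    by rewrite -(bary_affine_map T i x ndT').
  move=> /(elemP ndT) h; apply/(elemP ndT') => i.
  by rewrite (bary_affine_map T i x ndT').
have vE : vol T = c%:num * vol T'.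
  by rewrite /vol -FT hc ?fineM//; [exact: elem_fin|exact: elem_measurable].
have cI := cone_integrand_continuous (T := T') (j := j) fG.
have [_ E] := Rintegral_scaled mF hc (elem_measurable ndT')
  (continuous_measurable_rV cI) (continuous_integrable_elem ndT' cI).
have c0 : c%:num != 0.
  by apply: contraTneq (vol_gt0 ndT) => c0; rewrite vE c0 mul0r ltxx.
rewrite /side_mean vE mulrCA invfM -mulrA [X in _ * (_ * X)](_ : _ = c%:num *
    \int[mu]_(x in elem T') (d%:R * f x + dotp (G x) (x - T' j))).
  by rewrite mulrCA mulKf.
rewrite -E FT; apply: eq_Rintegral => x _; congr (_ + _).
have -> : F x - T' j = (x - T j) *m affine_lin T T'.
  rewrite -(affine_map_vertex T' j ndT) /F /affine_map.
  by rewrite mulmxBl opprD addrACA subrr addr0.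
by rewrite !dotp_mulmx trmx_mul mulmxA.
Qed.

End side_mean.

Lemma Rintegral_sum d (X : measurableType d) (R : realType)
    (m : {measure set X -> \bar R}) (D : set X) (mD : measurable D)
    (I : Type) (r : seq I) (f : I -> X -> R) :
  (forall i, m.-integrable D (EFin \o f i)) ->
  m.-integrable D (EFin \o (fun x => \sum_(i <- r) f i x)) /\
  \int[m]_(x in D) (\sum_(i <- r) f i x) = \sum_(i <- r) \int[m]_(x in D) f i x.
Proof.
move=> fi; elim: r => [|i r [IH1 IH2]].
  have -> : (fun x => \sum_(i <- [::]) f i x) = cst 0.
    by apply/funext => x; rewrite big_nil.
  split; first exact: integrable0.
  by rewrite big_nil Rintegral_cst// mul0r.
have -> : (fun x => \sum_(k <- i :: r) f k x) =
    (fun x => f i x + \sum_(k <- r) f k x).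
  by apply/funext => x; rewrite big_cons.
split; first exact: (integrableD mD (fi i) IH1).
by rewrite RintegralD// big_cons IH2.
Qed.

Section fluxes.
Variables (R : realType) (d : nat).
Hypothesis hd : (0 < d)%N.
Notation V := 'rV[R]_d.
Notation mu := (lebesgue_rV R d).
Implicit Types (T : 'I_d.+1 -> V) (f : V -> R) (G : V -> V).

Let d0 : d%:R != 0 :> R. Proof. by rewrite pnatr_eq0 -lt0n. Qed.

Lemma elem_perm T (s : {perm 'I_d.+1}) :
  Defs.nondegenerate T -> elem (T \o s) = elem T.
Proof.
move=> ndT; have ndTs := nondegenerate_perm s ndT.
apply/seteqP; split=> x.
  move=> /(elemP ndTs) h; apply/(elemP ndT) => i.
  by have := h (s^-1%g i); rewrite bary_perm// permKV.
move=> /(elemP ndT) h; apply/(elemP ndTs) => i.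
by rewrite bary_perm.
Qed.

(** The affine map between two simplices that matches a common side fixes that
side, so composing with it does not change the values there. *)
Lemma side_mean_eq T T' (s : {perm 'I_d.+1}) j f G : Defs.nondegenerate T ->
  Defs.nondegenerate T' -> has_grad f G -> (forall i, i != j -> T' (s i) = T i) ->
  side_mean T j f G = side_mean T' (s j) f G.
Proof.
move=> ndT ndT' fG sT.
have ndTs := nondegenerate_perm s ndT'.
have -> : side_mean T' (s j) f G = side_mean (T' \o s) j f G.
  by rewrite /side_mean /vol elem_perm.
rewrite -(side_mean_affine j ndT ndTs fG).
have fG' : has_grad (fun x => f (affine_map T (T' \o s) x))
    (fun x => G (affine_map T (T' \o s) x) *m (affine_lin T (T' \o s))^T).
  exact: has_grad_comp_affine.
apply/esym/eqP; rewrite -subr_eq0 -side_meanB//; apply/eqP.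
apply: side_mean0 => //; first exact: has_gradB.
move=> x /(sideP ndT)[_ xj]; rewrite affine_mapE -{2}[x](bary_comb ndT).
rewrite [X in f X - _](eq_bigr (fun i => bary T i x *: T i)) ?subrr// => i _.
have [->|ij] := eqVneq i j; first by rewrite xj !scale0r.
by rewrite /= sT.
Qed.

(** The cone identity for a coordinate, which vanishes on the side opposite to
its vertex, is an equation for its integral. *)
Lemma Rintegral_bary T j : Defs.nondegenerate T ->
  \int[mu]_(x in elem T) bary T j x = vol T / d.+1%:R.
Proof.
move=> ndT.
have bE : bary T j = fun x =>
    ((j == ord0)%:R - dotp (bgrad T j) (T ord0)) + dotp (bgrad T j) x.
  by apply/funext => x; rewrite /bary dotpBr addrA addrAC.
have bG : has_grad (bary T j) (cst (bgrad T j)).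
  by rewrite bE; exact: has_grad_affine.
have /= := cone_identity ndT bG (fun x h => ((sideP ndT j x).1 h).2).
have -> : (fun x => d%:R * bary T j x + dotp (bgrad T j) (x - T j)) =
    fun x => d.+1%:R * bary T j x - 1.
  apply/funext => x; rewrite dotp_bgrad_vertex// eqxx addrA -natr1 mulrDl mul1r.
  by [].
have ib : mu.-integrable (elem T) (EFin \o bary T j).
  by apply: continuous_integrable_elem => //; exact: bary_continuous.
have mT := elem_measurable ndT.
rewrite RintegralB//; last 2 first.
- by apply: continuous_integrable_elem => //; apply: continuous_mul => x;
    [exact: cst_continuous|exact: bary_continuous].
- by apply: continuous_integrable_elem => // x; exact: cst_continuous.
rewrite RintegralZl// Rintegral_cst// mul1r => /eqP.
rewrite subr_eq0 => /eqP E; apply: (canRL (mulfK _)); first by rewrite pnatr_eq0.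
by rewrite mulrC E.
Qed.

Lemma affine_bary T c g x : Defs.nondegenerate T ->
  c + dotp g x = \sum_j (c + dotp g (T j)) * bary T j x.
Proof.
move=> ndT; under eq_bigr do rewrite mulrDl; rewrite big_split /=.
rewrite -mulr_sumr bary_sum mulr1; congr (_ + _).
rewrite -{1}[x](bary_comb ndT) dotp_sumr.
by apply: eq_bigr => j _; rewrite dotpZr mulrC.
Qed.

Lemma Rintegral_affine T c g : Defs.nondegenerate T ->
  \int[mu]_(x in elem T) (c + dotp g x) = vol T * (c + dotp g (elem_mid T)).
Proof.
move=> ndT; under eq_Rintegral do rewrite (affine_bary c g _ ndT).
have mT := elem_measurable ndT.
have ib j : mu.-integrable (elem T) (EFin \o bary T j).
  by apply: continuous_integrable_elem => //; exact: bary_continuous.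
have [|_ ->] := @Rintegral_sum _ _ _ mu _ mT _ (index_enum 'I_d.+1)
   (fun j x => (c + dotp g (T j)) * bary T j x).
  move=> j; apply: continuous_integrable_elem => //; apply: continuous_mul => x;
    [exact: cst_continuous|exact: bary_continuous].
rewrite (affine_bary c g (elem_mid T) ndT) mulr_sumr; apply: eq_bigr => j _.
by rewrite RintegralZl// Rintegral_bary// bary_elem_mid// mulrCA.
Qed.

Lemma side_mid_elem_mid T j : side_mid T j = elem_mid T + d%:R^-1 *: (elem_mid T - T j).
Proof.
rewrite /side_mid /elem_mid.
have -> : \sum_(i | i != j) T i = \sum_i T i - T j.
  by rewrite [X in _ = X - _](bigD1 j)//= [T j + _]addrC addrK.
rewrite !scalerBr addrA scalerA -scalerDl; congr (_ *: _ - _).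
by rewrite -natr1; field; rewrite d0 natr1 pnatr_eq0.
Qed.

Lemma side_mean_aff T j c g : Defs.nondegenerate T ->
  side_mean T j (fun x => c + dotp g x) (cst g) = c + dotp g (side_mid T j).
Proof.
move=> ndT; rewrite /side_mean.
have -> : (fun x => d%:R * (c + dotp g x) + dotp (cst g x) (x - T j)) =
    fun x => (d%:R * c - dotp g (T j)) + dotp (d.+1%:R *: g) x.
  by apply/funext => x; rewrite dotpBr dotpZl -natr1 /=; ring.
rewrite Rintegral_affine// side_mid_elem_mid dotpDr
  [dotp g (d%:R^-1 *: _)]dotpZr dotpZl dotpBr -natr1.
by have v0 := vol_gt0 ndT; field; rewrite d0 gt_eqF.
Qed.

(** The outflow of [x |-> a + b (x - x_T)] through the side opposite to the
vertex [j]. The normal component is constant there; see [flux_normal]. *)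
Definition flux T (a : V) (b : R) j : R :=
  d%:R * vol T * (b / d.+1%:R - dotp (bgrad T j) a).

Lemma sum_flux T a b : Defs.nondegenerate T ->
  \sum_j (b / d.+1%:R - dotp (bgrad T j) a) = b.
Proof.
move=> ndT; rewrite sumrB -dotp_suml bgrad_sum dotp0l subr0 sumr_const card_ord.
by rewrite -[LHS]mulr_natl mulrCA divff ?mulr1// pnatr_eq0.
Qed.

(** Each of the fields [x - T j] flows out through a single side, so this
expansion separates the sides. *)
Lemma flux_expand T a b x : Defs.nondegenerate T ->
  \sum_j (b / d.+1%:R - dotp (bgrad T j) a) *: (x - T j) = a + b *: (x - elem_mid T).
Proof.
move=> ndT; under eq_bigr do rewrite scalerBr.
rewrite sumrB -scaler_suml sum_flux//.
under [X in b *: x - X]eq_bigr do rewrite scalerBl.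
rewrite sumrB -scaler_sumr bgrad_comb// opprB addrCA scalerBr; congr (_ + (_ - _)).
by rewrite /elem_mid scalerA.
Qed.

Lemma divergence_theorem T a b f G : Defs.nondegenerate T -> has_grad f G ->
  \int[mu]_(x in elem T) (dotp (a + b *: (x - elem_mid T)) (G x) + d%:R * b * f x)
  = \sum_j flux T a b j * side_mean T j f G.
Proof.
move=> ndT fG; have mT := elem_measurable ndT.
pose k j := b / d.+1%:R - dotp (bgrad T j) a.
have E x : dotp (a + b *: (x - elem_mid T)) (G x) + d%:R * b * f x =
    \sum_j k j * (d%:R * f x + dotp (G x) (x - T j)).
  under eq_bigr do rewrite mulrDr; rewrite big_split /= -mulr_suml sum_flux//.
  rewrite -flux_expand// dotp_suml [LHS]addrC; congr (_ + _); first by ring.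
  by apply: eq_bigr => j _; rewrite dotpZl [dotp _ (G x)]dotpC.
under eq_Rintegral do rewrite E.
have ci j := cone_integrand_continuous (T := T) (j := j) fG.
have [|_ ->] := @Rintegral_sum _ _ _ mu _ mT _ (index_enum 'I_d.+1)
   (fun j x => k j * (d%:R * f x + dotp (G x) (x - T j))).
  move=> j; apply: continuous_integrable_elem => //; apply: continuous_mul => //.
  by move=> x; exact: cst_continuous.
apply: eq_bigr => j _; rewrite RintegralZl//; last exact: continuous_integrable_elem.
rewrite /flux /side_mean -/(k j); set I := Rintegral _ _ _.
by field; rewrite d0 gt_eqF// vol_gt0.
Qed.

(** The divergence theorem for an affine function, whose mean over a side is
its value at the midpoint. This is the discrete integration by parts behind
the duality of Crouzeix--Raviart and Raviart--Thomas functions. *)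
Lemma affine_flux T a b c g : Defs.nondegenerate T ->
  vol T * (dotp a g + d%:R * b * (c + dotp g (elem_mid T))) =
  \sum_j flux T a b j * (c + dotp g (side_mid T j)).
Proof.
move=> ndT; have := divergence_theorem a b ndT (has_grad_affine g c).
under [in X in _ = X -> _]eq_bigr do rewrite side_mean_aff//.
move=> <-.
have -> : (fun x => dotp (a + b *: (x - elem_mid T)) (cst g x) + d%:R * b * (c + dotp g x)) =
   fun x => (dotp a g - b * dotp (elem_mid T) g + d%:R * b * c)
      + dotp ((b * (1 + d%:R)) *: g) x.
  apply/funext => x /=; move: (elem_mid T) => m; rewrite dotpDl !dotpZl [dotp (x - _) g]dotpC dotpBr.
  by rewrite (dotpC g m); ring.
rewrite Rintegral_affine//; move: (elem_mid T) => m.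
rewrite dotpZl (dotpC g m); congr (_ * _).
by ring.
Qed.

End fluxes.

(** * Sides of a conforming triangulation *)

Section lipschitz_domain.
Variables (R : realType) (d : nat).
Notation V := 'rV[R]_d.

Lemma open_segment (U : set V) (x v : V) : open U -> U x ->
  exists2 e : R, 0 < e < 1 & forall s, `|s| <= e -> U (x + s *: v).
Proof.
move=> oU Ux.
have cts : (fun t : R => x + t *: v) @ 0 --> x.
  rewrite -[X in _ --> X]addr0 -(scale0r v).
  apply: cvgD; first exact: cvg_cst.
  by apply: cvgZ; [exact: cvg_id|exact: cvg_cst].
have nU : nbhs x U by exact: open_nbhs_nbhs.
have [e /= e0 he] := (cts _ nU : nbhs 0 _) : exists2 e : R, 0 < e & _.
exists (Num.min (1 / 2) (e / 2)).
  rewrite lt_min gt_min !divr_gt0//=.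
  by rewrite ltr_pdivrMr// mul1r ltr1n.
move=> s; rewrite le_min => /andP[_ se]; apply: he; rewrite /= sub0r normrN.
by apply: (le_lt_trans se); rewrite ltr_pdivrMr// ltr_pMr// ltr1n.
Qed.

(** Below a boundary point of an epigraph, the complement has interior points;
so a Lipschitz domain is the interior of its closure. *)
Lemma lipschitz_interior_closure (Om : set V) : open Om ->
  lipschitz_boundary Om -> interior (closure Om) `<=` Om.
Proof.
move=> oO lip x ix; apply: contrapT => nOx.
have bx : boundary Om x.
  by split; [exact: interior_subset ix|move=> /interior_subset].
have [e [g [L [r [ee r0 gL gO]]]]] := lip x bx.
have L0 : 0 <= L.
  apply: contrapT => /negP; rewrite -ltNge => L0.
  have e0 : e != 0.
    by apply: contra_eq_neq ee => ->; rewrite dotp0r eq_sym oner_eq0.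
  have := gL e 0; rewrite subr0 => h.
  have := le_trans (normr_ge0 _) h.
  by rewrite nmulr_rge0// normr_le0 (negbTE e0).
pose p (y : V) := y - dotp y e *: e.
have oB : open (ball x r `&` interior (closure Om)).
  by apply: openI; [exact: ball_open|exact: open_interior].
have [s /andP[s0 _] hs] := open_segment (- e) oB (conj (ballxx _ r0) ix).
have [xr xO] := hs s ltac:(by rewrite gtr0_norm).
set y := x + s *: (- e) in xr xO.
have ye : dotp y e = dotp x e - s.
  by rewrite /y scalerN -scaleNr dotpDl dotpZl ee mulr1.
have pe : p y = p x.
  by rewrite /p ye /y scalerN scalerBl opprB addrA subrK.
have nx : dotp x e <= g (p x).
  rewrite leNgt; apply/negP => /(gO _ (ballxx _ r0)); exact: nOx.
have cdot : continuous (fun z : V => dotp z e).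
  rewrite (_ : (fun z => dotp z e) = dotp e); first exact: dotp_continuous.
  by apply/funext => z; rewrite dotpC.
pose h (z : V) := L * `|p z - p x| + dotp z e.
have ch : continuous h.
  apply: continuous_add => //; apply: continuous_mul.
    by move=> z; exact: cst_continuous.
  have cp : continuous (fun z : V => p z - p x).
    apply: continuous_sub; last by move=> z; exact: cst_continuous.
    apply: continuous_sub; first by move=> z; exact: cvg_id.
    by apply: continuous_scale => // z; exact: cst_continuous.
  exact: (continuous_compose cp (@norm_continuous _ _)).
pose U := [set z : V | h z < g (p x)].
have oU : open U.
  apply: (@open_comp _ _ h [set c | c < g (p x)]); last exact: open_lt.
  by move=> z _; exact: ch.
have Uy : U y.
  rewrite /U /= /h pe subrr normr0 mulr0 add0r ye.
  by apply: lt_le_trans nx; rewrite ltrBlDr ltrDl.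
have nU : nbhs y (U `&` ball x r).
  apply: open_nbhs_nbhs; split; last by split.
  by apply: openI => //; exact: ball_open.
have [z [Oz [Uz xz]]] := interior_subset xO _ nU.
have := (gO z xz).1 Oz; rewrite -/(p z) ltNge => /negP; apply.
rewrite -subr_ge0; move: Uz; rewrite /U /= /h -subr_gt0 => Uz.
have := gL (p z) (p x); rewrite ler_norml => /andP[gl _].
have : 0 < g (p z) - dotp z e by lra.
exact: ltW.
Qed.

End lipschitz_domain.

Section faces.
Variables (R : realType) (d : nat).
Notation V := 'rV[R]_d.
Implicit Types T : 'I_d.+1 -> V.

Lemma bary_sum_comb T i (c : 'I_d.+1 -> R) (p : 'I_d.+1 -> V) :
  \sum_k c k = 1 -> bary T i (\sum_k c k *: p k) = \sum_k c k * bary T i (p k).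
Proof.
move=> c1; rewrite /bary; under [RHS]eq_bigr do rewrite mulrDr.
rewrite big_split /= -mulr_suml c1 mul1r; congr (_ + _).
under [RHS]eq_bigr do rewrite dotpBr mulrBr.
rewrite sumrB -mulr_suml c1 mul1r dotpBr dotp_sumr; congr (_ - _).
by apply: eq_bigr => k _; rewrite dotpZr.
Qed.

(** A vertex is an extreme point of the common hull, so it is one of the
points [T' k] of which it is a convex combination. *)
Lemma conv_hull_vertex T T' (A B : {set 'I_d.+1}) i : Defs.nondegenerate T ->
  Defs.nondegenerate T' -> conv_hull A T = conv_hull B T' -> i \in A ->
  exists2 k, k \in B & T' k = T i.
Proof.
move=> ndT ndT' AB iA.
have /(conv_hullP ndT') [c0 cB] : conv_hull B T' (T i).
  rewrite -AB; apply/(conv_hullP ndT); split=> j; rewrite bary_vertex//.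
  by case: eqVneq => // ->; rewrite iA.
pose c k := bary T' k (T i).
have c1 : \sum_k c k = 1 by exact: bary_sum.
have [k ck] : exists k, 0 < c k.
  apply: contrapT => /forallNP h.
  have : \sum_k c k <= 0.
    by apply: sumr_le0 => k _; rewrite leNgt; apply/negP/h.
  by rewrite c1 ler10.
have kB : k \in B by apply: contraTT ck => /cB; rewrite /c => ->; rewrite ltxx.
exists k => //; apply: (bary_inj ndT) => l; rewrite bary_vertex//.
have inA m : m \in B -> forall l, 0 <= bary T l (T' m) <= 1.
  move=> mB l'.
  have Am : conv_hull A T (T' m).
    rewrite AB; apply/(conv_hullP ndT'); split=> j; rewrite bary_vertex//.
    by case: eqVneq => // ->; rewrite mB.
  have Tm := conv_hull_elem ndT Am.
  by rewrite bary_le1// andbT; exact: (elemP ndT _).1.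
have bi : bary T i (T' k) = 1.
  have E : \sum_m c m * (1 - bary T i (T' m)) = 0.
    under eq_bigr do rewrite mulrBr mulr1; rewrite sumrB c1 -bary_sum_comb//.
    by rewrite bary_comb// bary_vertex// eqxx subrr.
  have ge0 m : 0 <= c m * (1 - bary T i (T' m)).
    have [mB|mB] := boolP (m \in B).
      by rewrite mulr_ge0 ?c0// subr_ge0; case/andP: (inA m mB i).
    by rewrite /c cB// mul0r.
  move/eqP : E; rewrite psumr_eq0// => /allP /(_ k (mem_index_enum _)) /=.
  by rewrite mulf_eq0 gt_eqF//= subr_eq0 => /eqP.
have [->|li] := eqVneq l i; first by [].
apply/eqP; rewrite eq_le; case/andP: (inA k kB l) => -> _; rewrite andbT.
have := bary_sum T (T' k); rewrite (bigD1 i)//= bi (bigD1 l)//=.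
move/eqP; rewrite -[eqbRHS]addr0 (inj_eq (addrI _)) addr_eq0 => /eqP ->.
by rewrite oppr_le0 sumr_ge0// => m _; case/andP: (inA k kB m).
Qed.

Lemma conv_hull_card T T' (A B : {set 'I_d.+1}) : Defs.nondegenerate T ->
  Defs.nondegenerate T' -> conv_hull A T = conv_hull B T' -> (#|A| <= #|B|)%N.
Proof.
move=> ndT ndT' AB.
have h i : exists k, i \in A -> (k \in B) && (T' k == T i).
  have [iA|iA] := boolP (i \in A); last by exists i.
  by have [k kB kE] := conv_hull_vertex ndT ndT' AB iA; exists k; rewrite kB kE eqxx.
have [f fP] := choice h.
rewrite -(@card_in_imset _ _ f A).
  apply: subset_leq_card; apply/fintype.subsetP => _ /imsetP[i iA ->].
  by case/andP: (fP i iA).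
move=> i k iA kA fik; apply: (vertex_inj ndT).
by case/andP: (fP i iA) => _ /eqP <-; case/andP: (fP k kA) => _ /eqP <-; rewrite fik.
Qed.

(** A common side has the same vertices in both simplices; the permutation
matches these, and the two opposite vertices. *)
Lemma sharing_vertices T T' j j' : Defs.nondegenerate T ->
  Defs.nondegenerate T' -> side T j = side T' j' ->
  exists s : {perm 'I_d.+1}, s j = j' /\ forall i, i != j -> T' (s i) = T i.
Proof.
move=> ndT ndT' SS'.
have h i : exists k, if i == j then k = j' else k != j' /\ T' k = T i.
  case: eqVneq => [_|ij]; first by exists j'.
  have iA : i \in [set~ j]%SET by rewrite !inE.
  have [k] := conv_hull_vertex ndT ndT' SS' iA.
  by rewrite !inE => kj' kE; exists k.
have [f fP] := choice h.
have fj : f j = j' by have := fP j; rewrite eqxx.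
have finj : injective f.
  move=> i k fik; have := fP i; have := fP k.
  case: (eqVneq k j) => [kj|kj]; case: (eqVneq i j) => [ij|ij].
  - by rewrite ij kj.
  - by move=> fk [/eqP]; rewrite fik fk.
  - by move=> [/eqP fk _] fi; case: fk; rewrite -fik.
  - by move=> [_ ek] [_ ei]; apply: (vertex_inj ndT); rewrite -ei -ek fik.
exists (perm finj); rewrite permE; split=> // i ij.
by rewrite permE; have := fP i; rewrite (negbTE ij) => -[].
Qed.

Definition side_cone T j : set V := [set x | forall i, i != j -> 0 < bary T i x].

Lemma side_cone_open T j : open (side_cone T j).
Proof.
rewrite (_ : side_cone T j = [set x : V | forall i,
    [set x : V | i != j -> 0 < bary T i x] x]) //.
apply: open_forall_ord => i; have [->|ij] := eqVneq i j.
  rewrite (_ : mkset _ = setT); first exact: openT.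
  by apply/seteqP; split.
rewrite (_ : mkset _ = [set x | 0 < bary T i x]); first exact: open_bary_gt.
by apply/seteqP; split=> x //=; apply.
Qed.

Hypothesis hd : (0 < d)%N.

Definition relint_side T j x := bary T j x = 0 /\ forall i, i != j -> 0 < bary T i x.

Lemma relint_side_sub T j x : Defs.nondegenerate T -> relint_side T j x -> side T j x.
Proof.
move=> ndT [xj xi]; apply/(sideP ndT); split=> // i.
by have [->|/xi/ltW] := eqVneq i j; rewrite ?xj.
Qed.

Lemma relint_side_mid T j : Defs.nondegenerate T -> relint_side T j (side_mid T j).
Proof.
move=> ndT; split=> [|i ij]; rewrite bary_side_mid// ?eqxx ?mul0r// ij.
by rewrite divr_gt0// ltr0n.
Qed.

Lemma side_inj T j k : Defs.nondegenerate T -> side T j = side T k -> j = k.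
Proof.
move=> ndT jk; have [mj mi] := relint_side_mid j ndT.
have : side T k (side_mid T j).
  by rewrite -jk; apply: relint_side_sub => //; exact: relint_side_mid.
move=> /(sideP ndT)[_ mk]; apply/eqP/negPn/negP; rewrite eq_sym => /mi.
by rewrite mk ltxx.
Qed.

Lemma side_mid_eq T T' j j' : Defs.nondegenerate T -> Defs.nondegenerate T' ->
  side T j = side T' j' -> side_mid T j = side_mid T' j'.
Proof.
move=> ndT ndT' /(sharing_vertices ndT ndT')[s [sj sT]]; rewrite /side_mid.
congr (_ *: _); rewrite [RHS](reindex_inj (@perm_inj _ s)) /=.
apply: eq_big => [i|i ij]; first by rewrite -sj (inj_eq perm_inj).
by rewrite sT.
Qed.

End faces.

Section conforming.
Variables (R : realType) (d : nat).
Hypothesis hd : (0 < d)%N.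
Notation V := 'rV[R]_d.
Variables (Om : set V) (N : nat) (Th : 'I_N -> 'I_d.+1 -> V).
Hypothesis hTh : regular_triangulation Om Th.

Let nd t : Defs.nondegenerate (Th t). Proof. by case: hTh. Qed.

(** Two different elements do not share all their vertices, so their common
face is a proper one. *)
Lemma common_face t t' : t != t' -> exists A B : {set 'I_d.+1},
  [/\ elem (Th t) `&` elem (Th t') = conv_hull A (Th t),
      elem (Th t) `&` elem (Th t') = conv_hull B (Th t') &
      exists i, i \notin A].
Proof.
move=> tt'; have [_ inj /(_ t t')[A [B [EA EB]]] _] := hTh.
exists A, B; split=> //; apply: contrapT => /forallNP hA.
have AT : A = [set: 'I_d.+1]%SET.
  by apply/setP => i; rewrite inE; apply/negPn/negP; exact: hA.
have BT : B = [set: 'I_d.+1]%SET.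
  apply/eqP; rewrite eqEcard finset.subsetT /=.
  by rewrite -{1}AT; apply: (conv_hull_card (nd t) (nd t')); rewrite -EA.
move/eqP: tt'; apply; apply: inj.
by rewrite /elem -{1}AT -BT -EA.
Qed.

Lemma open_elem_notin t t' x : t != t' -> open_elem (Th t) x -> ~ elem (Th t') x.
Proof.
move=> /common_face[A [B [EA _ [i iA]]]] ox ex.
have /(conv_hullP (nd t))[_ /(_ i iA) xi] : conv_hull A (Th t) x.
  by rewrite -EA; split=> //; exact: open_elem_sub.
by have := ox i; rewrite xi ltxx.
Qed.

(** The common face contains a point of the relative interior of the side and
is proper; hence it is the side. *)
Lemma common_side t t' j x : t != t' -> relint_side (Th t) j x ->
  elem (Th t') x -> elem (Th t) `&` elem (Th t') = side (Th t) j /\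
  exists j', side (Th t) j = side (Th t') j'.
Proof.
move=> tt' [xj xi] ex; have [A [B [EA EB [i iA]]]] := common_face tt'.
have /(conv_hullP (nd t))[_ xA] : conv_hull A (Th t) x.
  by rewrite -EA; split=> //; apply: conv_hull_elem (relint_side_sub (nd t) (conj xj xi)).
have ij : i = j.
  by apply/eqP/negPn/negP => /xi; rewrite xA// ltxx.
have AE : A = [set~ j]%SET.
  apply/setP => k; rewrite !inE; apply/idP/idP => [kA|kj].
    by apply: contraTneq kA => ->; rewrite -ij.
  by apply/negPn/negP => /xA kx; have := xi k kj; rewrite kx ltxx.
have ES : elem (Th t) `&` elem (Th t') = side (Th t) j by rewrite EA AE.
split=> //.
have AB : conv_hull A (Th t) = conv_hull B (Th t') by rewrite -EA -EB.
have cB : #|B| = d.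
  have := conv_hull_card (nd t) (nd t') AB; have := conv_hull_card (nd t') (nd t) (esym AB).
  rewrite AE cardsC1 card_ord /= => h1 h2.
  by apply/eqP; rewrite eqn_leq h1.
have /eqP/cards1P[j' Bj'] : #|~: B|%SET = 1%N.
  have := cardsC B; rewrite card_ord cB => E.
  by apply/eqP; rewrite -(eqn_add2l d) E addn1.
exists j'; rewrite -ES EB /side; congr conv_hull.
by rewrite -[LHS]finset.setCK Bj'.
Qed.

(** Both coordinates are affine and vanish on the common side, so they are
proportional. *)
Lemma bary_shared t t' j j' : side (Th t) j = side (Th t') j' ->
  forall x, bary (Th t) j x = bary (Th t) j (Th t' j') * bary (Th t') j' x.
Proof.
move=> SS' x; have [s [sj sT]] := sharing_vertices (nd t) (nd t') SS'.
rewrite -{1}[x](bary_comb (nd t')) bary_sum_comb ?bary_sum//.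
rewrite (bigD1 j')//= big1 ?addr0; first by rewrite mulrC.
move=> k kj'; have sk : (s^-1%g k) != j.
  by apply: contraNneq kj' => kj; rewrite -sj -kj permKV.
have -> : Th t' k = Th t (s^-1%g k) by rewrite -sT// permKV.
by rewrite bary_vertex// eq_sym (negbTE sk) mulr0.
Qed.

(** Otherwise the two elements would overlap near the midpoint of the side. *)
Lemma opposite_sides t t' j j' : t != t' -> side (Th t) j = side (Th t') j' ->
  bary (Th t) j (Th t' j') < 0.
Proof.
move=> tt' SS'; rewrite ltNge le_eqVlt; apply/negP => /orP[/eqP b0|b0].
  have := bary_shared SS' (Th t j); rewrite -b0 mul0r bary_vertex// eqxx => /eqP.
  by rewrite oner_eq0.
pose m := side_mid (Th t) j; have [mj mi] := relint_side_mid hd j (nd t).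
have [e /andP[e0 e1] he] := open_segment (Th t' j' - m) (@side_cone_open _ _ (Th t) j) mi.
pose x := m + e *: (Th t' j' - m).
have Ux : side_cone (Th t) j x by apply: he; rewrite gtr0_norm.
apply: (open_elem_notin (x := x) tt').
  move=> i; have [->|ij] := eqVneq i j; last exact: Ux.
  by rewrite bary_segment mj mulr0 add0r mulr_gt0.
apply/(elemP (nd t')) => i; rewrite bary_segment.
have /(sideP (nd t'))[m0 _] : side (Th t') j' m.
  by rewrite -SS'; apply: relint_side_sub => //; exact: relint_side_mid.
by rewrite addr_ge0 ?mulr_ge0 ?subr_ge0 ?bary_vertex// ltW.
Qed.

(** Of three elements with a common side, two would lie on the same side of
its hyperplane. *)
Lemma side_unique t t' t'' j j' j'' : t != t' -> t != t'' -> t' != t'' ->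
  side (Th t) j = side (Th t') j' -> side (Th t) j = side (Th t'') j'' -> False.
Proof.
move=> tt' tt'' t't'' S1 S2.
have b1 := opposite_sides tt' S1; have b2 := opposite_sides tt'' S2.
have b3 := opposite_sides t't'' (etrans (esym S1) S2).
by move: b2; rewrite (bary_shared S1) nmulr_rlt0// => /(lt_trans b3); rewrite ltxx.
Qed.

(** A neighbourhood of the relative interior of a common side. *)
Definition lens t t' j j' : set V := side_cone (Th t) j `&` side_cone (Th t') j'.

Lemma lens_open t t' j j' : open (lens t t' j j').
Proof. by apply: openI; exact: side_cone_open. Qed.

Lemma lens_sub t t' j j' : t != t' -> side (Th t) j = side (Th t') j' ->
  lens t t' j j' `<=` elem (Th t) `|` elem (Th t').
Proof.
move=> tt' SS' x [h h']; have b0 := opposite_sides tt' SS'.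
have [xj|xj] := leP 0 (bary (Th t) j x).
  left; apply/(elemP (nd t)) => i.
  by have [->//|/h/ltW] := eqVneq i j.
right; apply/(elemP (nd t')) => i; have [->|/h'/ltW//] := eqVneq i j'.
by move: xj; rewrite (bary_shared SS') nmulr_rlt0// => /ltW.
Qed.

Lemma lens_relint t t' j j' x : side (Th t) j = side (Th t') j' ->
  relint_side (Th t) j x -> lens t t' j j' x /\ relint_side (Th t') j' x.
Proof.
move=> SS' xr; have [s [sj sT]] := sharing_vertices (nd t) (nd t') SS'.
have xs : side (Th t') j' x by rewrite -SS'; exact: relint_side_sub.
have [x0 xj'] := (sideP (nd t') _ _).1 xs.
have r' : relint_side (Th t') j' x.
  split=> // k kj'; rewrite lt_neqAle x0 andbT eq_sym; apply/eqP => xk.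
  have [xj xi] := xr; have kE := permKV s k.
  have sk : (s^-1%g k) != j by apply: contraNneq kj' => kj; rewrite -sj -kj permKV.
  have := xi _ sk; suff -> : bary (Th t) (s^-1%g k) x = 0 by rewrite ltxx.
  rewrite -[x](bary_comb (nd t')) bary_sum_comb ?bary_sum//.
  apply: big1 => l _; have [->|lk] := eqVneq l k; first by rewrite xk mul0r.
  have [->|lj'] := eqVneq l j'; first by rewrite xj' mul0r.
  have sl : (s^-1%g l) != j.
    by apply: contraNneq lj' => lj; rewrite -sj -lj permKV.
  have -> : Th t' l = Th t (s^-1%g l) by rewrite -sT// permKV.
  by rewrite bary_vertex// (inj_eq perm_inj) eq_sym (negbTE lk) mulr0.
by split=> //; split; [case: xr|case: r'].
Qed.

End conforming.

Section domain_sides.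
Variables (R : realType) (d : nat).
Hypothesis hd : (0 < d)%N.
Notation V := 'rV[R]_d.
Variable Om : set V.
Hypothesis hOm : bounded_polyhedral_lipschitz_domain Om.
Variables (N : nat) (Th : 'I_N -> 'I_d.+1 -> V).
Hypothesis hTh : regular_triangulation Om Th.

Let nd t : Defs.nondegenerate (Th t). Proof. by case: hTh. Qed.
Let oOm : open Om. Proof. by case: hOm => [[]]. Qed.

Lemma interior_closure_domain : interior (closure Om) `<=` Om.
Proof. by case: hOm => [[_ o _]] [_ _ lip]; exact: lipschitz_interior_closure. Qed.

Lemma closure_domainP x : closure Om x <-> exists t, elem (Th t) x.
Proof.
case: hTh => _ _ _ ->; split=> [[t _ h]|[t h]]; exists t => //.
Qed.

Lemma elem_closure t : elem (Th t) `<=` closure Om.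
Proof. by move=> x tx; apply/closure_domainP; exists t. Qed.

(** The domain is the interior of its closure, which is the union of the
elements. This is where the regularity of the boundary enters. *)
Lemma open_sub_domain (U : set V) : open U -> U `<=` closure Om -> U `<=` Om.
Proof.
move=> oU Uc x Ux; apply: interior_closure_domain.
have Ui : U `<=` interior (closure Om) by rewrite -open_subsetE.
exact: Ui.
Qed.

Lemma open_elem_domain t : open_elem (Th t) `<=` Om.
Proof.
apply: open_sub_domain; first exact: open_elem_open.
by move=> x /(open_elem_sub (nd t)); exact: elem_closure.
Qed.

Lemma lens_domain t t' j j' : t != t' -> side (Th t) j = side (Th t') j' ->
  lens Th t t' j j' `<=` Om.
Proof.
move=> tt' SS'; apply: open_sub_domain; first exact: lens_open.
by move=> x /(lens_sub hd hTh tt' SS')[]; exact: elem_closure.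
Qed.

Lemma boundary_notin x : boundary Om x -> ~ Om x.
Proof. by move=> [_ h] Ox; apply: h; exact: open_nbhs_nbhs. Qed.

Lemma boundary_side_unique t t' j j' : side (Th t) j `<=` boundary Om ->
  side (Th t) j = side (Th t') j' -> t = t' /\ j = j'.
Proof.
move=> bS SS'; have [tt'|tt'] := eqVneq t t'.
  by split=> //; apply: (side_inj hd (nd t)); rewrite SS' tt'.
exfalso; have r := relint_side_mid hd j (nd t).
apply: (boundary_notin (bS _ (relint_side_sub (nd t) r))).
by apply: (lens_domain tt' SS'); case: (lens_relint hTh SS' r).
Qed.

(** Let [y] be a point of the side in the domain, and move it slightly towards
the midpoint of the side, to a relative interior point. If no other element
contained this point, then the points of the domain just behind the side would
belong to no element. *)
Lemma interior_side_neighbor t j : ~ (side (Th t) j `<=` boundary Om) ->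
  exists t' j', t != t' /\ side (Th t) j = side (Th t') j'.
Proof.
move=> nb; have [y [Sy nby]] : exists y, side (Th t) j y /\ ~ boundary Om y.
  apply: contrapT => /forallNP h; apply: nb => y Sy.
  by apply: contrapT => nby; apply: (h y).
have Oy : Om y.
  apply: contrapT => nOy; apply: nby; split.
    by apply: (@elem_closure t); exact: conv_hull_elem Sy.
  by move=> /interior_subset.
pose m := side_mid (Th t) j; have [mj mi] := relint_side_mid hd j (nd t).
have [e /andP[e0 e1] he] := open_segment (m - y) oOm Oy.
pose x := y + e *: (m - y).
have Ox : Om x by apply: he; rewrite gtr0_norm.
have [y0 yj] := (sideP (nd t) _ _).1 Sy.
have xr : relint_side (Th t) j x.
  split=> [|i ij]; rewrite bary_segment; first by rewrite yj mj !mulr0 addr0.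
  by rewrite ltr_wpDl ?mulr_ge0 ?subr_ge0 ?(ltW e1)// mulr_gt0// mi.
suff [t' [tt' xt']] : exists t', t != t' /\ elem (Th t') x.
  by have [_ [j' SS']] := common_side hTh tt' xr xt'; exists t', j'.
apply: contrapT => /forallNP h.
pose U := [set z : V | forall t', [set z : V | t != t' -> ~ elem (Th t') z] z].
have oU : open U.
  apply: open_forall_ord => t'; have [tt'|tt'] := eqVneq t t'.
    rewrite [X in open X](_ : _ = setT); first exact: openT.
    by apply/seteqP; split=> // z _ /=; rewrite ?tt' ?eqxx.
  rewrite [X in open X](_ : _ = ~` elem (Th t')).
    by apply: closed_openC; exact: elem_closed.
  by apply/seteqP; split=> z /=; [apply|move=> ? _].
have Ux : U x by move=> t' tt' ?; apply: (h t').
have [s /andP[s0 s1] hs] := open_segment (Th t j - x) (openI oU oOm) (conj Ux Ox).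
have [Uz Oz] := hs (- s) ltac:(by rewrite normrN gtr0_norm).
set z := x + _ in Uz Oz.
have /closure_domainP[t' zt'] : closure Om z by exact: subset_closure.
have [tt'|/Uz] := eqVneq t t'; last exact.
move: zt'; rewrite -tt' => /(elemP (nd t)) /(_ j).
rewrite /z bary_segment (proj1 xr) mulr0 add0r bary_vertex// eqxx mulr1.
by rewrite oppr_ge0 leNgt s0.
Qed.

(** Exchanging the two representations of each interior side is an involution
under which the sum changes its sign. *)
Lemma side_sum0 (w : 'I_N -> 'I_d.+1 -> R) :
  (forall t j, side (Th t) j `<=` boundary Om -> w t j = 0) ->
  (forall t t' j j', t != t' -> side (Th t) j = side (Th t') j' ->
     w t j + w t' j' = 0) ->
  \sum_t \sum_j w t j = 0.
Proof.
move=> w0 wS; rewrite pair_big /=.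
pose same (q q' : 'I_N * 'I_d.+1) :=
  q'.1 != q.1 /\ side (Th q.1) q.2 = side (Th q'.1) q'.2.
have h q : exists q', same q q' \/ (q' = q /\ side (Th q.1) q.2 `<=` boundary Om).
  have [b|/interior_side_neighbor[t' [j' [tt' SS']]]] := pselect (side (Th q.1) q.2 `<=` boundary Om).
    by exists q; right.
  by exists (t', j'); left; split; rewrite //= eq_sym.
have [f fP] := choice h.
have fK : involutive f.
  move=> q; have := fP q; have := fP (f q).
  case=> [[n2 s2]|[e2 b2]]; case=> [[n1 s1]|[e1 b1]].
  - have [qq|qq] := eqVneq (f (f q)).1 q.1.
      have e2 : (f (f q)).2 = q.2.
        by apply: (side_inj hd (nd q.1)); rewrite s1 s2 qq.
      by rewrite [LHS]surjective_pairing qq e2 -surjective_pairing.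
    by case: (side_unique hd hTh (t := q.1) (t' := (f q).1) (t'' := (f (f q)).1)
      (j := q.2) (j' := (f q).2) (j'' := (f (f q)).2)); rewrite // 1?eq_sym// s1.
  - by rewrite !e1.
  - by have [e _] := boundary_side_unique b2 (esym s1); rewrite e eqxx in n1.
  - by rewrite !e1.
have E : \sum_q w q.1 q.2 = - \sum_q w q.1 q.2.
  rewrite [LHS](reindex_inj (inv_inj fK)) -sumrN; apply: eq_bigr => q _ /=.
  have [[n1 s1]|[-> b1]] := fP q; last by rewrite w0// oppr0.
  by apply/eqP; rewrite -addr_eq0 addrC wS// eq_sym.
by move/eqP: E; rewrite -addr_eq0 -mulr2n mulrn_eq0 /= => /eqP.
Qed.

End domain_sides.

(** * The two parts of the boundary *)

Section partition.
Variables (R : realType) (d : nat).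
Hypothesis hd : (0 < d)%N.
Notation V := 'rV[R]_d.
Variables (Om : set V) (N : nat) (Th : 'I_N -> 'I_d.+1 -> V).
Hypothesis hTh : regular_triangulation Om Th.
Variables GD GN : set V.
Hypothesis hG : boundary_partition Om Th GD GN.

Let nd t : Defs.nondegenerate (Th t). Proof. by case: hTh. Qed.

(** The midpoint of a side lies on no other side. *)
Lemma side_in_cover (D : set (set V)) t j : D `<=` sides Th ->
  side (Th t) j `<=` \bigcup_(S in D) S -> D (side (Th t) j).
Proof.
move=> Ds SD; have r := relint_side_mid hd j (nd t).
have [S DS Sm] := SD _ (relint_side_sub (nd t) r).
have [t' [k SE]] := Ds S DS; rewrite SE in DS Sm.
have mk := ((sideP (nd t') _ _).1 Sm).2.
have [tt'|tt'] := eqVneq t t'.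
  rewrite -tt' in DS mk; suff -> : j = k by [].
  by apply/eqP/negPn/negP; rewrite eq_sym => /(r.2); rewrite mk ltxx.
have [_ [j' SS']] := common_side hTh tt' r (conv_hull_elem (nd t') Sm).
rewrite SS' (_ : j' = k) //; apply/eqP/negPn/negP; rewrite eq_sym => kj'.
have := bary_side_mid (nd t') hd k j'.
rewrite -(side_mid_eq (nd t) (nd t') SS') mk kj' => /eqP.
by rewrite eq_sym mul1r invr_eq0 pnatr_eq0 -leqn0 leqNgt hd.
Qed.

Lemma gd_boundary t j : side (Th t) j `<=` GD -> side (Th t) j `<=` boundary Om.
Proof.
move=> SG; have [D [DB GDE _]] := hG; rewrite GDE in SG.
have := side_in_cover (D := D) (fun S DS => (DB S DS).1) SG.
by move=> /DB[].
Qed.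

Lemma gn_boundary t j : side (Th t) j `<=` GN -> side (Th t) j `<=` boundary Om.
Proof.
move=> SG; have [D [DB _ GNE]] := hG; rewrite GNE in SG.
by have [[_ ?]] := side_in_cover (fun S (DS : (boundary_sides Om Th `\` D) S) => DS.1.1) SG.
Qed.

Lemma gd_gn_disjoint t j : side (Th t) j `<=` GD -> side (Th t) j `<=` GN -> False.
Proof.
have [D [DB GDE GNE]] := hG; rewrite GDE GNE => SD SN.
have DS := side_in_cover (D := D) (fun S DS => (DB S DS).1) SD.
by have [_] := side_in_cover (fun S (DS : (boundary_sides Om Th `\` D) S) => DS.1.1) SN.
Qed.

Lemma boundary_gd_gn t j : side (Th t) j `<=` boundary Om ->
  side (Th t) j `<=` GD \/ side (Th t) j `<=` GN.
Proof.
move=> bS; have [D [DB -> ->]] := hG.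
have sS : sides Th (side (Th t) j) by exists t, j.
have [DS|nDS] := pselect (D (side (Th t) j)).
  by left=> x Sx; exists (side (Th t) j).
by right=> x Sx; exists (side (Th t) j).
Qed.

End partition.

(** * Elementwise integration *)

Section mesh_integral.
Variables (R : realType) (d : nat).
Hypothesis hd : (0 < d)%N.
Notation V := 'rV[R]_d.
Notation mu := (lebesgue_rV R d).
Variable Om : set V.
Hypothesis hOm : bounded_polyhedral_lipschitz_domain Om.
Variables (N : nat) (Th : 'I_N -> 'I_d.+1 -> V).
Hypothesis hTh : regular_triangulation Om Th.

Let nd t : Defs.nondegenerate (Th t). Proof. by case: hTh. Qed.
Let oOm : open Om. Proof. by case: hOm => [[]]. Qed.

Lemma domain_measurable : measurable Om.
Proof. exact: open_measurable_rV. Qed.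

Lemma open_elem_measurable T : measurable (@open_elem R d T).
Proof. by apply: open_measurable_rV; exact: open_elem_open. Qed.

Definition skeleton : set V :=
  \bigcup_(q in [set: 'I_N * 'I_d.+1]) side (Th q.1) q.2.

Lemma skeleton_measurable : measurable skeleton.
Proof.
by apply: fin_bigcup_measurable; [exact: finite_finset|move=> q _; exact: side_measurable].
Qed.

Lemma skeleton_null : mu skeleton = 0%E.
Proof.
have -> : skeleton = \big[setU/set0]_(q <- index_enum ('I_N * 'I_d.+1)%type)
    side (Th q.1) q.2.
  rewrite -bigcup_seq; apply/seteqP; split=> x [q _ h]; exists q => //=.
  exact: mem_index_enum.
elim: (index_enum _) => [|q s IH]; first by rewrite big_nil measure0.
rewrite big_cons null_set_setU//; [exact: side_measurable| |exact: side_null].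
by apply: bigsetU_measurable => p _; exact: side_measurable.
Qed.

Lemma elem_skeleton t x : elem (Th t) x -> open_elem (Th t) x \/ skeleton x.
Proof.
move=> /(elemP (nd t)) h.
have [ox|/existsNP[j nj]] := pselect (open_elem (Th t) x); [by left|right].
exists (t, j) => //; apply/(sideP (nd t)); split=> //=.
by apply/eqP; rewrite eq_le h andbT leNgt; apply/negP.
Qed.

Lemma ge0_integral_elem t (f : V -> \bar R) : measurable_fun setT f ->
  (forall x, 0 <= f x)%E ->
  (\int[mu]_(x in elem (Th t)) f x = \int[mu]_(x in open_elem (Th t)) f x)%E.
Proof.
move=> mf f0.
rewrite (ge0_negligible_integral skeleton_measurable (elem_measurable (nd t)))//;
  [|exact: measurable_funTS|exact: skeleton_null].
rewrite [RHS](ge0_negligible_integral skeleton_measurable (open_elem_measurable _))//;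
  [|exact: measurable_funTS|exact: skeleton_null].
congr (integral _ _ _); apply/seteqP; split=> x [ex nx]; split=> //.
  by case: (elem_skeleton ex).
exact: open_elem_sub ex.
Qed.

Lemma ge0_integral_domain (f : V -> \bar R) : measurable_fun setT f ->
  (forall x, 0 <= f x)%E ->
  (\int[mu]_(x in Om) f x = \sum_t \int[mu]_(x in elem (Th t)) f x)%E.
Proof.
move=> mf f0.
under eq_bigr do rewrite ge0_integral_elem//.
rewrite -(ge0_integral_bigsetU mu (F := fun t => open_elem (Th t)) (s := index_enum _))//; last 4 first.
- by move=> t; exact: open_elem_measurable.
- exact: index_enum_uniq.
- apply/trivIsetP => t t' _ _ tt'; apply/seteqP; split=> x // -[h h'].
  by apply: (open_elem_notin hTh tt' h); exact: open_elem_sub h'.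
- exact: measurable_funTS.
set D := \big[setU/set0]_(t <- _) _.
have mD : measurable D by apply: bigsetU_measurable => t _; exact: open_elem_measurable.
have DE x : D x <-> exists t, open_elem (Th t) x.
  rewrite /D -bigcup_seq; split=> [[t _ h]|[t h]]; exists t => //=.
  exact: mem_index_enum.
rewrite (ge0_negligible_integral skeleton_measurable domain_measurable)//;
  [|exact: measurable_funTS|exact: skeleton_null].
rewrite [RHS](ge0_negligible_integral skeleton_measurable mD)//;
  [|exact: measurable_funTS|exact: skeleton_null].
congr (integral _ _ _); apply/seteqP; split=> x [ex nx]; split=> //.
  have /(closure_domainP hTh)[t tx] : closure Om x by exact: subset_closure.
  by apply/DE; exists t; case: (elem_skeleton tx).
by move/DE : ex => [t]; exact: open_elem_domain.
Qed.

Lemma integrable_domain (f : V -> R) : measurable_fun setT f ->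
  mu.-integrable Om (EFin \o f) <->
  forall t, mu.-integrable (elem (Th t)) (EFin \o f).
Proof.
move=> mf; have mf' : measurable_fun setT (EFin \o f) by exact/measurable_EFinP.
have E := ge0_integral_domain (measurableT_comp (@abse_measurable R setT) mf')
  (fun x => abse_ge0 _).
split=> [/integrableP[_ h] t|h].
  apply/integrableP; split; first exact: measurable_funTS.
  apply: le_lt_trans h; rewrite [leRHS]E (bigD1 t)//= leeDl// sume_ge0// => s _.
  exact: integral_ge0.
apply/integrableP; split; first exact: measurable_funTS.
rewrite [ltLHS]E; apply: lte_sum_pinfty => t _.
by case/integrableP : (h t).
Qed.

Lemma Rintegral_domain (f : V -> R) : measurable_fun setT f ->
  mu.-integrable Om (EFin \o f) ->
  \int[mu]_(x in Om) f x = \sum_t \int[mu]_(x in elem (Th t)) f x.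
Proof.
move=> mf /(integrable_domain mf) fi.
have mf' : measurable_fun setT (EFin \o f) by exact/measurable_EFinP.
have mE t := elem_measurable (nd t).
rewrite /Rintegral integralE !ge0_integral_domain//; last 2 first.
- exact: measurable_funeneg.
- exact: measurable_funepos.
have P t := integrable_pos_fin_num (mE t) (fi t).
have Q t := integrable_neg_fin_num (mE t) (fi t).
rewrite -fin_num_sumeN// -big_split /=.
rewrite -sum_fine; last by move=> t _; rewrite -integralE; exact: integrable_fin_num.
by apply: eq_bigr => t _; rewrite -integralE.
Qed.

End mesh_integral.

(** * Elementwise affine functions *)

Section affine_functions.
Variables (R : realType) (d : nat).
Notation V := 'rV[R]_d.
Notation mu := (lebesgue_rV R d).

Definition aff (c : R) (g : V) : V -> R := fun x => c + dotp g x.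

Lemma aff_continuous c g : continuous (aff c g).
Proof. by case: (has_grad_affine g c). Qed.

Lemma sum_degree1 (k : {ffun 'I_d -> 'I_2} -> R) (x : V) :
  \sum_(a : {ffun 'I_d -> 'I_2} | (\sum_i a i <= 1)%N) k a * \prod_i x ord0 i ^+ a i =
  k [ffun=> ord0] +
  \sum_i k [ffun l => if l == i then lift ord0 ord0 else ord0] * x ord0 i.
Proof.
pose delta (i : 'I_d) : {ffun 'I_d -> 'I_2} :=
  [ffun l => if l == i then lift ord0 ord0 else ord0].
rewrite (bigD1 [ffun=> ord0])/=; last by rewrite big1// => i _; rewrite ffunE.
congr (_ + _); first by rewrite big1 ?mulr1// => i _; rewrite ffunE expr0.
have dinj : injective delta.
  move=> i l /ffunP /(_ i); rewrite !ffunE eqxx.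
  by case: eqVneq => // _ /(congr1 val).
rewrite (eq_bigl (mem [set delta i | i in 'I_d]%SET)); last first.
  move=> a; apply/andP/imsetP => [[a1 a0]|[i _ ->]].
    have [i ai] : exists i, a i != ord0.
      apply/existsP; apply: contraNT a0 => /existsPn h.
      by apply/eqP/ffunP => i; rewrite ffunE; apply/eqP/negPn/h.
    exists i => //; apply/ffunP => l; rewrite ffunE.
    move: a1; rewrite (bigD1 i)//=.
    have [->|li] := eqVneq l i.
      by move=> _; apply/val_inj => /=; case: (a i) ai => -[|[|]].
    rewrite (bigD1 l)//= => h; apply/val_inj => /=.
    by move: ai h; rewrite -val_eqE /= -lt0n; case: (nat_of_ord (a i)) => // m _;
      rewrite addSn ltnS leqn0 !addn_eq0 => /and3P[_ /eqP].
  split; last first.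
    by apply/eqP => /ffunP /(_ i); rewrite !ffunE eqxx => /(congr1 val).
  rewrite (bigD1 i)//= ffunE eqxx big1// => l li.
  by rewrite ffunE (negbTE li).
rewrite big_imset /=; last by move=> ? ? _ _; exact: dinj.
apply: eq_bigr => i _; congr (_ * _).
rewrite (bigD1 i)//= ffunE eqxx big1 ?mulr1// => l li.
by rewrite ffunE (negbTE li).
Qed.

Lemma Pk1_aff (p : V -> R) : Pk 1 p -> exists c g, p = aff c g.
Proof.
move=> [k ->].
exists (k [ffun=> ord0]),
  (\row_i k [ffun l => if l == i then lift ord0 ord0 else ord0]).
apply/funext => x; rewrite sum_degree1; congr (_ + _).
by apply: eq_bigr => i _; rewrite mxE.
Qed.

Lemma aff_Pk1 c g : Pk 1 (aff c g).
Proof.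
pose k (a : {ffun 'I_d -> 'I_2}) : R :=
  if [pick i | a i != ord0] is Some i then g ord0 i else c.
exists k; apply/funext => x; rewrite sum_degree1; congr (_ + _).
  by rewrite /k; case: pickP => // i; rewrite ffunE eqxx.
apply: eq_bigr => i _; congr (_ * _); rewrite /k; case: pickP => [l|/(_ i)].
  by rewrite ffunE; have [->//|li] := eqVneq l i; rewrite eqxx.
by rewrite ffunE eqxx.
Qed.

(** A nonempty open set has positive measure, so continuous functions that
differ somewhere on an open set differ on a set of positive measure. *)
Lemma ae_eq_open (D U : set V) (f h : V -> R) : continuous f -> continuous h ->
  open U -> U `<=` D -> ae_eq mu D f h -> forall x, U x -> f x = h x.
Proof.
move=> cf ch oU UD [B [mB B0 fB]] x Ux; apply/eqP/negPn/negP => fh.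
pose W := U `&` [set y | f y - h y != 0].
have oW : open W.
  apply: openI => //; apply: (@open_comp _ _ (fun y => f y - h y) [set c | c != 0]).
    by move=> y _; exact: continuous_sub.
  exact: open_neq.
have W0 : (0 < mu W)%E.
  by apply: open_lebesgue_gt0 => //; exists x; split=> //=; rewrite subr_eq0.
suff : (mu W <= 0)%E by rewrite leNgt W0.
rewrite -B0; apply: le_measure; rewrite ?inE//; first exact: open_measurable_rV.
move=> y [Uy /= fhy]; apply: fB => /= /(_ (UD _ Uy)) e.
by move: fhy; rewrite e subrr eqxx.
Qed.

Lemma aff_ext (U : set V) c g c' g' : open U -> U !=set0 ->
  (forall x, U x -> aff c g x = aff c' g' x) -> c = c' /\ g = g'.
Proof.
move=> oU [x Ux] E; have gg' : g = g'.
  apply/eqP; rewrite -subr_eq0 -dotp_self_eq0; apply/eqP.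
  have [e /andP[e0 _] he] := open_segment (g - g') oU Ux.
  have E2 := E _ (he e ltac:(by rewrite gtr0_norm)).
  have E1 := E _ Ux; rewrite /aff !(dotpDr _ x) !dotpZr in E1 E2.
  have : e * dotp (g - g') (g - g') = 0.
    have -> : dotp (g - g') (g - g') = dotp g (g - g') - dotp g' (g - g').
      by rewrite dotpDl -scaleN1r dotpZl mulN1r.
    by rewrite mulrBr; lra.
  by move/eqP; rewrite mulf_eq0 gt_eqF//= => /eqP.
by split=> //; have := E _ Ux; rewrite /aff gg' => /addIr.
Qed.

Lemma grad_aff c g x : grad (aff c g) x = g.
Proof.
apply/rowP => i; rewrite mxE.
have [_ _ /(_ x (basis_vec R i)) h] := has_grad_affine g c.
by rewrite (@derive_val _ _ _ _ _ _ _ h) dotp_delta.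
Qed.

End affine_functions.

Section mesh_functions.
Variables (R : realType) (d : nat).
Hypothesis hd : (0 < d)%N.
Notation V := 'rV[R]_d.
Notation mu := (lebesgue_rV R d).
Variable Om : set V.
Hypothesis hOm : bounded_polyhedral_lipschitz_domain Om.
Variables (N : nat) (Th : 'I_N -> 'I_d.+1 -> V).
Hypothesis hTh : regular_triangulation Om Th.

Let nd t : Defs.nondegenerate (Th t). Proof. by case: hTh. Qed.

Lemma ae_open_elem (P : V -> Prop) t :
  (forall x, open_elem (Th t) x -> P x) -> {ae mu, forall x, elem (Th t) x -> P x}.
Proof.
move=> h; exists (skeleton Th); split.
- exact: (skeleton_measurable hTh).
- exact: (skeleton_null hTh).
move=> x /= nP; apply: contrapT => nS; apply: nP => ex; apply: h.
by case: (elem_skeleton hTh ex).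
Qed.

Lemma ae_domain (P : V -> Prop) :
  (forall t, {ae mu, forall x, elem (Th t) x -> P x}) <-> {ae mu, forall x, Om x -> P x}.
Proof.
split=> [h|h t].
  have hall : {ae mu, forall x, forall t, elem (Th t) x -> P x}.
    exact: filter_forall h.
  apply: filterS hall => x hx Ox.
  have /(closure_domainP hTh)[t tx] : closure Om x by exact: subset_closure.
  exact: (hx t tx).
have h' : {ae mu, forall x, elem (Th t) x -> open_elem (Th t) x}.
  exact: ae_open_elem.
by apply: filterS2 h h' => x hx ho ex; apply: hx; apply: (open_elem_domain hOm hTh); exact: ho.
Qed.

Lemma glue_elem (W : lmodType R) (c : 'I_N -> V -> W) t x :
  open_elem (Th t) x -> Defs.glue Th c x = c t x.
Proof.
move=> ox; rewrite /Defs.glue (bigD1 t)//= interior_elem// indicE mem_set// scale1r.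
rewrite big1 ?addr0// => s st; rewrite interior_elem// indicE memNset ?scale0r//.
by move=> /(open_elem_sub (nd s)); apply: (open_elem_notin hTh _ ox); rewrite eq_sym.
Qed.

Lemma glue_skeleton (W : lmodType R) (c : 'I_N -> V -> W) x :
  (forall t, ~ open_elem (Th t) x) -> Defs.glue Th c x = 0.
Proof.
move=> nx; rewrite /Defs.glue big1// => t _.
by rewrite interior_elem// indicE memNset ?scale0r.
Qed.

Lemma glue_measurable (c : 'I_N -> V -> R) : (forall t, continuous (c t)) ->
  measurable_fun setT (Defs.glue Th (fun t x => c t x : R^o)).
Proof.
move=> cc; apply: measurable_sum => t; apply: measurable_funM.
  by apply: measurable_indic; rewrite interior_elem//; exact: open_elem_measurable.
exact: continuous_measurable_rV.
Qed.

Lemma piecewise_measurable (F : V -> \bar R) (c : 'I_N -> \bar R) c0 :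
  (forall t x, open_elem (Th t) x -> F x = c t) ->
  (forall x, (forall t, ~ open_elem (Th t) x) -> F x = c0) ->
  measurable_fun setT F.
Proof.
move=> Fc F0 _ Y mY; rewrite setTI.
pose U : set V := \bigcup_(t in [set: 'I_N]) open_elem (Th t).
have mU : measurable U.
  by apply: fin_bigcup_measurable; [exact: finite_finset|move=> t _; exact: open_elem_measurable].
rewrite (_ : F @^-1` Y = (\bigcup_(t in [set t : 'I_N | Y (c t)]) open_elem (Th t)) `|`
    (if pselect (Y c0) then ~` U else set0)).
  apply: measurableU.
    by apply: fin_bigcup_measurable; [exact: finite_finset|move=> t _; exact: open_elem_measurable].
  by case: pselect => //= _; exact: measurableC.
apply/seteqP; split=> x.
  move=> /= Yx; have [[t ox]|/forallNP nx] := pselect (exists t, open_elem (Th t) x).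
    by left; exists t => //=; rewrite -(Fc t x).
  right; rewrite F0// in Yx; case: pselect => //= _ [t _]; exact: nx.
move=> [[t /= Yt ox]|]; first by rewrite /= (Fc t).
case: pselect => //= Y0 nU; rewrite F0// => t ox; apply: nU.
by exists t.
Qed.

Lemma open_elem_vol t : mu (open_elem (Th t)) = (vol (Th t))%:E.
Proof.
rewrite -volE// -[RHS]mul1e -integral_cst//; last exact: elem_measurable.
rewrite (ge0_integral_elem hTh)//.
have mo := open_elem_measurable (Th t).
by rewrite [RHS](integral_cst _ mo) mul1e.
Qed.

(** The sum is over integrals of constants. The values are extended real
numbers because the conjugate of the energy density may be infinite on some
elements. *)
Lemma integral_piecewise (F : V -> \bar R) (c : 'I_N -> \bar R) c0 :
  (forall t x, open_elem (Th t) x -> F x = c t) ->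
  (forall x, (forall t, ~ open_elem (Th t) x) -> F x = c0) ->
  (forall t, c t != -oo%E) ->
  (\int[mu]_(x in Om) F x = \sum_t (vol (Th t))%:E * c t)%E.
Proof.
move=> Fc F0 cN.
have mF := piecewise_measurable Fc F0.
have I (h : \bar R -> \bar R) : measurable_fun setT (h \o F) ->
    (forall y, 0 <= h y)%E ->
    (\int[mu]_(x in Om) h (F x) = \sum_t (vol (Th t))%:E * h (c t))%E.
  move=> mh h0; rewrite (ge0_integral_domain hOm hTh)//.
  apply: eq_bigr => t _; rewrite (ge0_integral_elem hTh)//.
  rewrite (eq_integral (cst (h (c t)))); last first.
    by move=> x; rewrite inE => ox; rewrite /= (Fc t).
  rewrite integral_cst//; last exact: open_elem_measurable.
  by rewrite muleC; congr (_ * _)%E; exact: open_elem_vol.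
rewrite integralE.
have pE x : (F^\+ x = maxe (F x) 0)%E by rewrite funeposE.
have nE x : (F^\- x = maxe (- F x) 0)%E by rewrite funenegE.
have v0 t : (0 <= (vol (Th t))%:E)%E by rewrite lee_fin ltW// vol_gt0.
under [X in (X - _)%E]eq_integral do rewrite pE.
under [X in (_ - X)%E]eq_integral do rewrite nE.
rewrite (I (fun y => maxe y 0))//; last 2 first.
- rewrite (_ : _ \o _ = F^\+%E); first exact: measurable_funepos.
  by apply/funext => x; rewrite pE.
- by move=> y; rewrite le_max lexx orbT.
rewrite (I (fun y => maxe (- y) 0)%E)//; last 2 first.
- rewrite (_ : _ \o _ = F^\-%E); first exact: measurable_funeneg.
  by apply/funext => x; rewrite nE.
- by move=> y; rewrite le_max lexx orbT.
have fN t : (maxe (- c t) 0)%E \is a fin_num.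
  have := cN t; case: (c t) => [r| |] //= _; last by rewrite max_r ?leNye.
  by rewrite -EFin_max.
rewrite -fin_num_sumeN; last by move=> t _; apply: fin_numM; last exact: fN.
rewrite -big_split /=; apply: eq_bigr => t _.
rewrite -muleBr//; last by apply: fin_num_adde_defl; rewrite fin_numN; exact: fN.
congr (_ * _)%E; have := cN t; case: (c t) => [r| |] //= _.
  rewrite -!EFin_max -EFinB; congr EFin.
  by case: (leP 0 r) => r0; rewrite ?(max_l r0) ?(max_r r0); case: leP => //; lra.
by rewrite max_l ?leey// max_r ?leNye// sube0.
Qed.

End mesh_functions.

(** * Smooth and continuously differentiable functions *)

Section flat.
Variable R : realType.
Implicit Types (P : {poly R}) (s : R).

(** The functions [P (1/s) exp (-1/s)], extended by [0], are closed under
differentiation. *)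
Definition flat P s : R := if 0 < s then P.[s^-1] * expR (- s^-1) else 0.

(** The exponential of [1/s] dominates every power of [1/s]. *)
Lemma flat_small P : exists2 C, 0 <= C & forall s, `|flat P s| <= C * `|s|.
Proof.
pose C : R := \sum_(i < size P) `|P`_i| * (i.+1)`!%:R.
have C0 : 0 <= C by apply: sumr_ge0 => i _; rewrite mulr_ge0.
exists C => // s; rewrite /flat; case: ltP => s0; last by rewrite normr0 mulr_ge0.
have y0 : 0 < s^-1 by rewrite invr_gt0.
rewrite horner_coef mulr_suml; apply: (le_trans (ler_norm_sum _ _ _)).
rewrite (gtr0_norm s0) mulr_suml; apply: ler_sum => i _.
rewrite !normrM -mulrA -[leRHS]mulrA; apply: ler_wpM2l => //.
rewrite (ger0_norm (expR_ge0 _)) (gtr0_norm (exprn_gt0 _ y0)) expRN.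
rewrite ler_pdivrMr ?expR_gt0// -ler_pdivrMl; last first.
  by rewrite mulr_gt0// ltr0n fact_gt0.
have -> : ((i.+1)`!%:R * s)^-1 * s^-1 ^+ i = s^-1 ^+ i.+1 / (i.+1)`!%:R.
  rewrite invfM exprS; move: (s^-1) ((i.+1)`!%:R^-1) => y f; ring.
by apply: (le_trans _ (expR_ge1Dxn i (ltW y0))); rewrite lerDr.
Qed.

Lemma flat_derive P s : is_derive s 1 (flat P) (flat ('X^2 * (P - P^`())) s).
Proof.
have [s0|s0|->] := ltgtP s 0.
- rewrite [flat _ s]/flat ltNge (ltW s0)/=.
  apply: (@near_eq_is_derive _ _ _ (cst 0)).
  near=> u; rewrite /flat ifN// -leNgt; apply: ltW.
  by near: u; exact: lt_nbhsl.
- rewrite [flat _ s]/flat s0.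
  have sn0 : s != 0 by rewrite gt_eqF.
  apply: (@near_eq_is_derive _ _ _ (fun u : R => P.[u^-1] * expR (- u^-1) : R)).
    near=> u; rewrite /flat ifT//.
    by near: u; exact: lt_nbhsr.
  have dV : is_derive s 1 (fun u : R => u^-1) (- s ^- 2).
    have := @is_deriveV R id s 1 1 sn0 (is_derive_id _ _).
    by rewrite -[_ *: _]/(_ * _) mulr1.
  have dP := is_derive1_comp (is_derive_poly P s^-1) dV.
  have dE := @is_derive1_comp R expR (fun u => - u^-1) s _ _
    (is_derive_expR (- s^-1)) (is_deriveN dV).
  have := is_deriveM dP dE.
  have -> : P.[s^-1] *: (expR (- s^-1) * (- - s ^- 2)) +
      expR (- s^-1) *: (P^`().[s^-1] * (- s ^- 2)) =
      ('X^2 * (P - P^`())).[s^-1] * expR (- s^-1).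
    rewrite -![_ *: _]/(_ * _) hornerM hornerXn hornerD hornerN exprVn.
    by rewrite opprK; ring.
  by [].
rewrite [flat _ 0]/flat ltxx.
have [C C0 hC] := flat_small ('X * P).
have cv : (fun h : R => h^-1 *: ((flat P \o shift 0) (h *: 1) - flat P 0)) @ 0^' --> (0 : R).
  have c0 : (fun h : R => C * `|h|) @ 0^' --> (0 : R).
    suff : (fun h : R => C * `|h|) @ 0^' --> C * `|0 : R| by rewrite normr0 mulr0.
    apply: (@cvgM _ _ _ _ (fun=> C)); first exact: cvg_cst.
    apply: (@cvg_norm _ _ _ _ _ id) => A A0.
    by apply: filterS (A0 : nbhs 0 A) => x Ax _.
  apply: (squeeze_cvgr _ _ c0); last by rewrite -[X in _ --> X]oppr0; exact: cvgN c0.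
  near=> h; rewrite -ler_norml; have hn : h != 0 by near: h; exact: nbhs_dnbhs_neq.
  rewrite /= -[h *: 1]/(h * 1) mulr1 addr0 [flat P 0]/flat ltxx subr0.
  have -> : h^-1 *: flat P h = flat ('X * P) h.
    rewrite /flat -[_ *: _]/(_ * _); case: ifP => h0; last by rewrite mulr0.
    by rewrite hornerM hornerX mulrA.
  exact: hC.
by constructor; [apply/cvg_ex; exists 0|exact: cvg_lim cv].
Unshelve. all: by end_near.
Qed.

Lemma flat_continuous P : continuous (flat P).
Proof.
move=> s; apply/differentiable_continuous/derivable1_diffP.
by case: (flat_derive P s).
Qed.

End flat.

Section Ck_closure.
Variables (R : realType) (d : nat).
Notation V := 'rV[R]_d.
Implicit Types (f h : V -> R).

Lemma Ck_continuous k f : Ck k f -> continuous f.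
Proof. by case: k => [|k] []. Qed.

Lemma Ck_pred k f : Ck k.+1 f -> Ck k f.
Proof.
elim: k f => [|k IH] f [cf h]; first by split.
by split=> // i; have [h1 h2] := h i; split=> //; exact: IH.
Qed.

Lemma CkS k f (Df : 'I_d -> V -> R) : continuous f ->
  (forall i x, is_derive x (basis_vec R i) f (Df i x)) ->
  (forall i, Ck k (Df i)) -> Ck k.+1 f.
Proof.
move=> cf h hk; split=> // i; split=> [x|]; first by case: (h i x).
rewrite (_ : (fun x => _) = Df i); first exact: hk.
by apply/funext => x; exact: (@derive_val _ _ _ _ _ _ _ (h i x)).
Qed.

Lemma CkS_derive k f i x : Ck k.+1 f ->
  is_derive x (basis_vec R i) f ('D_(basis_vec R i) f x).
Proof. by move=> [_ /(_ i)[h _]]; exact: derivableP. Qed.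

Lemma Ck_cst k c : Ck k (cst c : V -> R).
Proof.
elim: k c => [|k IH] c; first by split=> // x; exact: cst_continuous.
apply: (CkS (Df := fun _ => cst 0)) => [x|i]; first exact: cst_continuous.
exact: IH.
Qed.

Lemma CkD k f h : Ck k f -> Ck k h -> Ck k (fun x => f x + h x).
Proof.
elim: k f h => [|k IH] f h Hf Hh; have cf := Ck_continuous Hf;
    have ch := Ck_continuous Hh.
  by split=> //; exact: continuous_add.
apply: (CkS (Df := fun i x => 'D_(basis_vec R i) f x + 'D_(basis_vec R i) h x)).
- exact: continuous_add.
- by move=> i x; exact: (is_deriveD (CkS_derive i x Hf) (CkS_derive i x Hh)).
by move=> i; apply: IH; [case: Hf => _ /(_ i)[]|case: Hh => _ /(_ i)[]].
Qed.

Lemma CkM k f h : Ck k f -> Ck k h -> Ck k (fun x => f x * h x).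
Proof.
elim: k f h => [|k IH] f h Hf Hh; have cf := Ck_continuous Hf;
    have ch := Ck_continuous Hh.
  by split=> //; exact: continuous_mul.
apply: (CkS (Df := fun i x => f x * 'D_(basis_vec R i) h x
    + h x * 'D_(basis_vec R i) f x)).
- exact: continuous_mul.
- by move=> i x; exact: (is_deriveM (CkS_derive i x Hf) (CkS_derive i x Hh)).
move=> i; apply: CkD; apply: IH; rewrite ?Ck_pred//.
- exact: Ck_pred.
- by case: Hh => _ /(_ i)[].
- exact: Ck_pred.
- by case: Hf => _ /(_ i)[].
Qed.

Lemma Ck_prod k (I : Type) (r : seq I) (P : pred I) (f : I -> V -> R) :
  (forall i, Ck k (f i)) -> Ck k (fun x => \prod_(i <- r | P i) f i x).
Proof.
move=> hf; elim: r => [|i r IH].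
  have -> : (fun x => \prod_(i <- [::] | P i) f i x) = cst 1.
    by apply/funext => x; rewrite big_nil.
  exact: Ck_cst.
have -> : (fun x => \prod_(j <- i :: r | P j) f j x) = fun x =>
    if P i then f i x * \prod_(j <- r | P j) f j x
    else \prod_(j <- r | P j) f j x.
  by apply/funext => x; rewrite big_cons.
by case: (P i) => //; exact: CkM.
Qed.

Lemma is_derive_comp_aff (e e' : R -> R) c (g x v : V) :
  is_derive (aff c g x) 1 e (e' (aff c g x)) ->
  is_derive x v (fun y => e (aff c g y)) (dotp g v * e' (aff c g x)).
Proof.
move=> he.
have E : (fun k : R => k^-1 *: (((fun y => e (aff c g y)) \o shift x) (k *: v)
      - e (aff c g x))) =
    (fun k => k^-1 *: (((fun u : R => e (aff c g x + u * dotp g v)) \o shift 0) (k *: (1 : R))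
      - e (aff c g x + 0 * dotp g v))).
  apply/funext => k; congr (_ *: (e _ - e _)) => /=.
    rewrite /aff dotpDr dotpZr -[k *: 1]/(k * 1) mulr1 addr0.
    by rewrite addrCA [RHS]addrC.
  by rewrite mul0r addr0.
have dl : is_derive (0 : R) 1 (fun u : R => aff c g x + u * dotp g v) (dotp g v).
  have := is_deriveD (is_derive_cst (aff c g x) (0 : R) 1)
    (is_deriveM (is_derive_id (0 : R) 1) (is_derive_cst (dotp g v) (0 : R) 1)).
  by rewrite scaler0 add0r add0r -[_ *: _]/(_ * _) mulr1.
have he0 : is_derive (aff c g x + 0 * dotp g v) 1 e (e' (aff c g x)).
  by rewrite mul0r addr0.
have [h1 h2] := is_derive1_comp (g := fun u => aff c g x + u * dotp g v) he0 dl.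
rewrite mulrC; constructor; first by rewrite /derivable E.
by rewrite -h2 /derive E.
Qed.

Lemma Ck_flat k P c (g : V) : Ck k (fun x => flat P (aff c g x)).
Proof.
have cfl Q : continuous (fun x => flat Q (aff c g x)).
  by apply: (continuous_compose (@aff_continuous _ _ c g)); exact: flat_continuous.
elim: k P => [|k IH] P; first by split.
apply: (CkS (Df := fun i x => dotp g (basis_vec R i) *
    flat ('X^2 * (P - P^`())) (aff c g x))) => // [i x|i].
  apply: is_derive_comp_aff; exact: flat_derive.
by apply: CkM; [exact: Ck_cst|exact: IH].
Qed.

Lemma Ck1_coord_mvt f i (y : V) (t : R) : Ck 1 f -> exists2 s, `|s| <= `|t| &
  f (y + t *: basis_vec R i) - f y =
  'D_(basis_vec R i) f (y + s *: basis_vec R i) * t.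
Proof.
move=> Hf; have cf := Ck_continuous Hf; set e := basis_vec R i.
have dl (u : R) : is_derive u (1 : R) (fun u : R => f (y + u *: e)) ('D_e f (y + u *: e)).
  by apply: is_derive_line; exact: (CkS_derive _ _ Hf).
have cl : continuous (fun u : R => f (y + u *: e)).
  move=> u; apply: continuous_comp; last exact: cf.
  by apply: cvgD; [exact: cvg_cst|apply: cvgZ; [exact: cvg_id|exact: cvg_cst]].
have [t0|t0] := leP 0 t.
  have [|s] := @MVT_segment R (fun u => f (y + u *: e))
    (fun u => 'D_e f (y + u *: e)) 0 t t0 (fun u _ => dl u).
    exact: continuous_subspaceT.
  rewrite in_itv /= scale0r addr0 subr0 => /andP[s0 st] E; exists s => //.
  by rewrite !ger0_norm.
have [|s] := @MVT_segment R (fun u => f (y + u *: e))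
  (fun u => 'D_e f (y + u *: e)) t 0 (ltW t0) (fun u _ => dl u).
  exact: continuous_subspaceT.
rewrite in_itv /= scale0r addr0 sub0r => /andP[st s0] E; exists s.
  by rewrite !ler0_norm ?lerN2// ltW.
by rewrite -opprB E mulrN opprK.
Qed.

Lemma rV_continuous (X : topologicalType) (F : X -> V) :
  (forall i, continuous (fun x => F x ord0 i)) -> continuous F.
Proof.
move=> cF; rewrite (_ : F = fun x => \sum_i F x ord0 i *: basis_vec R i).
  elim: (index_enum _) => [|i r IH] x.
    by under eq_fun do rewrite big_nil; exact: cst_continuous.
  under eq_fun do rewrite big_cons; move: x; apply: continuous_add => //.
  by apply: continuous_scale => // x; exact: cst_continuous.
apply/funext => x; exact: row_sum_delta.
Qed.

(** The increment of [f] is the telescoping sum of its increments along the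
coordinate directions, each of which is given by the mean value theorem. *)
Lemma Ck1_derive f (x v : V) : Ck 1 f -> is_derive x v f (dotp (grad f x) v).
Proof.
move=> Hf; pose e (i : 'I_d) : V := basis_vec R i.
pose w (k : nat) : V := \sum_(i < d | (i < k)%N) v ord0 i *: e i.
pose part (k : nat) (h : R) : V := x + h *: w k.
have w0 : w 0%N = 0 by rewrite /w big_pred0.
have wd : w d = v.
  rewrite /w [RHS]row_sum_delta; apply: eq_bigl => i; exact: ltn_ord.
have wS (i : 'I_d) : w i.+1 = w i + v ord0 i *: e i.
  rewrite /w (bigD1 i)//= addrC; congr (_ + _).
  by apply: eq_bigl => k; rewrite ltnS -val_eqE /= [RHS]ltn_neqAle andbC.
have partS (i : 'I_d) (h : R) : part i.+1 h = part i h + (h * v ord0 i) *: e i.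
  by rewrite /part wS scalerDr addrA scalerA.
pose r (i : 'I_d) (h : R) := h^-1 * (f (part i.+1 h) - f (part i h)).
have id0 : (fun h : R => h) @ 0^' --> (0 : R).
  by move=> A A0; apply: filterS (A0 : nbhs 0 A) => u Au _.
have cr i : r i @ 0^' --> v ord0 i * 'D_(e i) f x.
  have cD : continuous ('D_(e i) f) by have [_ /(_ i)[_ []]] := Hf.
  have /choice[s sP] : forall h : R, exists s, `|s| <= `|h * v ord0 i| /\
      f (part i.+1 h) - f (part i h) = 'D_(e i) f (part i h + s *: e i) * (h * v ord0 i).
    by move=> h; have [s s1 s2] := Ck1_coord_mvt i (part i h) (h * v ord0 i) Hf;
      exists s; split=> //; rewrite partS.
  have s0 : s @ 0^' --> (0 : R).
    have c0 : (fun h : R => `|h * v ord0 i|) @ 0^' --> (0 : R).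
      suff : (fun h : R => `|h * v ord0 i|) @ 0^' --> `|0 * v ord0 i|.
        by rewrite mul0r normr0.
      by apply: cvg_norm; apply: cvgM => //; exact: cvg_cst.
    apply: (squeeze_cvgr _ _ c0); last by rewrite -[X in _ --> X]oppr0; exact: cvgN c0.
    by apply: nearW => h; rewrite -ler_norml; case: (sP h).
  have qx : (fun h : R => part i h + s h *: e i) @ 0^' --> x.
    suff : (fun h : R => part i h + s h *: e i) @ 0^' --> x + 0 *: w i + 0 *: e i.
      by rewrite !scale0r !addr0.
    apply: cvgD; first apply: cvgD.
    - exact: cvg_cst.
    - by apply: cvgZ => //; exact: cvg_cst.
    by apply: cvgZ => //; exact: cvg_cst.
  have lim : (fun h : R => v ord0 i * 'D_(e i) f (part i h + s h *: e i)) @ 0^' -->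
      v ord0 i * 'D_(e i) f x.
    by apply: cvgM; [exact: cvg_cst|exact: (cvg_comp _ _ qx (cD x))].
  apply: cvg_trans lim; apply: near_eq_cvg; near=> h.
  have hn : h != 0 by near: h; exact: nbhs_dnbhs_neq.
  by rewrite /r (sP h).2 mulrCA mulKf// mulrC.
have cv : (fun h : R => h^-1 *: ((f \o shift x) (h *: v) - f x)) @ 0^' -->
    dotp (grad f x) v.
  have -> : (fun h : R => h^-1 *: ((f \o shift x) (h *: v) - f x)) =
      fun h : R => \sum_(i < d) r i h.
    apply/funext => h; rewrite -mulr_sumr -[_ *: _]/(_ * _); congr (_ * _).
    rewrite -(big_mkord xpredT (fun i => f (part i.+1 h) - f (part i h))).
    rewrite telescope_sumr// /part wd w0 scaler0 addr0 /=.
    by rewrite [h *: v + x]addrC.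
  rewrite (_ : dotp _ _ = \sum_(i < d) v ord0 i * 'D_(e i) f x); last first.
    by apply: eq_bigr => i _; rewrite mxE mulrC.
  elim: (index_enum _) => [|i l IH].
    by under eq_fun do rewrite big_nil; rewrite big_nil; exact: cvg_cst.
  by under eq_fun do rewrite big_cons; rewrite big_cons; apply: cvgD.
by constructor; [apply/cvg_ex; exists (dotp (grad f x) v)|exact: cvg_lim cv].
Unshelve. all: by end_near. Qed.

Lemma Ck1_has_grad f : Ck 1 f -> has_grad f (grad f).
Proof.
move=> Hf; split; first exact: Ck_continuous Hf.
  apply: rV_continuous => i.
  have -> : (fun x => grad f x ord0 i) = 'D_(basis_vec R i) f.
    by apply/funext => x; rewrite mxE.
  by have [_ /(_ i)[_ []]] := Hf.
by move=> x v; exact: Ck1_derive.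
Qed.

End Ck_closure.

Section flat_coordinates.
Variables (R : realType) (d : nat).
Notation V := 'rV[R]_d.
Implicit Types (f : V -> R) (G : V -> V).

Lemma has_grad_grad f G : has_grad f G -> G = grad f.
Proof.
move=> [_ _ h]; apply/funext => x; apply/rowP => i; rewrite mxE.
by rewrite (@derive_val _ _ _ _ _ _ _ (h x (basis_vec R i))) dotp_delta.
Qed.

Lemma grad0_open f (U : set V) x : open U -> (forall y, U y -> f y = 0) -> U x ->
  grad f x = 0.
Proof.
move=> oU f0 Ux; apply/rowP => i; rewrite !mxE.
have h : is_derive x (basis_vec R i) f 0.
  apply: (@near_eq_is_derive _ _ _ (cst 0)).
  by apply: filterS (open_nbhs_nbhs (conj oU Ux)) => y Uy; rewrite f0.
exact: (@derive_val _ _ _ _ _ _ _ h).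
Qed.

Lemma aff_shiftZ T i (a b : R) : exists c g, forall x : V, a * bary T i x + b = aff c g x.
Proof.
exists (a * ((i == ord0)%:R - dotp (bgrad T i) (T ord0)) + b), (a *: bgrad T i) => x.
by rewrite /bary /aff dotpBr dotpZl; ring.
Qed.

Lemma Ck_flat_bary k P (T : 'I_d.+1 -> V) i (a b : R) :
  Ck k (fun x => flat P (a * bary T i x + b)).
Proof.
have [c [g E]] := aff_shiftZ T i a b.
have -> : (fun x => flat P (a * bary T i x + b)) = fun x => flat P (aff c g x).
  by apply/funext => x; rewrite E.
exact: Ck_flat.
Qed.

End flat_coordinates.

Lemma Rintegral_ae d (X : measurableType d) (R : realType)
    (m : {measure set X -> \bar R}) (D : set X) (f h : X -> R) : measurable D ->
  measurable_fun setT f -> measurable_fun setT h -> ae_eq m D f h ->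
  \int[m]_(x in D) f x = \int[m]_(x in D) h x.
Proof.
move=> mD mf mh fh; congr fine; apply: ae_eq_integral => //.
- by apply: measurable_funTS; exact/measurable_EFinP.
- by apply: measurable_funTS; exact/measurable_EFinP.
by apply: filterS fh => x fx Dx /=; rewrite fx.
Qed.

Lemma integrable_ae_eq d (X : measurableType d) (R : realType)
    (m : {measure set X -> \bar R}) (D : set X) (f h : X -> R) : measurable D ->
  measurable_fun setT f -> measurable_fun setT h -> ae_eq m D f h ->
  m.-integrable D (EFin \o h) -> m.-integrable D (EFin \o f).
Proof.
move=> mD mf mh fh ih.
have mf' : measurable_fun setT (EFin \o f) by exact/measurable_EFinP.
have mh' : measurable_fun setT (EFin \o h) by exact/measurable_EFinP.
apply/integrableP; split; first exact: measurable_funTS.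
rewrite (ae_eq_integral (fun x => `|(EFin \o h) x|)%E) //.
- by case/integrableP : ih.
- by apply: measurable_funTS; exact: measurableT_comp.
- by apply: measurable_funTS; exact: measurableT_comp.
by apply: filterS fh => x fx Dx /=; rewrite fx.
Qed.

(** * The weak divergence on an element *)

Section mesh_continuous.
Variables (R : realType) (d : nat).
Hypothesis hd : (0 < d)%N.
Notation V := 'rV[R]_d.
Notation mu := (lebesgue_rV R d).
Variable Om : set V.
Hypothesis hOm : bounded_polyhedral_lipschitz_domain Om.
Variables (N : nat) (Th : 'I_N -> 'I_d.+1 -> V).
Hypothesis hTh : regular_triangulation Om Th.

Let nd t : Defs.nondegenerate (Th t). Proof. by case: hTh. Qed.
Let mE t : measurable (elem (Th t)). Proof. exact: elem_measurable. Qed.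

Lemma Rintegral_mesh (F : V -> R) (h : 'I_N -> V -> R) : measurable_fun setT F ->
  (forall t, continuous (h t)) -> (forall t, ae_eq mu (elem (Th t)) F (h t)) ->
  mu.-integrable Om (EFin \o F) /\
  \int[mu]_(x in Om) F x = \sum_t \int[mu]_(x in elem (Th t)) h t x.
Proof.
move=> mF ch Fh.
have mh t : measurable_fun setT (h t) by exact: continuous_measurable_rV.
have iF : mu.-integrable Om (EFin \o F).
  apply/(integrable_domain hOm hTh mF) => t.
  by apply: (integrable_ae_eq (mE t) mF (mh t) (Fh t)); exact: continuous_integrable_elem.
split=> //; rewrite (Rintegral_domain hOm hTh mF iF).
by apply: eq_bigr => t _; exact: Rintegral_ae.
Qed.

(** The function [1 + g ^ 2] is integrable on the element and dominates [g].
*)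
Lemma L2_integrable_elem (g : V -> R) t : L2 Om g ->
  mu.-integrable (elem (Th t)) (EFin \o g).
Proof.
move=> [mg g2].
have m2 : measurable_fun setT (fun x => g x ^+ 2) by exact: measurable_funX.
have i2 : mu.-integrable Om (EFin \o (fun x => g x ^+ 2)).
  apply/integrableP; split.
    by apply: measurable_funTS; exact/measurable_EFinP.
  rewrite (eq_integral (fun x => ((g x) ^+ 2)%:E))// => x _.
  by rewrite /= ger0_norm// sqr_ge0.
have /(_ t) i2t := (integrable_domain hOm hTh m2).1 i2.
have i1 : mu.-integrable (elem (Th t)) (EFin \o cst 1).
  by apply: continuous_integrable_elem => // x; exact: cst_continuous.
apply: (le_integrable (mE t) _ _ (integrableD (mE t) i1 i2t)).
  by apply: measurable_funTS; exact/measurable_EFinP.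
move=> x _ /=; rewrite lee_fin ler_norml ger0_norm ?addr_ge0 ?sqr_ge0//.
by apply/andP; split; nra.
Qed.

Lemma integrable_mul_continuous (g h : V -> R) t : measurable_fun setT g ->
  mu.-integrable (elem (Th t)) (EFin \o g) -> continuous h ->
  mu.-integrable (elem (Th t)) (EFin \o (fun x => g x * h x)).
Proof.
move=> mg ig ch; have [K K0 hK] := continuous_bounded_elem (nd t) ch.
have iK := integrableZl (mE t) K ig.
apply: (le_integrable (mE t) _ _ iK).
  apply: measurable_funTS; apply/measurable_EFinP; apply: measurable_funM => //.
  exact: continuous_measurable_rV.
move=> x Tx; rewrite /= lee_fin !normrM (ger0_norm K0) mulrC.
by apply: ler_wpM2r => //; exact: hK.
Qed.

(** The restrictions of a Raviart--Thomas field to the elements, with no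
condition on the sides. *)
Definition elementwise (y : V -> V) (a : 'I_N -> V) (b : 'I_N -> R) :=
  (forall i, measurable_fun setT (fun x => y x ord0 i)) /\
  forall t, ae_eq mu (elem (Th t)) y (fun x => a t + b t *: (x - elem_mid (Th t))).

Lemma rt_continuous (a : V) (b : R) m : continuous (fun x : V => a + b *: (x - m)).
Proof.
apply: continuous_add => [x|]; first exact: cst_continuous.
apply: continuous_scale => [x|]; first exact: cst_continuous.
by apply: continuous_sub => x; [exact: cvg_id|exact: cst_continuous].
Qed.

Lemma Rintegral_elementwise y a b G : elementwise y a b -> continuous G ->
  \int[mu]_(x in Om) dotp (y x) (G x) =
  \sum_t \int[mu]_(x in elem (Th t)) dotp (a t + b t *: (x - elem_mid (Th t))) (G x).
Proof.
move=> [my ey] cG.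
have [|||_ ->//] := @Rintegral_mesh (fun x => dotp (y x) (G x))
  (fun t x => dotp (a t + b t *: (x - elem_mid (Th t))) (G x)).
- apply: measurable_sum => i; apply: measurable_funM => //.
  apply: continuous_measurable_rV.
  exact: (continuous_compose cG (@coord_continuous R 1 d ord0 i)).
- by move=> t; apply: continuous_dotp => //; exact: rt_continuous.
by move=> t; apply: filterS (ey t) => x yx Tx; rewrite yx.
Qed.

End mesh_continuous.

Section cutoff.
Variables (R : realType) (d : nat) (T : 'I_d.+1 -> 'rV[R]_d).
Notation V := 'rV[R]_d.
Notation mu := (lebesgue_rV R d).
Hypothesis ndT : Defs.nondegenerate T.

Lemma flat1E (s : R) : 0 < s -> flat 1 s = expR (- s^-1).
Proof. by move=> s0; rewrite /flat s0 hornerC mul1r. Qed.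

Lemma flat1_le0 (s : R) : s <= 0 -> flat 1 s = 0.
Proof. by rewrite /flat ltNge => ->. Qed.

Lemma flat1_gt0 (s : R) : 0 < s -> 0 < flat 1 s.
Proof. by move=> s0; rewrite flat1E// expR_gt0. Qed.

Lemma flat1_ge0 (s : R) : 0 <= flat 1 s.
Proof. by have [/flat1_le0->//|/flat1_gt0/ltW] := leP s 0. Qed.

Lemma flat1_le1 (s : R) : flat 1 s <= 1.
Proof.
have [/flat1_le0->//|s0] := leP s 0.
by rewrite flat1E// -expR0 ler_expR oppr_le0 invr_ge0 ltW.
Qed.

Lemma flat1_neq0 (s : R) : flat 1 s != 0 -> 0 < s.
Proof. by have [h|//] := leP s 0; rewrite flat1_le0// eqxx. Qed.

(** Smooth functions supported inside the simplex that increase to [1] there. *)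
Definition cutoff (n : nat) (x : V) : R :=
  \prod_j flat 1 (n.+1%:R * bary T j x + -1).

Lemma cutoff_Ck k n : Ck k (cutoff n).
Proof. by apply: Ck_prod => j; exact: Ck_flat_bary. Qed.

Lemma cutoff_support n x : cutoff n x != 0 -> forall j, n.+1%:R^-1 <= bary T j x.
Proof.
move=> c0 j; apply: ltW; rewrite -[X in X < _]mul1r ltr_pdivrMr ?ltr0n//.
rewrite -subr_gt0 mulrC; apply: flat1_neq0.
by apply: contraNneq c0 => h; rewrite /cutoff (bigD1 j)//= h mul0r.
Qed.

Lemma cutoff_notin n x : ~ open_elem T x -> cutoff n x = 0.
Proof.
move=> nx; apply/eqP/negPn/negP => /cutoff_support h; apply: nx => j.
by apply: lt_le_trans (h j); rewrite invr_gt0.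
Qed.

Lemma cutoff_norm n x : `|cutoff n x| <= 1.
Proof.
rewrite ger0_norm; last by apply: prodr_ge0 => j _; exact: flat1_ge0.
by apply: Num.Theory.prodr_ile1 => j _; rewrite flat1_ge0 flat1_le1.
Qed.

Lemma cutoff_cvg x : open_elem T x -> cutoff ^~ x @ \oo --> (1 : R).
Proof.
move=> ox; suff : cutoff ^~ x @ \oo --> \prod_(j < d.+1) (1 : R) by rewrite big1_eq.
rewrite /cutoff; elim: (index_enum _) => [|j s IH].
  by under eq_fun do rewrite big_nil; rewrite big_nil; exact: cvg_cst.
under eq_fun do rewrite big_cons; rewrite big_cons; apply: cvgM => //.
have l0 := ox j; set l := bary T j x in l0 *.
have h0 : (fun n : nat => n.+1%:R^-1 : R) @ \oo --> (0 : R) by exact: cvg_harmonic.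
have lo : (fun n : nat => 1 - (2 / l) * n.+1%:R^-1) @ \oo --> (1 : R).
  rewrite -[X in _ --> X]subr0 -[X in _ --> _ - X](mulr0 (2 / l)).
  by apply: cvgB; [exact: cvg_cst|apply: cvgM => //; exact: cvg_cst].
have hi : (fun _ : nat => 1 : R) @ \oo --> (1 : R) by exact: cvg_cst.
apply: (squeeze_cvgr _ lo hi); near=> n.
have nl : n.+1%:R^-1 < l / 2.
  by near: n; apply: (cvgr_lt _ h0); rewrite divr_gt0.
have n0 : 0 < n.+1%:R :> R by rewrite ltr0n.
have nl2 : 2 < n.+1%:R * l.
  by move: nl; rewrite -[X in X < _]mul1r ltr_pdivrMr// mulrAC ltr_pdivlMr// mul1r mulrC.
have s0 : 0 < n.+1%:R * l + -1 by lra.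
rewrite flat1_le1 andbT flat1E//.
apply: (le_trans _ (expR_ge1Dx _)); rewrite lerD2l lerN2.
have -> : 2 / l * n.+1%:R^-1 = (n.+1%:R * l / 2)^-1.
  by rewrite !invfM invrK; move: (l^-1) (n.+1%:R^-1) => u w; ring.
have h2 : 0 < n.+1%:R * l / 2 by rewrite divr_gt0// mulr_gt0.
by rewrite lef_pV2 ?posrE//; lra.
Unshelve. all: by end_near. Qed.

Lemma cutoff_test (Om : set V) (psi : V -> R) n : open_elem T `<=` Om ->
  (forall k, Ck k psi) -> test_function Om (fun x => psi x * cutoff n x).
Proof.
move=> TO Hpsi.
pose K : set V := [set x | forall j, [set y | n.+1%:R^-1 <= bary T j y] x].
have cK : closed K by apply: closed_forall_ord => j; exact: closed_bary_ge.
have n0 : 0 < n.+1%:R^-1 :> R by rewrite invr_gt0.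
have KT : K `<=` open_elem T by move=> x Kx j; exact: lt_le_trans (Kx j).
have sK : Defs.support (fun x => psi x * cutoff n x) `<=` K.
  have KE : K = closure K by apply/closure_id.
  rewrite KE; apply: closure_subset => x /=.
  rewrite mulf_eq0 negb_or => /andP[_ /cutoff_support h] j; exact: h.
split.
- by move=> k; apply: CkM => //; exact: cutoff_Ck.
- apply: (subclosed_compact _ (elem_compact ndT)); first exact: closed_closure.
  by move=> x /sK /KT; exact: open_elem_sub.
by move=> x /sK /KT /TO.
Qed.

End cutoff.

Section weak_divergence.
Variables (R : realType) (d : nat).
Hypothesis hd : (0 < d)%N.
Notation V := 'rV[R]_d.
Notation mu := (lebesgue_rV R d).
Variable Om : set V.
Hypothesis hOm : bounded_polyhedral_lipschitz_domain Om.
Variables (N : nat) (Th : 'I_N -> 'I_d.+1 -> V).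
Hypothesis hTh : regular_triangulation Om Th.

Let nd t : Defs.nondegenerate (Th t). Proof. by case: hTh. Qed.
Let mE t : measurable (elem (Th t)). Proof. exact: elem_measurable. Qed.

Variables (y : V -> V) (a : 'I_N -> V) (b : 'I_N -> R) (g : V -> R).
Hypothesis ey : elementwise Th y a b.
Hypothesis yg : is_weak_div Om y g.

Let mg : measurable_fun setT g. Proof. by case: yg => [[]]. Qed.

(** The cutoff makes [psi] a test function supported in one element, whose
side means vanish; so the divergence theorem there has no boundary terms. *)
Lemma weak_div_cutoff t (psi : V -> R) n : (forall k, Ck k psi) ->
  \int[mu]_(x in elem (Th t)) (g x * (psi x * cutoff (Th t) n x)) =
  d%:R * b t * \int[mu]_(x in elem (Th t)) (psi x * cutoff (Th t) n x).
Proof.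
move=> Hpsi; set f := fun x => psi x * cutoff (Th t) n x.
have Hf k : Ck k f by apply: CkM => //; exact: cutoff_Ck.
have tf : test_function Om f.
  by apply: (cutoff_test (nd t)) => //; exact: open_elem_domain.
have fG := Ck1_has_grad (Hf 1%N); have [cf cG _] := fG.
have f0 s x : s != t -> open_elem (Th s) x -> f x = 0.
  move=> st ox; rewrite /f cutoff_notin ?mulr0// => ox'.
  by apply: (open_elem_notin hTh st ox); exact: open_elem_sub ox'.
have E1 : \int[mu]_(x in Om) dotp (y x) (grad f x) =
    - (d%:R * b t * \int[mu]_(x in elem (Th t)) f x).
  rewrite (Rintegral_elementwise hOm hTh ey cG) (bigD1 t)//= big1 ?addr0; last first.
    move=> s st; rewrite (Rintegral_ae (h := cst 0))//; first by rewrite Rintegral_cst// mul0r.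
    - by apply: continuous_measurable_rV; apply: continuous_dotp => //; exact: rt_continuous.
    - apply: (ae_open_elem hTh) => x ox.
      by rewrite (grad0_open (@open_elem_open _ _ (Th s)) (fun y => f0 s y st) ox) dotp0r.
  have := divergence_theorem hd (a t) (b t) (nd t) fG.
  rewrite big1; last first.
    move=> j _; rewrite side_mean0 ?mulr0// => x /(sideP (nd t))[_ xj].
    by rewrite /f cutoff_notin ?mulr0// => /(_ j); rewrite xj ltxx.
  rewrite RintegralD//; last 2 first.
  - apply: continuous_integrable_elem => //.
    by apply: continuous_dotp => //; exact: rt_continuous.
  - apply: continuous_integrable_elem => //; apply: continuous_mul => //.
    by move=> x; exact: cst_continuous.
  rewrite RintegralZl//; last exact: continuous_integrable_elem.
  by move/eqP; rewrite addr_eq0 => /eqP.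
have E2 : L2prod Om g f = \int[mu]_(x in elem (Th t)) (g x * f x).
  have mf : measurable_fun setT (fun x => g x * f x).
    by apply: measurable_funM => //; exact: continuous_measurable_rV.
  have ig : mu.-integrable Om (EFin \o (fun x => g x * f x)).
    apply/(integrable_domain hOm hTh mf) => s.
    exact: (integrable_mul_continuous hTh mg
      (L2_integrable_elem hOm hTh s (proj1 yg)) cf).
  rewrite /L2prod (Rintegral_domain hOm hTh mf ig) (bigD1 t)//= big1 ?addr0// => s st.
  rewrite (Rintegral_ae (h := cst 0))//; first by rewrite Rintegral_cst// mul0r.
  by apply: (ae_open_elem hTh) => x ox; rewrite (f0 s x st ox) mulr0.
have := yg.2 f tf; rewrite E1 E2 => /eqP; rewrite eqr_opp => /eqP <-.
by [].
Qed.

(** The limit of [weak_div_cutoff]: the cutoffs increase to the indicator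
function of the open element. *)
Lemma weak_div_elem t (psi : V -> R) : (forall k, Ck k psi) ->
  \int[mu]_(x in elem (Th t)) (g x * psi x) =
  d%:R * b t * \int[mu]_(x in elem (Th t)) psi x.
Proof.
move=> Hpsi; have cpsi := Ck_continuous (Hpsi 0%N).
have cc n : continuous (cutoff (Th t) n) by exact: Ck_continuous (cutoff_Ck _ 0 n).
have lim (w : V -> R) : measurable_fun setT w ->
    mu.-integrable (elem (Th t)) (EFin \o (fun x => w x * psi x)) ->
    (fun n => \int[mu]_(x in elem (Th t)) (w x * (psi x * cutoff (Th t) n x)))
    @ \oo --> \int[mu]_(x in elem (Th t)) (w x * psi x).
  move=> mw iw.
  have mwp : measurable_fun setT (fun x => w x * psi x).
    by apply: measurable_funM => //; exact: continuous_measurable_rV.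
  have mo : measurable_fun setT (\1_(open_elem (Th t)) : V -> R).
    by apply: measurable_indic; exact: open_elem_measurable.
  rewrite (_ : \int[mu]_(x in elem (Th t)) (w x * psi x) =
      \int[mu]_(x in elem (Th t)) (w x * psi x * \1_(open_elem (Th t)) x)); last first.
    apply: Rintegral_ae => //; first exact: measurable_funM.
    by apply: (ae_open_elem hTh) => x ox; rewrite indicE mem_set// mulr1.
  apply: (@Rintegral_dominated_convergence _ _ _ mu _ (mE t) _ _
    (fun x => `|w x * psi x|)).
  - move=> n; apply: measurable_funTS; apply: measurable_funM => //.
    by apply: continuous_measurable_rV; exact: continuous_mul.
  - by apply: measurable_funTS; exact: measurable_funM.
  - move=> x Tx; under eq_fun do rewrite mulrA.
    apply: cvgM; first exact: cvg_cst.
    have [ox|nx] := pselect (open_elem (Th t) x).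
      by rewrite indicE mem_set//; exact: cutoff_cvg.
    rewrite indicE memNset//; under eq_fun do rewrite cutoff_notin//.
    exact: cvg_cst.
  - by apply: (@integrable_norm _ _ _ mu).
  move=> n x Tx; rewrite mulrA normrM ler_piMr//; exact: cutoff_norm.
have l1 := lim g mg (integrable_mul_continuous hTh mg
  (L2_integrable_elem hOm hTh t (proj1 yg)) cpsi).
have l2 : (fun n => d%:R * b t *
    \int[mu]_(x in elem (Th t)) (psi x * cutoff (Th t) n x)) @ \oo -->
    d%:R * b t * \int[mu]_(x in elem (Th t)) psi x.
  apply: cvgM; first exact: cvg_cst.
  have e1 : \int[mu]_(x in elem (Th t)) psi x =
      \int[mu]_(x in elem (Th t)) (cst 1 x * psi x).
    by apply: eq_Rintegral => x _; rewrite mul1r.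
  have e2 n : \int[mu]_(x in elem (Th t)) (psi x * cutoff (Th t) n x) =
      \int[mu]_(x in elem (Th t)) (cst 1 x * (psi x * cutoff (Th t) n x)).
    by apply: eq_Rintegral => x _; rewrite mul1r.
  rewrite e1; under eq_fun do rewrite e2; apply: lim => //.
  apply: continuous_integrable_elem => //; apply: continuous_mul => //.
  by move=> x; exact: cst_continuous.
move: l1; under eq_fun do rewrite weak_div_cutoff//.
move=> l1; exact: (cvg_unique _ l1 l2).
Qed.

End weak_divergence.

(** * Fluxes on interior sides are determined by the weak divergence *)

Section bump.
Variables (R : realType) (d : nat).
Hypothesis hd : (0 < d)%N.
Variable T : 'I_d.+1 -> 'rV[R]_d.
Notation V := 'rV[R]_d.
Notation mu := (lebesgue_rV R d).
Hypothesis ndT : Defs.nondegenerate T.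
Variable j : 'I_d.+1.

Lemma has_grad_flat_bary P i (a b : R) :
  has_grad (fun x => flat P (a * bary T i x + b))
    (fun x => (a * flat ('X^2 * (P - P^`())) (a * bary T i x + b)) *: bgrad T i).
Proof.
pose c := a * ((i == ord0)%:R - dotp (bgrad T i) (T ord0)) + b.
have E x : a * bary T i x + b = aff c (a *: bgrad T i) x.
  by rewrite /bary /aff /c dotpBr dotpZl; ring.
have cfl Q : continuous (fun x => flat Q (a * bary T i x + b)).
  have -> : (fun x => flat Q (a * bary T i x + b)) =
      fun x => flat Q (aff c (a *: bgrad T i) x) by apply/funext => x; rewrite E.
  by apply: (continuous_compose (@aff_continuous _ _ _ _)); exact: flat_continuous.
split=> //.
  apply: continuous_scale; last by move=> x; exact: cst_continuous.
  by apply: continuous_mul => // x; exact: cst_continuous.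
move=> x v.
have := @is_derive_comp_aff R d (flat P) (flat ('X^2 * (P - P^`()))) c
  (a *: bgrad T i) x v (flat_derive _ _).
rewrite -E !dotpZl mulrAC => h.
have -> // : (fun x => flat P (a * bary T i x + b)) =
    fun x => flat P (aff c (a *: bgrad T i) x) by apply/funext => z; rewrite E.
Qed.

(** A class of functions that is closed under products and on which the
integrand of [side_mean] is nonnegative. *)
Definition ray_increasing (f : V -> R) := exists2 G, has_grad f G &
  forall x, elem T x -> 0 <= f x /\ 0 <= dotp (G x) (x - T j).

Lemma ray_increasing_cst1 : ray_increasing (cst 1).
Proof.
exists (cst 0) => [|x _]; last by rewrite dotp0l ler01.
split; [by move=> x; exact: cst_continuous|by move=> x; exact: cst_continuous|].
by move=> x v; rewrite dotp0l; exact: is_derive_cst.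
Qed.

Lemma ray_increasingM f h : ray_increasing f -> ray_increasing h ->
  ray_increasing (fun x => f x * h x).
Proof.
move=> [G fG f0] [H hH h0]; exists (fun x => f x *: H x + h x *: G x).
  exact: has_gradM.
move=> x Tx; have [f1 f2] := f0 x Tx; have [h1 h2] := h0 x Tx.
by rewrite dotpDl !dotpZl mulr_ge0// addr_ge0// mulr_ge0.
Qed.

Lemma ray_increasing_flat i b : i != j ->
  ray_increasing (fun x => flat 1 (1 * bary T i x + b)).
Proof.
move=> ij; eexists; first exact: has_grad_flat_bary.
move=> x Tx; split; first exact: flat1_ge0.
rewrite dotpZl dotp_bgrad_vertex// (negbTE ij) subr0 mulr_ge0//; last first.
  exact: (elemP ndT x).1.
rewrite mul1r /flat; case: ifP => // s0.
rewrite derivC subr0 mulr1 hornerXn mulr_ge0 ?expR_ge0// exprn_ge0//.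
by rewrite invr_ge0 ltW.
Qed.

(** Half the value of the coordinates at the midpoint of the element, so that
the bump is positive there. *)
Definition bump_level : R := (d.+1%:R *+ 2)^-1.

Lemma bump_level_gt0 : 0 < bump_level.
Proof. by rewrite invr_gt0 mulrn_wgt0. Qed.

(** A nonnegative function of the coordinates other than [j], which is not
zero on the side and vanishes near its relative boundary. *)
Definition side_bump (x : V) : R :=
  \prod_(i | i != j) flat 1 (1 * bary T i x + - bump_level).

Lemma side_bump_ray_increasing : ray_increasing side_bump.
Proof.
rewrite /side_bump; elim: (index_enum _) => [|i r IH].
  have -> : (fun x => \prod_(i <- [::] | i != j) flat 1 (1 * bary T i x + - bump_level))
      = cst 1 by apply/funext => x; rewrite big_nil.
  exact: ray_increasing_cst1.
have [->|ij] := eqVneq i j.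
  have -> // : (fun x => \prod_(i <- j :: r | i != j) flat 1 (1 * bary T i x + - bump_level))
    = (fun x => \prod_(i <- r | i != j) flat 1 (1 * bary T i x + - bump_level)).
  by apply/funext => x; rewrite big_cons eqxx.
have -> : (fun x => \prod_(k <- i :: r | k != j) flat 1 (1 * bary T k x + - bump_level))
    = (fun x => flat 1 (1 * bary T i x + - bump_level) *
       \prod_(k <- r | k != j) flat 1 (1 * bary T k x + - bump_level)).
  by apply/funext => x; rewrite big_cons ij.
by apply: ray_increasingM => //; exact: ray_increasing_flat.
Qed.

Lemma side_bump_mid : 0 < side_bump (elem_mid T).
Proof.
apply: prodr_gt0 => i _; apply: flat1_gt0.
rewrite mul1r bary_elem_mid// subr_gt0 /bump_level ltf_pV2 ?posrE ?mulrn_wgt0//.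
by rewrite mulr2n ltrDl.
Qed.

Lemma side_bump_neq0 x : side_bump x != 0 ->
  forall i, i != j -> bump_level <= bary T i x.
Proof.
move=> p0 i ij; apply: ltW; rewrite -subr_gt0 -[bary T i x]mul1r; apply: flat1_neq0.
by apply: contraNneq p0 => h; rewrite /side_bump (bigD1 i)//= h mul0r.
Qed.

Lemma side_bump_Ck k : Ck k side_bump.
Proof. by apply: Ck_prod => i; exact: Ck_flat_bary. Qed.

(** Both terms of the integrand of [side_mean] are nonnegative. *)
Lemma side_bump_mean_gt0 : 0 < side_mean T j side_bump (grad side_bump).
Proof.
have [G fG fge] := side_bump_ray_increasing.
rewrite -(has_grad_grad fG) /side_mean.
have v0 := vol_gt0 ndT; have d0 : 0 < d%:R :> R by rewrite ltr0n.
rewrite mulr_gt0 ?invr_gt0 ?mulr_gt0//.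
have [cf cG _] := fG; have mT := elem_measurable ndT.
have iF := continuous_integrable_elem ndT (cone_integrand_continuous (T := T) (j := j) fG).
have if_ := continuous_integrable_elem ndT cf.
have i0 : 0 < \int[mu]_(x in elem T) side_bump x.
  rewrite lt_neqAle; apply/andP; split; last first.
    by apply: Rintegral_ge0 => x Tx; exact: (fge x Tx).1.
  apply/negP => /eqP I0.
  have ae0 : ae_eq mu (elem T) (EFin \o side_bump) (cst 0%E).
    apply/(ae_eq_integral_abs mu mT).
      by apply: measurable_funTS; apply/measurable_EFinP; exact: continuous_measurable_rV.
    have : (\int[mu]_(x in elem T) (side_bump x)%:E = 0)%E.
      rewrite -[LHS]fineK; first by rewrite -[fine _]/(Rintegral _ _ _) -I0.
      exact: integrable_fin_num.
    move=> <-; apply: eq_integral => x; rewrite inE => Tx /=.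
    by rewrite ger0_norm//; exact: (fge x Tx).1.
  have ae0' : ae_eq mu (elem T) side_bump (cst 0).
    by apply: filterS ae0 => x h Tx; have := h Tx => /= -[].
  have c00 : continuous (cst 0 : V -> R) by move=> x; exact: cst_continuous.
  have := ae_eq_open cf c00 (@open_elem_open _ _ T)
    (@open_elem_sub _ _ _ ndT) ae0' (elem_mid_open_elem ndT).
  by move=> h; have := side_bump_mid; rewrite h ltxx.
apply: (lt_le_trans (mulr_gt0 d0 i0)).
rewrite -RintegralZl//; apply: le_Rintegral => //.
  by apply: continuous_integrable_elem => //; apply: continuous_mul => // x;
    exact: cst_continuous.
by move=> x Tx; rewrite lerDl; exact: (fge x Tx).2.
Qed.

End bump.

Section green.
Variables (R : realType) (d : nat).
Hypothesis hd : (0 < d)%N.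
Notation V := 'rV[R]_d.
Notation mu := (lebesgue_rV R d).
Variable Om : set V.
Hypothesis hOm : bounded_polyhedral_lipschitz_domain Om.
Variables (N : nat) (Th : 'I_N -> 'I_d.+1 -> V).
Hypothesis hTh : regular_triangulation Om Th.

Let nd t : Defs.nondegenerate (Th t). Proof. by case: hTh. Qed.

(** The divergence theorem, summed over the elements. *)
Lemma Rintegral_flux (y : V -> V) a b (f : V -> R) G :
  elementwise Th y a b -> has_grad f G ->
  \int[mu]_(x in Om) dotp (y x) (G x) =
  \sum_t \sum_j flux (Th t) (a t) (b t) j * side_mean (Th t) j f G -
  \sum_t d%:R * b t * \int[mu]_(x in elem (Th t)) f x.
Proof.
move=> ey fG; have [cf cG _] := fG.
rewrite (Rintegral_elementwise hOm hTh ey cG) -sumrB; apply: eq_bigr => t _.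
rewrite -(divergence_theorem hd _ _ (nd t) fG).
have mT := elem_measurable (nd t).
rewrite RintegralD//; last 2 first.
- apply: continuous_integrable_elem => //.
  by apply: continuous_dotp => //; exact: rt_continuous.
- apply: continuous_integrable_elem => //; apply: continuous_mul => //.
  by move=> x; exact: cst_continuous.
by rewrite RintegralZl//; [rewrite addrK|exact: continuous_integrable_elem].
Qed.

Lemma L2prod_test (g psi : V -> R) : L2 Om g -> continuous psi ->
  L2prod Om g psi = \sum_t \int[mu]_(x in elem (Th t)) (g x * psi x).
Proof.
move=> Lg cpsi; have [mg _] := Lg.
have mf : measurable_fun setT (fun x => g x * psi x).
  by apply: measurable_funM => //; exact: continuous_measurable_rV.
rewrite /L2prod (Rintegral_domain hOm hTh mf)//.
apply/(integrable_domain hOm hTh mf) => s.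
exact: (integrable_mul_continuous hTh mg (L2_integrable_elem hOm hTh s Lg) cpsi).
Qed.

End green.

Section flux_matching.
Variables (R : realType) (d : nat).
Hypothesis hd : (0 < d)%N.
Notation V := 'rV[R]_d.
Notation mu := (lebesgue_rV R d).
Variable Om : set V.
Hypothesis hOm : bounded_polyhedral_lipschitz_domain Om.
Variables (N : nat) (Th : 'I_N -> 'I_d.+1 -> V).
Hypothesis hTh : regular_triangulation Om Th.

Let nd t : Defs.nondegenerate (Th t). Proof. by case: hTh. Qed.

Variables (t t' : 'I_N) (j j' : 'I_d.+1).
Hypothesis tt' : t != t'.
Hypothesis SS' : side (Th t) j = side (Th t') j'.

Let beta := bary (Th t) j (Th t' j').
Let beta0 : beta < 0. Proof. exact: (opposite_sides hd hTh tt' SS'). Qed.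

(** So small that, within this distance from the side and inside the support
of [side_bump], the coordinates with respect to the second element are
positive as well. Passing to that element changes a coordinate by a multiple
of [bary (Th t') j' x], and the denominator bounds the factor. *)
Definition bump_width : R := bump_level R d * - bary (Th t) j (Th t' j') /
  (2 * (1 + \sum_i `|bary (Th t) i (Th t' j')|)).

Lemma bump_width_gt0 : 0 < bump_width.
Proof.
rewrite /bump_width divr_gt0 ?mulr_gt0 ?bump_level_gt0 ?oppr_gt0//.
by rewrite ltr_pwDl// sumr_ge0.
Qed.

Lemma bump_in_lens x : `|bary (Th t) j x| <= bump_width ->
  (forall i, i != j -> bump_level R d <= bary (Th t) i x) -> lens Th t t' j j' x.
Proof.
move=> xj xi; split=> [i ij|k kj'].
  by apply: lt_le_trans (xi i ij); exact: bump_level_gt0.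
have [s [sj sT]] := sharing_vertices (nd t) (nd t') SS'.
pose i := (s^-1%g k); have si : s i = k by rewrite permKV.
have ij : i != j by apply: contraNneq kj' => ij; rewrite -si ij sj.
have E : bary (Th t) i x = bary (Th t') k x +
    bary (Th t') j' x * bary (Th t) i (Th t' j').
  rewrite -{1}[x](bary_comb (nd t')) bary_sum_comb ?bary_sum//.
  rewrite (bigD1 j')//= (bigD1 k)//= big1 ?addr0; last first.
    move=> l /andP[lj' lk].
    have sl : (s^-1%g l) != j.
      by apply: contraNneq lj' => lj; rewrite -sj -lj permKV.
    have -> : Th t' l = Th t (s^-1%g l) by rewrite -sT// permKV.
    by rewrite bary_vertex// (inj_eq perm_inj) eq_sym (negbTE lk) mulr0.
  rewrite addrC; congr (_ + _).
  by rewrite -si sT// bary_vertex// eqxx mulr1.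
pose c := bary (Th t) i (Th t' j'); pose C := 1 + \sum_i `|bary (Th t) i (Th t' j')|.
have cC : `|c| < C.
  by rewrite /C (bigD1 i)//= addrCA ltrDl ltr_pwDl// sumr_ge0.
have C0 : 0 < C by apply: le_lt_trans cC.
have l0 := bump_level_gt0 R d.
have b0 : 0 < - beta by rewrite oppr_gt0.
have xj' : `|bary (Th t') j' x| <= bump_level R d / (2 * C).
  have := xj; rewrite (bary_shared hTh SS') -/beta normrM ltr0_norm// /bump_width -/C -/beta.
  by rewrite [_ * - beta]mulrC -mulrA ler_pM2l.
have small : `|bary (Th t') j' x * c| < bump_level R d.
  rewrite normrM; apply: (@le_lt_trans _ _ (bump_level R d / (2 * C) * C)).
    by apply: ler_pM => //; exact: ltW.
  have -> : bump_level R d / (2 * C) * C = bump_level R d / 2.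
    by rewrite invfM -!mulrA mulVf ?gt_eqF// mulr1.
  by rewrite ltr_pdivrMr// ltr_pMr// ltr1n.
have := xi i ij; rewrite E -/c; move: small; rewrite ltr_norml => /andP[_ h1] h2.
by rewrite -(ltrD2r (bary (Th t') j' x * c)) add0r (lt_le_trans h1).
Qed.

(** The function [side_bump], cut off at a small distance on both sides of the
common side. On the side itself it is a positive multiple of [side_bump]. *)
Definition lens_bump (x : V) : R :=
  flat 1 (1 * bary (Th t) j x + bump_width) *
  flat 1 (-1 * bary (Th t) j x + bump_width) * side_bump (Th t) j x.

Lemma lens_bump_Ck k : Ck k lens_bump.
Proof.
apply: CkM; last exact: side_bump_Ck.
by apply: CkM; exact: Ck_flat_bary.
Qed.

Let K : set V := [set x | `|bary (Th t) j x| <= bump_width /\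
  forall i, i != j -> bump_level R d <= bary (Th t) i x].

Let lens_bump_K x : lens_bump x != 0 -> K x.
Proof.
rewrite /lens_bump !mulf_eq0 !negb_or => /andP[/andP[h1 h2] h3]; split.
  have := flat1_neq0 h1; have := flat1_neq0 h2; rewrite mul1r mulN1r => {}h2 {}h1.
  by rewrite ler_norml; apply/andP; split; lra.
exact: side_bump_neq0.
Qed.

Lemma lens_bump_notin x : ~ lens Th t t' j j' x -> lens_bump x = 0.
Proof.
move=> nx; apply/eqP/negPn/negP => /lens_bump_K[h1 h2].
by apply: nx; exact: bump_in_lens.
Qed.

Lemma lens_bump_test : test_function Om lens_bump.
Proof.
have cK : closed K.
  apply: closedI.
    rewrite (_ : (fun x => _) = [set x | - bump_width <= bary (Th t) j x] `&`
      ~` [set x | bump_width < bary (Th t) j x]).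
      by apply: closedI; [exact: closed_bary_ge|apply: open_closedC; exact: open_bary_gt].
    apply/seteqP; split=> x /=; rewrite ler_norml.
      by move=> /andP[h1 h2]; split=> //; apply/negP; rewrite -leNgt.
    by move=> [h1 /negP]; rewrite -leNgt => h2; apply/andP.
  rewrite (_ : (fun x => _) = [set x | forall i, (if i == j then setT
      else [set x | bump_level R d <= bary (Th t) i x]) x]).
    by apply: closed_forall_ord => i; case: eqP => _;
      [exact: closedT|exact: closed_bary_ge].
  apply/seteqP; split=> x /= h i; first by case: eqVneq => // /h.
  by move=> /negbTE ij; have := h i; rewrite ij.
have sK : Defs.support lens_bump `<=` K.
  have KE : K = closure K by apply/closure_id.
  by rewrite KE; apply: closure_subset => x /= /lens_bump_K.
have KL : K `<=` lens Th t t' j j' by move=> x [h1 h2]; exact: bump_in_lens.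
split.
- by move=> k; exact: lens_bump_Ck.
- have cU : compact (elem (Th t) `|` elem (Th t')).
    by apply: compactU; exact: elem_compact.
  apply: (subclosed_compact _ cU); first exact: closed_closure.
  by move=> x /sK /KL; exact: (lens_sub hd hTh tt' SS').
by move=> x /sK /KL; exact: (lens_domain hd hOm hTh tt' SS').
Qed.

(** Side means depend only on the values on the side, where the bump is a
positive multiple of [side_bump]. *)
Lemma lens_bump_mean_gt0 : 0 < side_mean (Th t) j lens_bump (grad lens_bump).
Proof.
pose c := flat 1 bump_width * flat 1 bump_width : R.
have c0 : 0 < c by rewrite mulr_gt0// flat1_gt0// bump_width_gt0.
have fG := Ck1_has_grad (lens_bump_Ck 1).
have pG := Ck1_has_grad (side_bump_Ck (Th t) j 1).
have cpG : has_grad (fun x => c * side_bump (Th t) j x)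
    (fun x => c *: grad (side_bump (Th t) j) x).
  have [cp cg hp] := pG; split.
  - by apply: continuous_mul => // x; exact: cst_continuous.
  - by apply: continuous_scale => // x; exact: cst_continuous.
  by move=> x v; rewrite dotpZl; exact: (is_deriveZ c (hp x v)).
suff -> : side_mean (Th t) j lens_bump (grad lens_bump) =
    c * side_mean (Th t) j (side_bump (Th t) j) (grad (side_bump (Th t) j)).
  by rewrite mulr_gt0// side_bump_mean_gt0.
have -> : c * side_mean (Th t) j (side_bump (Th t) j) (grad (side_bump (Th t) j)) =
    side_mean (Th t) j (fun x => c * side_bump (Th t) j x)
    (fun x => c *: grad (side_bump (Th t) j) x).
  rewrite /side_mean mulrCA -RintegralZl//; last 2 first.
  - exact: elem_measurable.
  - by apply: continuous_integrable_elem => //; exact: cone_integrand_continuous.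
  by congr (_ * _); apply: eq_Rintegral => x _; rewrite dotpZl; ring.
apply/eqP; rewrite -subr_eq0 -side_meanB//; apply/eqP; apply: side_mean0 => //.
  exact: has_gradB.
move=> x /(sideP (nd t))[_ xj]; rewrite /lens_bump xj !mulr0 !add0r.
by rewrite subrr.
Qed.

Variables (y : V -> V) (a : 'I_N -> V) (b : 'I_N -> R) (g : V -> R).
Hypothesis ey : elementwise Th y a b.
Hypothesis yg : is_weak_div Om y g.

(** Testing the weak divergence with the bump leaves only the contributions of
the common side. There the bump has the same positive mean seen from both
elements, so the two fluxes are opposite. *)
Lemma flux_match :
  flux (Th t) (a t) (b t) j + flux (Th t') (a t') (b t') j' = 0.
Proof.
have fG := Ck1_has_grad (lens_bump_Ck 1); have [cf cG _] := fG.
set f := lens_bump in fG cf cG *; set G := grad f in fG cG *.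
have sm0 k i : (forall x, side (Th k) i x -> ~ lens Th t t' j j' x) ->
    side_mean (Th k) i f G = 0.
  by move=> h; apply: side_mean0 => // x /h /lens_bump_notin.
have out k x : k != t -> k != t' -> open_elem (Th k) x -> f x = 0.
  move=> kt kt' ox; apply: lens_bump_notin => /(lens_sub hd hTh tt' SS').
  by case; [exact: (open_elem_notin hTh kt ox)|exact: (open_elem_notin hTh kt' ox)].
have sum0 : \sum_k \sum_i flux (Th k) (a k) (b k) i * side_mean (Th k) i f G = 0.
  have tf := lens_bump_test.
  have := yg.2 f tf; rewrite (Rintegral_flux hd hOm hTh ey fG).
  rewrite (L2prod_test hOm hTh (proj1 yg) cf).
  have W k := weak_div_elem hd hOm hTh ey yg k lens_bump_Ck.
  rewrite (eq_bigr _ (fun k _ => W k)).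
  by move/eqP; rewrite subr_eq addNr => /eqP.
have other k : k != t -> k != t' ->
    \sum_i flux (Th k) (a k) (b k) i * side_mean (Th k) i f G = 0.
  move=> kt kt'; rewrite -(divergence_theorem hd _ _ (nd k) fG).
  rewrite (Rintegral_ae (elem_measurable (nd k)) (h := cst 0))//.
  - by rewrite Rintegral_cst ?mul0r//; exact: elem_measurable.
  - apply: continuous_measurable_rV; apply: continuous_add.
      by apply: continuous_dotp => //; exact: rt_continuous.
    by apply: continuous_mul => // x; exact: cst_continuous.
  apply: (ae_open_elem hTh) => x ox.
  have -> : G x = 0.
    exact: (grad0_open (@open_elem_open _ _ (Th k)) (fun y => @out k y kt kt') ox).
  rewrite dotp0r.
  by rewrite (out k x kt kt' ox) mulr0 addr0.
have one k i : (forall l x, l != i -> lens Th t t' j j' x -> 0 < bary (Th k) l x) ->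
    \sum_i flux (Th k) (a k) (b k) i * side_mean (Th k) i f G =
    flux (Th k) (a k) (b k) i * side_mean (Th k) i f G.
  move=> h; rewrite (bigD1 i)//= big1 ?addr0// => l li.
  rewrite sm0 ?mulr0// => x /(sideP (nd k))[_ xl] Lx.
  by have := h l x li Lx; rewrite xl ltxx.
move: sum0; rewrite (bigD1 t)//= (bigD1 t') /=; last by rewrite eq_sym.
rewrite [X in _ + (_ + X)]big1 ?addr0; last first.
  by move=> k /andP[kt kt']; exact: other.
rewrite (one t j) => [|l x lj [h _]]; last exact: h.
rewrite (one t' j') => [|l x lj [_ h]]; last exact: h.
have [s [sj sT]] := sharing_vertices (nd t) (nd t') SS'.
rewrite (side_mean_eq (s := s) (nd t) (nd t') fG sT) sj -mulrDl => /eqP.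
rewrite mulf_eq0 => /orP[/eqP//|/eqP s0].
have := lens_bump_mean_gt0.
by rewrite -/f -/G (side_mean_eq (s := s) (nd t) (nd t') fG sT) sj s0 ltxx.
Qed.

End flux_matching.

(** * Fields with matching fluxes *)

Section rt_construction.
Variables (R : realType) (d : nat).
Hypothesis hd : (0 < d)%N.
Notation V := 'rV[R]_d.
Notation mu := (lebesgue_rV R d).
Variable Om : set V.
Hypothesis hOm : bounded_polyhedral_lipschitz_domain Om.
Variables (N : nat) (Th : 'I_N -> 'I_d.+1 -> V).
Hypothesis hTh : regular_triangulation Om Th.

Let nd t : Defs.nondegenerate (Th t). Proof. by case: hTh. Qed.

Lemma piecewise_L2 (w : V -> R) (h : 'I_N -> V -> R) : measurable_fun setT w ->
  (forall t, continuous (h t)) -> (forall t, ae_eq mu (elem (Th t)) w (h t)) ->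
  L2 Om w.
Proof.
move=> mw ch wh; split=> //.
have m2 : measurable_fun setT (fun x => w x ^+ 2) by exact: measurable_funX.
have [||/integrableP[_ i2] _] := Rintegral_mesh hOm hTh (h := fun t x => h t x ^+ 2) m2.
- by move=> t; rewrite (_ : (fun x => _) = fun x => h t x * h t x)//; exact: continuous_mul.
- by move=> t; apply: filterS (wh t) => x wx Tx; rewrite wx.
apply: le_lt_trans i2; rewrite le_eqVlt; apply/orP; left; apply/eqP.
by apply: eq_integral => x _ /=; rewrite ger0_norm// sqr_ge0.
Qed.

Lemma elementwise_glue a b :
  elementwise Th (Defs.glue Th (fun t x => a t + b t *: (x - elem_mid (Th t)))) a b.
Proof.
split=> [i|t]; last by apply: (ae_open_elem hTh) => x ox; rewrite (glue_elem hTh _ ox).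
rewrite (_ : (fun x => _) = Defs.glue Th (fun t (x : V) =>
   (a t + b t *: (x - elem_mid (Th t))) ord0 i : R^o)).
  apply: (glue_measurable hTh) => t.
  exact: (continuous_compose (@rt_continuous _ _ _ _ _) (@coord_continuous R 1 d ord0 i)).
by apply/funext => x; rewrite /Defs.glue summxE; apply: eq_bigr => t _; rewrite mxE.
Qed.

Variables (a : 'I_N -> V) (b : 'I_N -> R) (y : V -> V).
Hypothesis ey : elementwise Th y a b.
Hypothesis flux0 : forall t t' j j', t != t' -> side (Th t) j = side (Th t') j' ->
  flux (Th t) (a t) (b t) j + flux (Th t') (a t') (b t') j' = 0.

(** Matching fluxes are sufficient: a test function has the same mean on a side
    seen from both elements and vanishes on the boundary. *)
Lemma flux_weak_div :
  is_weak_div Om y (Defs.glue Th (fun t _ => d%:R * b t : R^o)).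
Proof.
set g := Defs.glue _ _.
have cg t : continuous (cst (d%:R * b t) : V -> R) by move=> x; exact: cst_continuous.
have mg : measurable_fun setT g by exact: (glue_measurable hTh).
have eg t : ae_eq mu (elem (Th t)) g (cst (d%:R * b t)).
  by apply: (ae_open_elem hTh) => x ox; rewrite /g (glue_elem hTh _ ox).
have Lg : L2 Om g by exact: piecewise_L2 mg cg eg.
split=> // psi [psiC _ psiO].
have fG := Ck1_has_grad (psiC 1%N); have [cf _ _] := fG.
have psi0 x : ~ Om x -> psi x = 0.
  move=> nO; apply/eqP/negPn/negP => px; apply: nO; apply: psiO.
  exact: subset_closure.
rewrite (Rintegral_flux hd hOm hTh ey fG) (L2prod_test hOm hTh Lg cf).
rewrite (side_sum0 hd hOm hTh) ?sub0r.
- congr (- _); apply: eq_bigr => t _.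
  have mE := elem_measurable (nd t).
  rewrite [RHS](Rintegral_ae mE (h := fun x => d%:R * b t * psi x)).
  + by rewrite RintegralZl//; exact: continuous_integrable_elem.
  + apply: measurable_funM; [exact: mg|exact: continuous_measurable_rV].
  + by apply: continuous_measurable_rV; apply: continuous_mul => // x; exact: cst_continuous.
  by apply: filterS (eg t) => x gx Tx; rewrite gx.
- move=> t j bS; rewrite side_mean0 ?mulr0// => x /bS bx; apply: psi0.
  exact: (boundary_notin hOm bx).
move=> t t' j j' tt' SS'.
have [s [sj sT]] := sharing_vertices (nd t) (nd t') SS'.
by rewrite (side_mean_eq (s := s) (nd t) (nd t') fG sT) sj -mulrDl flux0// mul0r.
Qed.

Lemma flux_RT : RT Om Th y.
Proof.
split; last by move=> t; exists (a t), (b t); exact: ey.2.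
split; last by exists (Defs.glue Th (fun t _ => d%:R * b t : R^o)); exact: flux_weak_div.
move=> i; apply: (@piecewise_L2 _ (fun t x => (a t + b t *: (x - elem_mid (Th t))) ord0 i)).
- exact: ey.1.
- move=> t; exact: (continuous_compose (@rt_continuous _ _ _ _ _) (@coord_continuous R 1 d ord0 i)).
by move=> t; apply: filterS (ey.2 t) => x yx Tx; rewrite yx.
Qed.

End rt_construction.

(** * Crouzeix--Raviart functions and side midpoint values *)

Section cr_local.
Variables (R : realType) (d : nat).
Hypothesis hd : (0 < d)%N.
Notation V := 'rV[R]_d.
Implicit Types (T : 'I_d.+1 -> V) (p : 'I_d.+1 -> R).

Let d0 : d%:R != 0 :> R. Proof. by rewrite pnatr_eq0 -lt0n. Qed.

(** The gradient of the affine function with the values [p] at the side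
midpoints; the basis function of the side [j] is [1 - d * bary T j]. *)
Definition cr_grad T p : V := - (d%:R *: \sum_j p j *: bgrad T j).

Definition cr_cst T p : R :=
  (d.+1%:R)^-1 * \sum_j p j - dotp (cr_grad T p) (elem_mid T).

Lemma cr_elem_mid T p : aff (cr_cst T p) (cr_grad T p) (elem_mid T) =
  (d.+1%:R)^-1 * \sum_j p j.
Proof. by rewrite /aff /cr_cst subrK. Qed.

Lemma cr_side_mid T p i : Defs.nondegenerate T ->
  aff (cr_cst T p) (cr_grad T p) (side_mid T i) = p i.
Proof.
move=> ndT; rewrite /aff /cr_cst -addrA [- _ + _]addrC -dotpBr.
rewrite /cr_grad -scaleNr dotpZl dotp_suml.
have E j : dotp (p j *: bgrad T j) (side_mid T i - elem_mid T) =
   p j * ((j != i)%:R / d%:R - d.+1%:R^-1).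
  rewrite dotpZl -(bary_side_mid ndT hd) -(bary_elem_mid ndT j).
  by rewrite (baryE T j (side_mid T i) (elem_mid T)) [_ + dotp _ _]addrC addrK.
rewrite (eq_bigr _ (fun j _ => E j)) !mulr_sumr -big_split /=.
rewrite (bigD1 i)//= big1 ?addr0 => [|j ji].
  by rewrite eqxx mul0r sub0r -[d.+1%:R]natr1; field; rewrite natr1 pnatr_eq0.
by rewrite ji mul1r -[d.+1%:R]natr1; field; rewrite natr1 pnatr_eq0 d0.
Qed.

Lemma cr_grad_aff T c g : Defs.nondegenerate T ->
  cr_grad T (fun j => aff c g (side_mid T j)) = g.
Proof.
move=> ndT; have E j : aff c g (side_mid T j) =
    (c + (1 + d%:R^-1) * dotp g (elem_mid T)) - d%:R^-1 * dotp g (T j).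
  rewrite /aff side_mid_elem_mid//; move: (elem_mid T) => m.
  by rewrite dotpDr dotpZr dotpBr; ring.
rewrite /cr_grad (eq_bigr (fun j => (c + (1 + d%:R^-1) * dotp g (elem_mid T)) *: bgrad T j
   - (d%:R^-1 * dotp g (T j)) *: bgrad T j)); last first.
  by move=> j _; rewrite E scalerBl.
rewrite sumrB -scaler_sumr bgrad_sum scaler0 sub0r scalerN opprK.
under eq_bigr do rewrite -scalerA.
rewrite -scaler_sumr scalerA divff// scale1r.
apply/rowP => i; rewrite summxE -[RHS](dotp_delta g i).
rewrite -[in RHS](bgrad_comb ndT (basis_vec R i)) dotp_sumr.
by apply: eq_bigr => j _; rewrite mxE dotpZr dotp_delta mulrC.
Qed.

Lemma cr_gradD T p q : cr_grad T (fun j => p j + q j) = cr_grad T p + cr_grad T q.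
Proof.
rewrite /cr_grad -opprD -scalerDr -big_split /=; congr (- (_ *: _)).
by apply: eq_bigr => j _; rewrite scalerDl.
Qed.

Lemma cr_gradZ T s p : cr_grad T (fun j => s * p j) = s *: cr_grad T p.
Proof.
rewrite /cr_grad scalerN scalerA [s * _]mulrC -scalerA [in RHS]scaler_sumr.
by congr (- (_ *: _)); apply: eq_bigr => j _; rewrite scalerA.
Qed.

Lemma cr_grad_cst T s : cr_grad T (fun=> s) = 0.
Proof. by rewrite /cr_grad -scaler_sumr bgrad_sum !scaler0 oppr0. Qed.

(** The vectors [T i - side_mid T j] with [i != j] are orthogonal to a normal,
and [w] is the combination of all of these with the weights [dotp (bgrad T i)
w]. *)
Lemma normal_dotp T j nu w : Defs.nondegenerate T -> outer_unit_normal T j nu ->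
  dotp nu w = dotp (bgrad T j) w * dotp nu (T j - side_mid T j).
Proof.
move=> ndT [_ nS _]; set m := side_mid T j.
have wE : w = \sum_i dotp (bgrad T i) w *: (T i - m).
  under eq_bigr do rewrite scalerBr.
  by rewrite sumrB -scaler_suml -dotp_suml bgrad_sum dotp0l scale0r subr0 bgrad_comb.
rewrite {1}wE dotp_sumr (bigD1 j)//= dotpZr big1 ?addr0// => i ij.
rewrite dotpZr nS ?mulr0//.
  apply/(sideP ndT); split=> [k|]; rewrite bary_vertex// eq_sym; by rewrite (negbTE ij).
exact/relint_side_sub/relint_side_mid.
Qed.

(** The normalized gradient of the coordinate [j], with the opposite sign. *)
Lemma outer_normal_ex T j : Defs.nondegenerate T -> exists nu, outer_unit_normal T j nu.
Proof.
move=> ndT; pose q := bgrad T j; pose r := Num.sqrt (dotp q q).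
have r0 : 0 < r.
  by rewrite sqrtr_gt0 lt_neqAle dotp_self_ge0 andbT eq_sym dotp_self_eq0 bgrad_neq0.
have rr : r * r = dotp q q by rewrite -expr2 sqr_sqrtr// dotp_self_ge0.
exists (- r^-1 *: q); split.
- by rewrite dotpZl dotpZr -rr; field; rewrite gt_eqF.
- move=> x y /(sideP ndT)[_ xj] /(sideP ndT)[_ yj]; rewrite dotpZl.
  have := baryE T j x y; rewrite xj yj add0r => <-; by rewrite mulr0.
move=> x /(sideP ndT)[_ xj]; rewrite dotpZl.
have := baryE T j (T j) x; rewrite bary_vertex// eqxx xj add0r => <-.
by rewrite mulr1 oppr_lt0 invr_gt0.
Qed.

(** The outer normal is the normalized [- bgrad T j], and the area of the side
is [d * vol T] times the norm of [bgrad T j]. *)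
Lemma flux_normal T a b j x : Defs.nondegenerate T -> side T j x ->
  flux T a b j = - (d%:R * vol T) * dotp (bgrad T j) (a + b *: (x - elem_mid T)).
Proof.
move=> ndT /(sideP ndT)[_ xj]; rewrite /flux dotpDr dotpZr.
have -> : dotp (bgrad T j) (x - elem_mid T) = - d.+1%:R^-1.
  apply/eqP; rewrite -addr_eq0 -(bary_elem_mid ndT j) addrC.
  by rewrite -(baryE T j x (elem_mid T)) xj.
by ring.
Qed.

End cr_local.

Lemma sum_aff_side_mid (R : realType) (d : nat) (hd : (0 < d)%N)
    (T : 'I_d.+1 -> 'rV[R]_d) c g :
  \sum_j aff c g (side_mid T j) = d.+1%:R * aff c g (elem_mid T).
Proof.
have S : \sum_j T j = d.+1%:R *: elem_mid T.
  by rewrite /elem_mid scalerA divff ?scale1r// pnatr_eq0.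
rewrite /aff big_split /= sumr_const card_ord -dotp_sumr mulrDr -[c *+ _]mulr_natl.
congr (_ + _); rewrite -dotpZr; congr (dotp _ _).
under eq_bigr do rewrite (side_mid_elem_mid hd).
move: (elem_mid T) S => m S; by rewrite big_split /= -scaler_sumr sumrB S !sumr_const card_ord scaler_nat subrr
  scaler0 addr0.
Qed.

Section cr_space.
Variables (R : realType) (d : nat).
Hypothesis hd : (0 < d)%N.
Notation V := 'rV[R]_d.
Notation mu := (lebesgue_rV R d).
Variable Om : set V.
Hypothesis hOm : bounded_polyhedral_lipschitz_domain Om.
Variables (N : nat) (Th : 'I_N -> 'I_d.+1 -> V).
Hypothesis hTh : regular_triangulation Om Th.

Let nd t : Defs.nondegenerate (Th t). Proof. by case: hTh. Qed.
Let mE t : measurable (elem (Th t)). Proof. exact: elem_measurable. Qed.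

Definition affine_pieces (u : V -> R) (c : 'I_N -> R) (g : 'I_N -> V) :=
  measurable_fun setT u /\ forall t, ae_eq mu (elem (Th t)) u (aff (c t) (g t)).

(** Affine functions that agree almost everywhere on an element are equal, so
the chosen restriction is the expected one. *)
Lemma restr_aff w t c g : ae_eq mu (elem (Th t)) w (aff c g) ->
  restr Th 1 w t = aff c g.
Proof.
move=> wcg; have ex : is_restr Th 1 w t (aff c g) by split=> //; exact: aff_Pk1.
have [/Pk1_aff[c' [g' ->]] wcg'] : is_restr Th 1 w t (restr Th 1 w t).
  exact: xgetPex (ex_intro _ _ ex).
have ae' : ae_eq mu (elem (Th t)) (aff c' g') (aff c g).
  by apply: filterS2 wcg wcg' => x h1 h2 Tx; rewrite -h1// -h2.
have E := ae_eq_open (@aff_continuous _ _ c' g') (@aff_continuous _ _ c g)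
  (@open_elem_open _ _ (Th t)) (open_elem_sub (nd t)) ae'.
have [|-> -> //] := aff_ext (@open_elem_open _ _ (Th t)) _ E.
by exists (elem_mid (Th t)); exact: elem_mid_open_elem.
Qed.

Lemma Lk1_affine u : Lk Om Th 1 u -> exists c g, affine_pieces u c g.
Proof.
move=> [[mu_ _] h].
have h' t : exists q : R * V, ae_eq mu (elem (Th t)) u (aff q.1 q.2).
  by have [p [/Pk1_aff[c [g ->]] e]] := h t; exists (c, g).
have [f hf] := choice h'.
by exists (fun t => (f t).1), (fun t => (f t).2).
Qed.

Lemma affine_Lk1 u c g : affine_pieces u c g -> Lk Om Th 1 u.
Proof.
move=> [mu_ ucg]; split; last first.
  by move=> t; exists (aff (c t) (g t)); split; [exact: aff_Pk1|exact: ucg].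
split=> //.
have hk t : exists K : R, 0 <= K /\
    forall x, elem (Th t) x -> `|aff (c t) (g t) x| <= K.
  have [K K0 hK] := continuous_bounded_elem (nd t) (@aff_continuous _ _ (c t) (g t)).
  by exists K.
have [K hK] := choice hk.
exists (\sum_t K t); apply/(ae_domain hOm hTh) => t.
apply: filterS (ucg t) => x ux Tx; rewrite ux//.
apply: (le_trans ((hK t).2 x Tx)); rewrite (bigD1 t)//= lerDl.
by apply: sumr_ge0 => s _; case: (hK s).
Qed.

(** Side midpoint values of the Crouzeix--Raviart functions that vanish at the
midpoints of the sides in [GD]. *)
Definition conforming (GD : set V) (p : 'I_N -> 'I_d.+1 -> R) :=
  (forall t t' j j', side (Th t) j = side (Th t') j' -> p t j = p t' j') /\
  (forall t j, side (Th t) j `<=` GD -> p t j = 0).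

Lemma CR_D_conforming GD u c g : affine_pieces u c g -> CR_D Om Th GD u <->
  conforming GD (fun t j => aff (c t) (g t) (side_mid (Th t) j)).
Proof.
move=> ucg; have rE t := restr_aff (ucg.2 t).
have mid t t' j j' (S : side (Th t) j = side (Th t') j') :=
  side_mid_eq (nd t) (nd t') S.
split=> [[[_ h1] h2]|[h1 h2]].
  split=> [t t' j j' SS'|t j SD]; last by have := h2 t j SD; rewrite rE.
  by rewrite -(mid _ _ _ _ SS') -(rE t) -(rE t') (h1 _ _ _ _ SS').
split; first split.
- exact: affine_Lk1 ucg.
- by move=> t t' j j' SS'; rewrite !rE (h1 _ _ _ _ SS') (mid _ _ _ _ SS').
by move=> t j SD; rewrite rE; exact: h2.
Qed.

Lemma mean_aff v t c g : measurable_fun setT v -> ae_eq mu (elem (Th t)) v (aff c g) ->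
  mean Th t v = aff c g (elem_mid (Th t)).
Proof.
move=> mv vcg; rewrite /mean (Rintegral_ae (mE t) mv _ vcg); last first.
  by apply: continuous_measurable_rV; exact: aff_continuous.
rewrite /aff Rintegral_affine// -/(vol (Th t)) mulKf// gt_eqF// vol_gt0//.
Qed.

Lemma Pi_h_aff u c g t x : affine_pieces u c g -> open_elem (Th t) x ->
  Pi_h Th u x = aff (c t) (g t) (elem_mid (Th t)).
Proof.
by move=> [mu_ ucg] ox; rewrite /Pi_h (glue_elem hTh _ ox); exact: mean_aff.
Qed.

Lemma grad_h_aff u c g t x : affine_pieces u c g -> open_elem (Th t) x ->
  grad_h Th u x = g t.
Proof.
by move=> [mu_ ucg] ox; rewrite /grad_h (glue_elem hTh _ ox) (restr_aff (ucg t)) grad_aff.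
Qed.

Lemma affine_pieces_glue c g :
  affine_pieces (Defs.glue Th (fun t x => aff (c t) (g t) x : R^o)) c g.
Proof.
split; first by apply: (glue_measurable hTh) => t; exact: aff_continuous.
by move=> t; apply: (ae_open_elem hTh) => x ox; rewrite (glue_elem hTh _ ox).
Qed.

Definition elementwise_cst (w : V -> R) (m : 'I_N -> R) :=
  measurable_fun setT w /\ forall t, ae_eq mu (elem (Th t)) w (cst (m t)).

Lemma Pi_h_affine_cst u c g w m : affine_pieces u c g -> elementwise_cst w m ->
  ae_eq mu Om (Pi_h Th u) w <-> forall t, aff (c t) (g t) (elem_mid (Th t)) = m t.
Proof.
move=> ucg [mw wm].
have cc (k : R) : continuous (cst k : V -> R) by move=> x; exact: cst_continuous.
split=> [/(ae_domain hOm hTh) h t|h]; last first.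
  apply/(ae_domain hOm hTh) => t.
  have Pu := ae_open_elem hTh (fun x => @Pi_h_aff u c g t x ucg).
  by apply: filterS2 (wm t) Pu => x h1 h2 Tx; rewrite h1// h2//.
have Pu := ae_open_elem hTh (fun x => @Pi_h_aff u c g t x ucg).
have ae' : ae_eq mu (elem (Th t)) (cst (aff (c t) (g t) (elem_mid (Th t)))) (cst (m t)).
  by apply: filterS3 (h t) Pu (wm t) => x h1 h2 h3 Tx; rewrite -h3// -h1// h2.
exact: (ae_eq_open (cc _) (cc _) (@open_elem_open _ _ (Th t)) (open_elem_sub (nd t))
  ae' (elem_mid_open_elem (nd t))).
Qed.

Lemma Pi_h_CR_D_cst GD w : Pi_h_CR_D Om Th GD w -> exists m, elementwise_cst w m.
Proof.
move=> [mw [v [[Lv _] _] vw]]; have [c [g vcg]] := Lk1_affine Lv.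
exists (fun t => aff (c t) (g t) (elem_mid (Th t))); split=> // t.
have Pv := ae_open_elem hTh (fun x => @Pi_h_aff v c g t x vcg).
have vw' := (ae_domain hOm hTh (fun x => Pi_h Th v x = w x)).2 vw t.
by apply: filterS2 Pv vw' => x h1 h2 Tx; rewrite -h2// h1.
Qed.

(** The constraints of the primal problem in terms of side midpoint values;
the mean of an affine function over an element is the average of these. *)
Definition feasible (GD : set V) (m : 'I_N -> R) p :=
  conforming GD p /\ forall t, \sum_j p t j = d.+1%:R * m t.

Definition energy (phi : V -> R) (p : 'I_N -> 'I_d.+1 -> R) : R :=
  \sum_t vol (Th t) * phi (cr_grad (Th t) (p t)).

(** A Crouzeix--Raviart function is determined by its side midpoint values,
and all conforming values occur. *)
Lemma primal_valuesE GD phi w m : elementwise_cst w m ->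
  primal_values Om Th GD phi w = [set (energy phi p)%:E | p in feasible GD m].
Proof.
move=> wm; have d1 : d.+1%:R != 0 :> R by rewrite pnatr_eq0.
have val u c g : affine_pieces u c g ->
    (\int[mu]_(x in Om) (phi (grad_h Th u x))%:E =
     (\sum_t vol (Th t) * phi (g t))%:E)%E.
  move=> ucg; rewrite (integral_piecewise hOm hTh
    (c := fun t => (phi (g t))%:E) (c0 := (phi 0)%:E)) //.
  - by rewrite -sumEFin; apply: eq_bigr => t _; rewrite EFinM.
  - by move=> t x ox; rewrite (grad_h_aff ucg ox).
  by move=> x nx; rewrite /grad_h (glue_skeleton hTh _ nx).
apply/seteqP; split=> [_ [u [uD uw] <-]|_ [p [pc pm] <-]].
  have [c [g ucg]] := Lk1_affine uD.1.1.
  exists (fun t j => aff (c t) (g t) (side_mid (Th t) j)).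
    split; first exact/(CR_D_conforming _ ucg).
    by move=> t; rewrite -((Pi_h_affine_cst ucg wm).1 uw t) sum_aff_side_mid.
  by rewrite (val _ _ _ ucg); congr EFin; apply: eq_bigr => t _; rewrite cr_grad_aff.
pose c t := cr_cst (Th t) (p t); pose g t := cr_grad (Th t) (p t).
have ucg := affine_pieces_glue c g.
have pE : (fun t j => aff (c t) (g t) (side_mid (Th t) j)) = p.
  by apply/funext => t; apply/funext => j; exact: cr_side_mid.
exists (Defs.glue Th (fun t x => aff (c t) (g t) x : R^o)).
  split; first by apply/(CR_D_conforming _ ucg); rewrite pE.
  by apply/(Pi_h_affine_cst ucg wm) => t; rewrite cr_elem_mid pm mulKf.
exact: (val _ _ _ ucg).
Qed.

End cr_space.

(** * Raviart--Thomas fields and their coefficients *)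

Section rt_space.
Variables (R : realType) (d : nat).
Hypothesis hd : (0 < d)%N.
Notation V := 'rV[R]_d.
Notation mu := (lebesgue_rV R d).
Variable Om : set V.
Hypothesis hOm : bounded_polyhedral_lipschitz_domain Om.
Variables (N : nat) (Th : 'I_N -> 'I_d.+1 -> V).
Hypothesis hTh : regular_triangulation Om Th.

Let nd t : Defs.nondegenerate (Th t). Proof. by case: hTh. Qed.
Let mE t : measurable (elem (Th t)). Proof. exact: elem_measurable. Qed.

Lemma RT_elementwise z : RT Om Th z -> exists a b, elementwise Th z a b.
Proof.
move=> [[L2z _] h].
have h' t : exists q : V * R, ae_eq mu (elem (Th t)) z
    (fun x => q.1 + q.2 *: (x - elem_mid (Th t))).
  by have [a [b e]] := h t; exists (a, b).
have [f hf] := choice h'; exists (fun t => (f t).1), (fun t => (f t).2).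
by split=> // i; case: (L2z i).
Qed.

Lemma rt_coord (a : V) b m i (x : V) : (a + b *: (x - m)) ord0 i =
  aff (a ord0 i - b * m ord0 i) (b *: basis_vec R i) x.
Proof. by rewrite /aff dotpZl dotpC dotp_delta !mxE; ring. Qed.

Section field.
Variables (z : V -> V) (a : 'I_N -> V) (b : 'I_N -> R).
Hypothesis ez : elementwise Th z a b.

Let ez_coord t i : ae_eq mu (elem (Th t)) (fun x => z x ord0 i)
  (aff (a t ord0 i - b t * elem_mid (Th t) ord0 i) (b t *: basis_vec R i)).
Proof. by apply: filterS (ez.2 t) => x zx Tx; rewrite zx// rt_coord. Qed.

Lemma restr_vec_rt t x : restr_vec Th z t x = a t + b t *: (x - elem_mid (Th t)).
Proof.
by apply/rowP => i; rewrite mxE (restr_aff hTh (ez_coord t i)) rt_coord.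
Qed.

Lemma Pi_h_vec_rt t x : open_elem (Th t) x -> Pi_h_vec Th z x = a t.
Proof.
move=> ox; rewrite /Pi_h_vec (glue_elem hTh _ ox); apply/rowP => i.
rewrite mxE (mean_aff hTh (ez.1 i) (ez_coord t i)) -rt_coord.
by rewrite subrr scaler0 addr0.
Qed.

(** The normal component of the field is continuous across the sides and
vanishes on [GN]. *)
Definition admissible (GN : set V) (ab : ('I_N -> V) * ('I_N -> R)) :=
  (forall t t' j j', t != t' -> side (Th t) j = side (Th t') j' ->
     flux (Th t) (ab.1 t) (ab.2 t) j + flux (Th t') (ab.1 t') (ab.2 t') j' = 0) /\
  (forall t j, side (Th t) j `<=` GN -> flux (Th t) (ab.1 t) (ab.2 t) j = 0).

(** The continuity of the normal component is equivalent to the existence of a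
weak divergence by [flux_match] and [flux_RT]; on [GN] the flux is a nonzero
multiple of the normal component. *)
Lemma RT_N_admissible GN : RT_N Om Th GN z <-> admissible GN (a, b).
Proof.
have v0 t : 0 < d%:R * vol (Th t) by rewrite mulr_gt0 ?ltr0n ?vol_gt0.
split=> [[[[_ [g zg]] _] h]|[h1 h2]].
  split=> [t t' j j' tt' SS'|t j SN /=]; first exact: (flux_match hd hOm hTh tt' SS' ez zg).
  have [nu hnu] := outer_normal_ex hd j (nd t).
  have Sm := relint_side_sub (nd t) (relint_side_mid hd j (nd t)).
  have := h t j nu SN hnu _ Sm.
  rewrite restr_vec_rt dotpC (normal_dotp hd _ (nd t) hnu) => /eqP.
  have [_ _ /(_ _ Sm) n0] := hnu.
  rewrite mulf_eq0 (lt_eqF n0) orbF => /eqP E.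
  by rewrite (flux_normal _ _ (nd t) Sm) E mulr0.
split; first exact: (flux_RT hd hOm hTh ez h1).
move=> t j nu SN hnu x Sx; rewrite restr_vec_rt dotpC (normal_dotp hd _ (nd t) hnu).
have /eqP := h2 t j SN; rewrite (flux_normal _ _ (nd t) Sx) mulf_eq0 oppr_eq0.
by rewrite (gt_eqF (v0 t)) => /eqP ->; rewrite mul0r.
Qed.

(** On an element the integral of the weak divergence is [d * b t * vol (Th
t)], by [weak_div_elem] for the constant function one. *)
Lemma L2prod_divergence w m : Hdiv Om z -> elementwise_cst Th w m ->
  L2prod Om w (divergence Om z) = \sum_t m t * (d%:R * b t * vol (Th t)).
Proof.
move=> [_ [g0 zg0]] [mw wm].
have zg : is_weak_div Om z (divergence Om z) by exact: xgetPex (ex_intro _ _ zg0).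
set g := divergence Om z in zg *; have [mg _] := zg.1.
have mwg : measurable_fun setT (fun x => w x * g x) by exact: measurable_funM.
have ig t := L2_integrable_elem hOm hTh t zg.1.
have mmg t : measurable_fun setT (fun x => m t * g x) by exact: measurable_funM.
have ae_wg t : ae_eq mu (elem (Th t)) (fun x => w x * g x) (fun x => m t * g x).
  by apply: filterS (wm t) => x wx Tx; rewrite wx.
rewrite /L2prod (Rintegral_domain hOm hTh mwg); last first.
  apply/(integrable_domain hOm hTh mwg) => t.
  apply: (integrable_ae_eq (mE t) mwg (mmg t) (ae_wg t)).
  exact: (integrableZl (mE t) (m t) (ig t)).
apply: eq_bigr => t _; rewrite (Rintegral_ae (mE t) mwg (mmg t) (ae_wg t)).
rewrite RintegralZl//; congr (_ * _).
have := weak_div_elem hd hOm hTh ez zg t (fun k => Ck_cst d k (1 : R)).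
rewrite Rintegral_cst// mul1r => <-.
by apply: eq_Rintegral => x _; rewrite mulr1.
Qed.

End field.

Lemma convex_conjugate_gtNy (phi : V -> R) s : (convex_conjugate phi s != -oo)%E.
Proof.
apply/eqP => h; have : ((dotp s 0 - phi 0)%:E <= convex_conjugate phi s)%E.
  by apply: ereal_sup_ubound; exists 0.
by rewrite h leeNy_eq.
Qed.

Definition dual_value (phi : V -> R) (m : 'I_N -> R)
    (ab : ('I_N -> V) * ('I_N -> R)) : \bar R :=
  (- (\sum_t (vol (Th t))%:E * convex_conjugate phi (ab.1 t))
   - (\sum_t m t * (d%:R * ab.2 t * vol (Th t)))%:E)%E.

(** Conversely, admissible coefficients are those of the field glued from the
corresponding pieces. *)
Lemma dual_valuesE GN phi w m : elementwise_cst Th w m ->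
  dual_values Om Th GN phi w = [set dual_value phi m ab | ab in admissible GN].
Proof.
move=> wm.
have val z a b : elementwise Th z a b -> Hdiv Om z ->
    (- (\int[mu]_(x in Om) convex_conjugate phi (Pi_h_vec Th z x))
        - (L2prod Om w (divergence Om z))%:E)%E = dual_value phi m (a, b).
  move=> ez Hz; rewrite (L2prod_divergence ez Hz wm).
  rewrite (integral_piecewise hOm hTh (c := fun t => convex_conjugate phi (a t))
    (c0 := convex_conjugate phi 0)) //.
  - by move=> t x ox; rewrite (Pi_h_vec_rt ez ox).
  - by move=> x nx; rewrite /Pi_h_vec (glue_skeleton hTh _ nx).
  by move=> t; exact: convex_conjugate_gtNy.
apply/seteqP; split=> [_ [z zN <-]|_ [[a b] ab <-]].
  have [a [b ez]] := RT_elementwise zN.1.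
  exists (a, b); first exact/(RT_N_admissible ez).
  by rewrite (val z a b)//; case: zN => [[]].
have ez := elementwise_glue hTh a b.
have zN := (RT_N_admissible ez GN).2 ab.
by eexists; [exact: zN|apply: (val _ _ _ ez); case: zN => [[]]].
Qed.

End rt_space.

(** * Lagrange multipliers for a convex function *)

Section sandwich.
Variables (R : realType) (n : nat).
Implicit Types (p : 'rV[R]_n -> R) (x v : 'rV[R]_n) (gam : 'cV[R]_n).

(** Jensen's inequality for unnormalized weights. *)
Definition convex_ineq (E : lmodType R) (p : E -> R) := forall (x y : E) (r s : R),
  0 < r -> 0 < s ->
  (r + s) * p ((r + s)^-1 *: (r *: x + s *: y)) <= r * p x + s * p y.

Lemma mx11D (A B : 'M[R]_1) : (A + B) 0 0 = A 0 0 + B 0 0. Proof. by rewrite mxE. Qed.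
Lemma mx11Z (a : R) (A : 'M[R]_1) : (a *: A) 0 0 = a * A 0 0. Proof. by rewrite mxE. Qed.

(** The admissible values at [v] form the interval between the supremum of the
lower bounds and the infimum of the upper bounds, nonempty by convexity. *)
Lemma extension_value k (G : 'M[R]_(k, n)) p gam v : convex_ineq p ->
  (forall x, (x <= G)%MS -> (x *m gam) 0 0 <= p x) ->
  exists a : R, forall x (s : R), (x <= G)%MS -> (x *m gam) 0 0 + s * a <= p (x + s *: v).
Proof.
move=> cp gp.
pose L : set R := [set a | exists x (s : R), [/\ (x <= G)%MS, 0 < s &
   a = ((x *m gam) 0 0 - p (x - s *: v)) / s]].
have LU x r : (x <= G)%MS -> 0 < r -> ubound L ((p (x + r *: v) - (x *m gam) 0 0) / r).
  move=> xG r0 _ [y [s [yG s0 ->]]].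
  rewrite ler_pdivrMr// mulrAC ler_pdivlMr//.
  have zG : ((s + r)^-1 *: (s *: x + r *: y) <= G)%MS.
    by rewrite scalemx_sub// addmx_sub// scalemx_sub.
  have sr0 : 0 < s + r by rewrite addr_gt0.
  have h1 := gp _ zG; have h2 := cp (x + r *: v) (y - s *: v) s r s0 r0.
  have E : s *: (x + r *: v) + r *: (y - s *: v) = s *: x + r *: y.
    by rewrite !scalerDr scalerN !scalerA [r * s]mulrC addrACA subrr addr0.
  rewrite E in h2; move: h1; rewrite -scalemxAl mulmxDl -!scalemxAl mx11Z mx11D !mx11Z.
  rewrite -(ler_pM2l sr0) mulrA divff ?gt_eqF// mul1r => h1.
  have := le_trans h1 h2; lra.
have L0 : L !=set0.
  exists (((0 : 'rV_n) *m gam) 0 0 - p (0 - 1 *: v)) ; exists 0, 1; split=> //.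
    exact: sub0mx.
  by rewrite divr1.
have LB : has_sup L.
  split=> //; exists ((p (0 + 1 *: v) - ((0 : 'rV_n) *m gam) 0 0) / 1).
  by apply: LU => //; exact: sub0mx.
exists (sup L) => x s xG.
have [s0|s0|->] := ltgtP s 0; last by rewrite scale0r mul0r !addr0; exact: gp.
  have := sup_upper_bound LB (x := ((x *m gam) 0 0 - p (x + s *: v)) / (- s)).
  have : L (((x *m gam) 0 0 - p (x + s *: v)) / - s).
    by exists x, (- s); rewrite oppr_gt0 s0; split=> //; rewrite scaleNr opprK.
  move=> Lx /(_ Lx); rewrite ler_pdivrMr ?oppr_gt0//; lra.
have := sup_le_ub L0 (LU x s xG s0); rewrite ler_pdivlMr//; lra.
Qed.

Lemma functional_separating k (G : 'M[R]_(k, n)) v : ~~ (v <= G)%MS ->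
  exists eta : 'cV[R]_n, (v *m eta) 0 0 = 1 /\
    forall x, (x <= G)%MS -> (x *m eta) 0 0 = 0.
Proof.
rewrite submxE => /eqP vG.
have [j vj] : exists j, (v *m cokermx G) 0 j != 0.
  apply: contrapT => /forallNP h; apply: vG; apply/rowP => j; rewrite [RHS]mxE.
  by apply/eqP/negPn/negP => hj; apply: (h j).
exists (((v *m cokermx G) 0 j)^-1 *: col j (cokermx G)).
have cE x : (x *m col j (cokermx G)) 0 0 = (x *m cokermx G) 0 j.
  by rewrite [LHS]mxE [RHS]mxE; apply: eq_bigr => i _; rewrite mxE.
split=> [|x]; rewrite -scalemxAr mx11Z cE ?mulVf//.
by rewrite submxE => /eqP ->; rewrite [X in _ * X]mxE mulr0.
Qed.

Lemma extension_step k (G : 'M[R]_(k, n)) p gam v : convex_ineq p ->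
  (forall x, (x <= G)%MS -> (x *m gam) 0 0 <= p x) ->
  exists gam', (forall x, (x <= G)%MS -> (x *m gam') 0 0 = (x *m gam) 0 0) /\
    forall x, (x <= G + v)%MS -> (x *m gam') 0 0 <= p x.
Proof.
move=> cp gp; have [vG|vG] := boolP (v <= G)%MS.
  exists gam; split=> // x xGv; apply: gp; apply: submx_trans xGv _.
  by rewrite addsmx_sub submx_refl.
have [eta [ev eG]] := functional_separating vG.
have [a ha] := extension_value v cp gp.
exists (gam + (a - (v *m gam) 0 0) *: eta).
have E x : (x *m (gam + (a - (v *m gam) 0 0) *: eta)) 0 0 =
    (x *m gam) 0 0 + (a - (v *m gam) 0 0) * (x *m eta) 0 0.
  by rewrite mulmxDr -scalemxAr mx11D mx11Z.
split=> [x xG|x]; first by rewrite E eG// mulr0 addr0.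
move=> /sub_addsmxP[[u1 u2] /= ->].
pose y := u1 *m G; have yG : (y <= G)%MS by exact: submxMl.
have -> : u2 *m v = u2 0 0 *: v by rewrite [u2]mx11_scalar mul_scalar_mx mxE eqxx mulr1n.
rewrite -/y E !mulmxDl -!scalemxAl !mx11D !mx11Z ev (eG y yG).
have := ha y (u2 0 0) yG; lra.
Qed.

(** The Hahn--Banach theorem, by adding the standard basis vectors one at a
time. *)
Lemma convex_extension k (G : 'M[R]_(k, n)) p gam : convex_ineq p ->
  (forall x, (x <= G)%MS -> (x *m gam) 0 0 <= p x) ->
  exists gam', (forall x, (x <= G)%MS -> (x *m gam') 0 0 = (x *m gam) 0 0) /\
    forall x, (x *m gam') 0 0 <= p x.
Proof.
move=> cp gp.
suff h (l : seq 'rV[R]_n) : exists k' (G' : 'M[R]_(k', n)) gam',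
   [/\ (G <= G')%MS, (forall v, v \in l -> (v <= G')%MS),
   (forall x, (x <= G)%MS -> (x *m gam') 0 0 = (x *m gam) 0 0) &
    forall x, (x <= G')%MS -> (x *m gam') 0 0 <= p x].
  have [k' [G' [gam' [_ lG' e h']]]] := h [seq delta_mx 0 i | i <- enum 'I_n].
  exists gam'; split=> // x; apply: h'; rewrite [x]row_sum_delta.
  apply: summx_sub => i _; apply: scalemx_sub; apply: lG'.
  by apply/mapP; exists i; rewrite ?mem_enum.
elim: l => [|v l [k' [G' [gam' [GG' lG' e h']]]]]; first by exists k, G, gam.
have [gam'' [e' h'']] := extension_step v cp h'.
exists n, (G' + v)%MS, gam''; split=> //.
- by apply: submx_trans GG' _; exact: addsmxSl.
- move=> w; rewrite inE => /orP[/eqP->|/lG' h]; first exact: addsmxSr.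
  by apply: submx_trans h _; exact: addsmxSl.
move=> x xG; rewrite e' ?e//; exact: submx_trans xG GG'.
Qed.

(** In suitable bases the constraints are a partial identity matrix, by
Gaussian elimination. *)
Lemma multipliers k (C : 'M[R]_(n, k)) gam : kermx C *m gam = 0 ->
  exists y : 'cV[R]_k, gam = C *m y.
Proof.
rewrite /kermx -mulmxA; set r := \rank C; set del := invmx _ *m gam => h.
have Lu := col_ebase_unit C; have Uu := row_ebase_unit C.
exists (invmx (row_ebase C) *m (pid_mx r *m del)).
rewrite -{1}(mulmx_ebase C) -!mulmxA (mulmxA (row_ebase C)) mulmxV// mul1mx.
rewrite (mulmxA (pid_mx r)) pid_mx_id ?rank_leq_col//.
move: h; rewrite /copid_mx mulmxBl mul1mx => /subr0_eq <-.
by rewrite /del mulKVmx.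
Qed.

End sandwich.

Section lagrange.
Variables (R : realType) (A J : finType).

Lemma sum_enum_val (B : finType) (f : B -> R) : 
  \sum_(i < #|B|) f (enum_val i) = \sum_b f b.
Proof.
rewrite (reindex (@enum_val B (mem B))) //=.
by exists enum_rank => b _; [exact: enum_valK|exact: enum_rankK].
Qed.

(** The zero functional on the subspace of the constraints lies below [p]. It
has an extension below [p], which vanishes on that subspace and is therefore a
combination of the constraints. *)
Lemma lagrange_multipliers (k : J -> A -> R) (p : {ffun A -> R} -> R) :
  convex_ineq p ->
  (forall P : {ffun A -> R}, (forall i, \sum_a k i a * P a = 0) -> 0 <= p P) ->
  exists y : J -> R, forall P : {ffun A -> R},
    \sum_a (\sum_i y i * k i a) * P a <= p P.
Proof.
move=> cp p0.
pose F (x : 'rV[R]_#|A|) : {ffun A -> R} := [ffun a => x 0 (enum_rank a)].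
pose C : 'M[R]_(#|A|, #|J|) := \matrix_(a, i) k (enum_val i) (enum_val a).
have cpF : convex_ineq (p \o F).
  move=> x z r s r0 s0 /=; rewrite (_ : F _ = (r + s)^-1 *: (r *: F x + s *: F z)).
    exact: cp.
  by apply/ffunP => a; rewrite !ffunE !mxE.
have ker0 (x : 'rV[R]_#|A|) : (x <= kermx C)%MS ->
    (x *m (0 : 'cV_#|A|)) 0 0 <= (p \o F) x.
  move=> /sub_kermxP xC.
  rewrite mulmx0 mxE; apply: p0 => i.
  have /rowP/(_ (enum_rank i)) := xC; rewrite !mxE => xi.
  rewrite -[RHS]xi -[LHS]sum_enum_val; apply: eq_bigr => a _.
  by rewrite !mxE !ffunE enum_valK enum_rankK mulrC.
have [gam [gamC gamp]] := convex_extension cpF ker0.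
have [|y gamE] := @multipliers R #|A| #|J| C gam.
  apply/row_matrixP => i.
  rewrite row0 row_mul [LHS]mx11_scalar (gamC _ (row_sub i _)) mulmx0.
  by apply/matrixP => u v; rewrite !mxE mul0rn.
exists (fun i => y (enum_rank i) 0) => P.
have {2}-> : P = F (\row_a P (enum_val a)).
  by apply/ffunP => a; rewrite ffunE mxE enum_rankK.
apply: le_trans (gamp _); rewrite le_eqVlt; apply/orP; left; apply/eqP.
rewrite gamE mxE -[LHS]sum_enum_val; apply: eq_bigr => a _.
rewrite !mxE mulrC; congr (_ * _); rewrite -[LHS]sum_enum_val.
by apply: eq_bigr => i _; rewrite !mxE enum_valK mulrC.
Qed.

Lemma convex_function_ineq (E : lmodType R) (f : E -> R) :
  convex_function [set: E] f -> convex_ineq f.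
Proof.
move=> cf x z r s r0 s0; have rs0 : 0 < r + s by rewrite addr_gt0.
have h0 : 0 <= r / (r + s) by rewrite divr_ge0// ltW.
have h1 : r / (r + s) <= 1 by rewrite ler_pdivrMr// mul1r lerDl ltW.
have oE : unstable.onem (r / (r + s)) = s / (r + s).
  by rewrite /unstable.onem; field; rewrite gt_eqF.
have := cf (Itv01 h0 h1) x z (mem_set I) (mem_set I).
rewrite convRE /= oE.
have -> : conv (Itv01 h0 h1) (x : convex_lmodType E) z =
    (r + s)^-1 *: (r *: x + s *: z).
  rewrite scalerDr !scalerA ![_^-1 * _]mulrC -oE; reflexivity.
rewrite -(ler_pM2l rs0) => /le_trans; apply.
by rewrite le_eqVlt; apply/orP; left; apply/eqP; field; rewrite gt_eqF.
Qed.

End lagrange.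

(** * Duality *)

Section duality.
Variables (R : realType) (d : nat).
Hypothesis hd : (0 < d)%N.
Notation V := 'rV[R]_d.
Variable Om : set V.
Hypothesis hOm : bounded_polyhedral_lipschitz_domain Om.
Variables (N : nat) (Th : 'I_N -> 'I_d.+1 -> V).
Hypothesis hTh : regular_triangulation Om Th.
Variables GD GN : set V.
Hypothesis hG : boundary_partition Om Th GD GN.

Let nd t : Defs.nondegenerate (Th t). Proof. by case: hTh. Qed.
Let d0 : 0 < d%:R :> R. Proof. by rewrite ltr0n. Qed.
Let v0 t : 0 < vol (Th t). Proof. exact: vol_gt0. Qed.

Implicit Type T : 'I_d.+1 -> V.

(** The fluxes through the sides are degrees of freedom for the fields on one
simplex. *)
Lemma flux_onto T (F : 'I_d.+1 -> R) : Defs.nondegenerate T ->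
  exists a b, forall j, flux T a b j = F j.
Proof.
move=> ndT; have vT := vol_gt0 ndT.
pose b := (\sum_j F j) / (d%:R * vol T).
pose q j := b / d.+1%:R - F j / (d%:R * vol T).
have q0 : \sum_j q j = 0.
  rewrite sumrB sumr_const card_ord -mulr_suml -/b -[_ *+ _]mulr_natl.
  by rewrite mulrCA divff ?mulr1 ?subrr// pnatr_eq0.
exists (\sum_j q j *: T j), b => j; rewrite /flux dotp_bgrad_comb//.
by rewrite /q; field; rewrite !gt_eqF.
Qed.

Lemma flux_pairing T a b p : Defs.nondegenerate T ->
  \sum_j flux T a b j * p j =
  vol T * (dotp a (cr_grad T p) + d%:R * b * (d.+1%:R^-1 * \sum_j p j)).
Proof.
move=> ndT; rewrite -(cr_elem_mid T) /aff affine_flux//.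
by apply: eq_bigr => j _; rewrite -[_ + dotp _ _]/(aff _ _ _) cr_side_mid.
Qed.

(** Integration by parts: the boundary terms cancel in pairs on interior sides,
and one of the factors vanishes on each boundary side. *)
Lemma admissible_orthogonal ab p : admissible Th GN ab -> conforming Th GD p ->
  \sum_t \sum_j flux (Th t) (ab.1 t) (ab.2 t) j * p t j = 0.
Proof.
move=> [f1 f2] [p1 p2]; apply: (side_sum0 hd hOm hTh).
  move=> t j /(boundary_gd_gn hG)[SD|SN]; first by rewrite p2// mulr0.
  by rewrite f2// mul0r.
by move=> t t' j j' tt' SS'; rewrite (p1 _ _ _ _ SS') -mulrDl f1// mul0r.
Qed.

Lemma feasible_pairing ab p m : admissible Th GN ab -> feasible Th GD m p ->
  \sum_t vol (Th t) * dotp (ab.1 t) (cr_grad (Th t) (p t)) =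
  - \sum_t m t * (d%:R * ab.2 t * vol (Th t)).
Proof.
move=> abN [pc pm]; apply/eqP; rewrite -addr_eq0 -big_split /=.
apply/eqP; rewrite -[RHS](admissible_orthogonal abN pc); apply: eq_bigr => t _.
rewrite flux_pairing// pm mulKf ?pnatr_eq0//; ring.
Qed.

Lemma fenchel (phi : V -> R) (s r : V) :
  ((dotp s r - phi r)%:E <= convex_conjugate phi s)%E.
Proof. by apply: ereal_sup_ubound; exists r. Qed.

(** Fenchel's inequality on each element and integration by parts. *)
Lemma weak_duality phi m ab p : admissible Th GN ab -> feasible Th GD m p ->
  (dual_value Th phi m ab <= (energy Th phi p)%:E)%E.
Proof.
move=> abN pf; rewrite /dual_value; set S := \sum_t m t * _.
set X := (\sum_t _)%E.
have : ((\sum_t vol (Th t) * (dotp (ab.1 t) (cr_grad (Th t) (p t)) -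
    phi (cr_grad (Th t) (p t))))%:E <= X)%E.
  rewrite -sumEFin; apply: lee_sum => t _; rewrite EFinM.
  by apply: lee_wpmul2l; [rewrite lee_fin ltW|exact: fenchel].
under eq_bigr do rewrite mulrBr.
rewrite sumrB (feasible_pairing abN pf) -/S -/(energy Th phi p).
case: X => [x| |] //=; last by move=> _; rewrite leNye.
by rewrite !lee_fin => h; lra.
Qed.

(** Testing with the indicator function of a side. *)
Lemma orthogonal_sides (F : 'I_N -> 'I_d.+1 -> R) :
  (forall p, conforming Th GD p -> \sum_t \sum_j F t j * p t j = 0) ->
  (forall t t' j j', t != t' -> side (Th t) j = side (Th t') j' ->
     F t j + F t' j' = 0) /\
  (forall t j, side (Th t) j `<=` GN -> F t j = 0).
Proof.
move=> orth.
pose p t j : 'I_N -> 'I_d.+1 -> R := fun s k => (`[< side (Th s) k = side (Th t) j >])%:R.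
have pc t j : ~ (side (Th t) j `<=` GD) -> conforming Th GD (p t j).
  move=> nD; split=> [s s' k k' SS'|s k SD]; first by rewrite /p SS'.
  by rewrite /p asboolF// => SE; apply: nD; rewrite -SE.
have one t j : p t j t j = 1 by rewrite /p asboolT.
have inner t j k : k != j -> p t j t k = 0.
  by move=> kj; rewrite /p asboolF// => /(side_inj hd (nd t)) E; rewrite E eqxx in kj.
split=> [t t' j j' tt' SS'|t j SN].
  have nD : ~ (side (Th t) j `<=` GD).
    move=> /(gd_boundary hd hTh hG) /(boundary_side_unique hd hOm hTh) /(_ SS')[E _].
    by rewrite E eqxx in tt'.
  have pE : p t j = p t' j' by rewrite /p SS'.
  have := orth _ (pc t j nD); rewrite (bigD1 t)//= (bigD1 t') /=; last by rewrite eq_sym.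
  rewrite [X in _ + (_ + X)]big1 ?addr0; last first.
    move=> s /andP[st st']; apply: big1 => k _; rewrite /p asboolF ?mulr0// => SE.
    by apply: (side_unique hd hTh tt' _ _ SS' (esym SE)); rewrite eq_sym.
  rewrite (bigD1 j)//= one mulr1 big1 ?addr0 => [|k kj]; last by rewrite inner ?mulr0.
  rewrite pE (bigD1 j')//= one mulr1 big1 ?addr0// => k kj.
  by rewrite inner ?mulr0.
have nD : ~ (side (Th t) j `<=` GD).
  by move=> SD; exact: (gd_gn_disjoint hd hTh hG SD SN).
have := orth _ (pc t j nD); rewrite (bigD1 t)//= [X in _ + X]big1 ?addr0.
  by rewrite (bigD1 j)//= one mulr1 big1 ?addr0// => k kj; rewrite inner ?mulr0.
move=> s st; apply: big1 => k _; rewrite /p asboolF ?mulr0// => SE.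
have [E _] := boundary_side_unique hd hOm hTh (gn_boundary hd hTh hG SN) (esym SE).
by rewrite E eqxx in st.
Qed.

(** Approximate each supremum by the value at one point. *)
Lemma conjugate_sum_le (phi : V -> R) (w : 'I_N -> R) (a : 'I_N -> V) (B : R) :
  (forall t, 0 < w t) ->
  (forall q : 'I_N -> V, \sum_t w t * (dotp (a t) (q t) - phi (q t)) <= B) ->
  (\sum_t (w t)%:E * convex_conjugate phi (a t) <= B%:E)%E.
Proof.
move=> w0 wB; pose val t r := dotp (a t) r - phi r.
have fin t : convex_conjugate phi (a t) \is a fin_num.
  rewrite fin_numE convex_conjugate_gtNy /=; apply/eqP => coo.
  pose C := B - \sum_(s | s != t) w s * val s 0.
  suff : (convex_conjugate phi (a t) <= (C / w t)%:E)%E by rewrite coo leye_eq.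
  apply: ge_ereal_sup => _ [r _ <-]; rewrite lee_fin ler_pdivlMr// mulrC.
  have := wB (fun s => if s == t then r else 0); rewrite (bigD1 t)//= eqxx.
  under eq_bigr => s st do rewrite (negbTE st).
  by rewrite -lerBrDr.
apply/lee_addgt0Pr => e e0; pose W := \sum_t w t.
have W0 : 0 <= W by apply: sumr_ge0 => t _; exact: ltW.
pose e' := e / (1 + W); have e'0 : 0 < e' by rewrite divr_gt0// ltr_pwDl.
have approx t : exists r, fine (convex_conjugate phi (a t)) - e' < val t r.
  have [_ [r _ <-]] := ub_ereal_sup_adherent e'0 (fin t).
  by rewrite -[X in (X - _)%E](fineK (fin t)) -EFinB lte_fin => h; exists r.
have [q hq] := choice approx.
have -> : (\sum_t (w t)%:E * convex_conjugate phi (a t) =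
    (\sum_t w t * fine (convex_conjugate phi (a t)))%:E)%E.
  by rewrite -sumEFin; apply: eq_bigr => t _; rewrite EFinM fineK.
rewrite -EFinD lee_fin.
apply: (@le_trans _ _ (\sum_t (w t * val t (q t) + w t * e'))).
  apply: ler_sum => t _; rewrite -mulrDr ler_pM2l// -lerBlDr ltW//.
rewrite big_split /= lerD ?wB// -mulr_suml -/W /e' mulrCA ler_piMr ?(ltW e0)//.
by rewrite ler_pdivrMr ?ltr_pwDl// mul1r lerDr.
Qed.

Lemma energy_convex (phi : V -> R) (p : 'I_N -> 'I_d.+1 -> R) M : convex_ineq phi ->
  convex_ineq (fun P : {ffun 'I_N * 'I_d.+1 -> R} =>
    energy Th phi (fun t j => p t j + P (t, j)) - M).
Proof.
move=> cphi P Q r s r0 s0; have rs : r + s != 0 by rewrite gt_eqF ?addr_gt0.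
rewrite !mulrBr addrACA -opprD -mulrDl lerD2r /energy !mulr_sumr -big_split /=.
apply: ler_sum => t _; rewrite !(mulrCA _ (vol (Th t))) -mulrDr ler_pM2l//.
set x := cr_grad _ (fun j => p t j + P _); set z := cr_grad _ (fun j => p t j + Q _).
have -> : cr_grad (Th t) (fun j => p t j +
    ((r + s)^-1 *: (r *: P + s *: Q)) (t, j)) = (r + s)^-1 *: (r *: x + s *: z).
  rewrite /x /z -!cr_gradZ -cr_gradD -cr_gradZ; congr cr_grad.
  by apply/funext => j; rewrite !ffunE /GRing.scale /=; field.
exact: cphi.
Qed.

(** The linear part of the constraints in [feasible], one summand for each of
the three families. *)
Let constraint := ((('I_N * 'I_d.+1) * ('I_N * 'I_d.+1) + 'I_N * 'I_d.+1) + 'I_N)%type.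

Let coef (i : constraint) (q : 'I_N * 'I_d.+1) : R :=
  match i with
  | inl (inl (q1, q2)) => if `[< side (Th q1.1) q1.2 = side (Th q2.1) q2.2 >]
      then (q == q1)%:R - (q == q2)%:R else 0
  | inl (inr q1) => if `[< side (Th q1.1) q1.2 `<=` GD >] then (q == q1)%:R else 0
  | inr t => (q.1 == t)%:R
  end.

Let sum_delta (P : 'I_N * 'I_d.+1 -> R) q1 : \sum_q (q == q1)%:R * P q = P q1.
Proof.
rewrite (bigD1 q1)//= eqxx mul1r big1 ?addr0// => q /negbTE ->.
by rewrite mul0r.
Qed.

Let sum_pair (P : 'I_N * 'I_d.+1 -> R) : \sum_q P q = \sum_t \sum_j P (t, j).
Proof. by rewrite pair_big /=; apply: eq_bigr => -[]. Qed.

Let coef_conforming (p : 'I_N -> 'I_d.+1 -> R) :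
  (forall i : ('I_N * 'I_d.+1) * ('I_N * 'I_d.+1) + 'I_N * 'I_d.+1,
    \sum_q coef (inl i) q * p q.1 q.2 = 0) <-> conforming Th GD p.
Proof.
have E1 q1 q2 : \sum_q coef (inl (inl (q1, q2))) q * p q.1 q.2 =
    if `[< side (Th q1.1) q1.2 = side (Th q2.1) q2.2 >]
    then p q1.1 q1.2 - p q2.1 q2.2 else 0.
  rewrite /=; case: asboolP => _; last by rewrite big1// => q _; rewrite mul0r.
  under eq_bigr do rewrite mulrBl.
  by rewrite sumrB !(sum_delta (fun q => p q.1 q.2)).
have E2 q1 : \sum_q coef (inl (inr q1)) q * p q.1 q.2 =
    if `[< side (Th q1.1) q1.2 `<=` GD >] then p q1.1 q1.2 else 0.
  rewrite /=; case: asboolP => _; last by rewrite big1// => q _; rewrite mul0r.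
  by rewrite (sum_delta (fun q => p q.1 q.2)).
split=> [h|[h1 h2] [[q1 q2]|q1]].
- split=> [t t' j j' SS'|t j SD].
    have := h (inl ((t, j), (t', j'))); rewrite E1 asboolT// => /eqP.
    by rewrite subr_eq0 => /eqP.
  by have := h (inr (t, j)); rewrite E2 asboolT.
- by rewrite E1; case: asboolP => // /h1 ->; rewrite subrr.
by rewrite E2; case: asboolP => // /h2.
Qed.

(** The multipliers [y] for the convex function [energy (p0 + P) - M] give a
functional [P |-> \sum F P + \sum be P] below it, in which [F] is orthogonal
to all conforming [P] and [be] belongs to the constraints on the means. The
numbers [F] are the fluxes of an admissible field [a], [b]. Since the energy
only depends on the gradients, the functional vanishes on constants, so it is
the pairing of [a] with the gradients. Maximizing over all gradients turns the
energy into its conjugate. *)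
Lemma strong_duality (phi : V -> R) m p0 (M : R) : convex_ineq phi ->
  feasible Th GD m p0 -> (forall p, feasible Th GD m p -> M <= energy Th phi p) ->
  exists ab, admissible Th GN ab /\ (M%:E <= dual_value Th phi m ab)%E.
Proof.
move=> cphi [p0c p0m] Mp.
have [|y hy] := lagrange_multipliers (k := coef) (energy_convex p0 M cphi).
  move=> P hP; rewrite subr_ge0; apply: Mp; split.
    apply/coef_conforming => i; have /coef_conforming/(_ i) := p0c.
    move=> h0.
    under eq_bigr => q _ do rewrite mulrDr -surjective_pairing.
    by rewrite big_split /= h0 (hP (inl i)) addr0.
  move=> t; rewrite big_split /= p0m -[RHS]addr0; congr (_ + _).
  have := hP (inr t); rewrite (sum_pair (fun q => coef (inr t) q * P q)) (bigD1 t)//=.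
  rewrite [X in _ + X]big1 ?addr0 => [h|s st].
    rewrite -[RHS]h; by apply: eq_bigr => j _; rewrite eqxx mul1r.
  by apply: big1 => j _; rewrite (negbTE st) mul0r.
pose F t j := \sum_i y (inl i) * coef (inl i) (t, j).
pose be t := y (inr t).
have gamE t j : \sum_i y i * coef i (t, j) = F t j + be t.
  rewrite big_sumType /=; congr (_ + _).
  rewrite (bigD1 t)//= eqxx mulr1 big1 ?addr0// => s st.
  by rewrite eq_sym (negbTE st) mulr0.
have {}hy (P : 'I_N -> 'I_d.+1 -> R) : \sum_t \sum_j (F t j + be t) * P t j <=
    energy Th phi (fun t j => p0 t j + P t j) - M.
  have := hy [ffun q => P q.1 q.2]; rewrite sum_pair.
  rewrite (eq_bigr (fun t => \sum_j (F t j + be t) * P t j)); last first.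
    by move=> t _; apply: eq_bigr => j _; rewrite gamE ffunE.
  move/le_trans; apply; rewrite lerD2r /energy le_eqVlt; apply/orP; left; apply/eqP.
  apply: eq_bigr => t _; congr (_ * phi (cr_grad _ _)).
  by apply/funext => j; rewrite ffunE.
have Forth p : conforming Th GD p -> \sum_t \sum_j F t j * p t j = 0.
  move=> /coef_conforming pc.
  rewrite -(sum_pair (fun q => F q.1 q.2 * p q.1 q.2)).
  under eq_bigr do rewrite /F mulr_suml.
  rewrite exchange_big /= big1// => i _.
  under eq_bigr do rewrite -surjective_pairing -mulrA.
  by rewrite -mulr_sumr pc mulr0.
have hab t : exists ab : V * R, forall j, flux (Th t) ab.1 ab.2 j = F t j.
  by have [a [b h]] := flux_onto (F t) (nd t); exists (a, b).
have [ab hF] := choice hab.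
pose a t := (ab t).1; pose b t := (ab t).2.
have abN : admissible Th GN (a, b).
  have [h1 h2] := orthogonal_sides Forth.
  split=> [t t' j j' tt' SS'|t j SN] /=; rewrite /a /b !hF; [exact: h1|exact: h2].
(* Adding constants on an element leaves the energy unchanged. *)
have gam0 t : \sum_j (F t j + be t) = 0.
  set c := \sum_j _; apply/eqP/negPn/negP => c0.
  pose D := energy Th phi p0 - M.
  have := hy (fun s j => (s == t)%:R * ((D + 1) / c)).
  rewrite (bigD1 t)//= [X in _ + X]big1 ?addr0 => [|s st]; last first.
    by apply: big1 => j _; rewrite (negbTE st) mul0r mulr0.
  rewrite eqxx mul1r -mulr_suml -/c mulrC divfK//.
  rewrite (_ : energy _ _ _ = energy Th phi p0); last first.
    apply: eq_bigr => s _; congr (_ * phi _).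
    by rewrite cr_gradD cr_grad_cst addr0.
  by rewrite -/D gerDl ler10.
(* The multipliers of the means cancel the divergences. *)
have lin (P : 'I_N -> 'I_d.+1 -> R) : \sum_t \sum_j (F t j + be t) * P t j =
    \sum_t vol (Th t) * dotp (a t) (cr_grad (Th t) (P t)).
  apply: eq_bigr => t _; under eq_bigr do rewrite mulrDl -hF.
  have d1 : d.+1%:R != 0 :> R by rewrite pnatr_eq0.
  have := gam0 t; rewrite big_split /= sumr_const card_ord -mulr_natl.
  have := flux_pairing (a t) (b t) (fun=> 1) (nd t).
  rewrite cr_grad_cst dotp0r add0r sumr_const card_ord mulVf// mulr1.
  rewrite (eq_bigr (F t)) => [|j _]; last by rewrite mulr1 hF.
  move=> -> bet; rewrite big_split /= flux_pairing// -mulr_sumr mulrDr.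
  have -> : be t = - (vol (Th t) * (d%:R * b t)) / d.+1%:R.
    by rewrite -[be t](mulKf d1) mulrC; congr (_ / _); lra.
  by rewrite -addrA -[RHS]addr0; congr (_ + _); ring.
exists (a, b); split=> //.
pose B := \sum_t vol (Th t) * dotp (a t) (cr_grad (Th t) (p0 t)) - M.
have XB : (\sum_t (vol (Th t))%:E * convex_conjugate phi (a t) <= B%:E)%E.
  apply: conjugate_sum_le => // q.
  pose u t j := aff 0 (q t) (side_mid (Th t) j).
  have := hy (fun t j => u t j + -1 * p0 t j); rewrite lin.
  rewrite (eq_bigr (fun t => vol (Th t) * dotp (a t) (q t) -
      vol (Th t) * dotp (a t) (cr_grad (Th t) (p0 t)))); last first.
    move=> t _; rewrite cr_gradD cr_gradZ /u cr_grad_aff// scaleN1r dotpBr.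
    by rewrite mulrBr.
  rewrite (_ : energy _ _ _ = \sum_t vol (Th t) * phi (q t)); last first.
    apply: eq_bigr => t _; congr (_ * phi _); rewrite -[RHS](cr_grad_aff hd 0 (q t) (nd t)).
    by congr cr_grad; apply/funext => j; rewrite mulN1r addrCA subrr addr0.
  rewrite sumrB /B => h; under eq_bigr do rewrite mulrBr.
  by rewrite sumrB; lra.
have := feasible_pairing abN (conj p0c p0m); rewrite /dual_value /= -/(b _).
set S := \sum_t m t * _ => SE; move: XB; rewrite /B SE.
set X := (\sum_t _)%E; case: X => [x| |] //=; first by rewrite !lee_fin; lra.
by move=> _; rewrite addye// leey.
Qed.

End duality.

Theorem corollary3p4 (R : realType) (d : nat) (hd : (0 < d)%N)
    (Om : set 'rV[R]_d) (hOm : bounded_polyhedral_lipschitz_domain Om)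
    (N : nat) (Th : 'I_N -> 'I_d.+1 -> 'rV[R]_d)
    (hTh : regular_triangulation Om Th)
    (GD GN : set 'rV[R]_d) (hG : boundary_partition Om Th GD GN)
    (ubar : 'rV[R]_d -> R) (hubar : Pi_h_CR_D Om Th GD ubar)
    (phi : 'rV[R]_d -> R) (hphi : continuous phi)
    (hconv : convex_function [set: 'rV[R]_d] phi) :
  (ereal_sup (dual_values Om Th GN phi ubar) <=
     ereal_inf (primal_values Om Th GD phi ubar))%E /\
  (Ck 1 phi ->
   ereal_inf (primal_values Om Th GD phi ubar) \is a fin_num ->
   ereal_inf (primal_values Om Th GD phi ubar) =
     ereal_sup (dual_values Om Th GN phi ubar)).
Proof.
have [m um] := Pi_h_CR_D_cst hOm hTh hubar.
have cphi := convex_function_ineq hconv.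
rewrite (primal_valuesE hd hOm hTh GD phi um) (dual_valuesE hd hOm hTh GN phi um).
have weak : (ereal_sup [set dual_value Th phi m ab | ab in admissible Th GN] <=
    ereal_inf [set (energy Th phi p)%:E | p in feasible Th GD m])%E.
  apply: ge_ereal_sup => _ [ab abN <-]; apply: le_ereal_inf_tmp => _ [p pf <-].
  exact: (weak_duality hd hOm hTh hG).
split=> // _ fin_inf; apply/eqP; rewrite eq_le weak andbT.
have [p0 p0f] : exists p, feasible Th GD m p.
  apply: contrapT => /forallNP h; move: fin_inf.
  rewrite (_ : image _ _ = set0) ?ereal_inf0//.
  by apply/seteqP; split=> [x [p /h]|x].
rewrite -(fineK fin_inf); set M := fine _.
have Mp p : feasible Th GD m p -> M <= energy Th phi p.
  by move=> pf; rewrite -lee_fin fineK//; apply: ereal_inf_lbound; exists p.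
have [ab [abN MD]] := strong_duality hd hOm hTh hG cphi p0f Mp.
by apply: (le_trans MD); apply: ereal_sup_ubound; exists ab.
Qed.
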